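(* Let $\hbar>0$ and let $f\in L^2(\mathbb{R})$ be such that the nodal set $\mathcal{N}(Wf)=\{z\in\mathbb{R}^2:Wf(z)=0\}$ is bounded. Then $\mathcal{N}(Wf)$ does not contain any (nondegenerate) line segment.
   Context: $Wf(x,p)=\frac{1}{2\pi\hbar}\int_{\mathbb{R}} f(x+\tau/2)\overline{f(x-\tau/2)}e^{-\frac{i}{\hbar}p\tau}\,d\tau$ for $(x,p)\in\mathbb{R}^2$. *)

(* Defs.v *)
From mathcomp Require Import all_boot all_algebra.
From mathcomp Require Import all_classical all_reals all_analysis.
From mathcomp Require Import complex.
Set Implicit Arguments. Unset Strict Implicit. Unset Printing Implicit Defensive.
Import GRing.Theory Num.Theory.
Local Open Scope ring_scope.
Local Open Scope complex_scope.

Section Wigner.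
Variable R : realType.

Definition cre (z : R[i]) : R := complex.Re z.
Definition cim (z : R[i]) : R := complex.Im z.

Definition L2 (f : R -> R[i]) : Prop :=
  measurable_fun setT (fun x => cre (f x)) /\
  measurable_fun setT (fun x => cim (f x)) /\
  (\int[@lebesgue_measure R]_x (((cre (f x)) ^+ 2 + (cim (f x)) ^+ 2)%:E)
     < +oo)%E.

Definition cintegral (g : R -> R[i]) : R[i] :=
  (Rintegral (@lebesgue_measure R) setT (fun t => cre (g t)))
  +i* (Rintegral (@lebesgue_measure R) setT (fun t => cim (g t))).

Definition expi (theta : R) : R[i] := cos theta +i* sin theta.

Definition Wigner (hbar : R) (f : R -> R[i]) (x p : R) : R[i] :=
  ((2 * pi * hbar)^-1)%:C *
  cintegral (fun tau => f (x + tau / 2) * (f (x - tau / 2))^*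
                        * expi (- (p * tau / hbar))).

Definition nodal_bounded (hbar : R) (f : R -> R[i]) : Prop :=
  exists M : R, forall z : R * R, Wigner hbar f z.1 z.2 = 0 ->
    `|z.1| <= M /\ `|z.2| <= M.

Definition segment (a b : R * R) : set (R * R) :=
  [set z | exists2 t : R, 0 <= t <= 1 &
     z = (a.1 + t * (b.1 - a.1), a.2 + t * (b.2 - a.2))].

End Wigner.

(* Main.v *)
Require Import Defs.
From mathcomp Require Import all_boot all_order all_algebra.
From mathcomp Require Import all_classical all_reals all_analysis.
From mathcomp Require Import measurable_realfun complex ring lra.
Set Implicit Arguments. Unset Strict Implicit. Unset Printing Implicit Defensive.
Import Order.TTheory GRing.Theory Num.Theory.
Import numFieldNormedType.Exports.
Local Open Scope classical_set_scope.
Local Open Scope ring_scope.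

(** Write f = a + i b. After rescaling p, the Wigner function of f is the real
    number W(x,p) = int Re (f(x+s) conj(f(x-s)) e^{-ips}) ds, which is continuous in
    each variable, so a bounded nodal set forces W(x,.) to have constant sign for
    |x| large. A function whose transform has constant sign is bounded by its
    averages near 0 (test against tent functions, whose transforms are nonnegative,
    then pass to Lebesgue points); this gives |f(u)||f(v)| <= 4 |f((u+v)/2)|^2 for
    almost all u, v with |u+v| large.
    Fixing v in a bounded set of positive mass, smallness of f beyond z is squared
    beyond 2z, so f decays exponentially. The same argument for W(.,p) applies to the
    Fourier transform of f.
    Hence W is real analytic on vertical and on horizontal lines, and if it
    vanished on a segment of such a line it would vanish on a half-line,
    contradicting boundedness. Multiplying f by e^{i alpha x^2} shears phase space
    and turns any other segment into a horizontal one.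

    To stay within real integrals, the Fourier transform is replaced by the Hartley
    transform, with kernel cas = cos + sin. *)

(** * Integrals on the real line *)

(** The two directions are not on the same footing. For f merely in L2, W(x,.) is for every x the
    transform of an integrable function, but W(.,p) is not known to be integrable and the Fourier
    transform of f is not an absolutely convergent integral. Hence the decay of f has to precede
    everything on the Fourier side: it puts f in L1, and only then is W(.,p) integrable, with a
    transform expressed through that of f. On a horizontal line, inversion then exhibits W(.,p) as
    the transform of an exponentially decaying function. With the Hartley kernel, the real plus the
    imaginary part of f(x+s) conj(f(x-s)) stands for the complex product. Replacing s by -s gives
    the real minus the imaginary part, and both together recover |f(u)||f(v)|. The constant 4 is 2
    times 2: one factor is the bound |cas| <= 2, the other comes from bounding the product by
    |f(x+s)|^2 + |f(x-s)|^2, whose averages near s = 0 tend to 2|f(x)|^2. *)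

Section affine.
Context {R : realType}.
Local Notation mu := (@lebesgue_measure R).

Lemma measurable_affine (c d : R) : measurable_fun setT (fun x : R => c * x + d).
Proof. by apply: measurable_funD => //; apply: measurable_funM. Qed.

(** Multiplying the image measure by [c] restores the lengths of intervals, and these determine
    Lebesgue measure. *)
Lemma lebesgue_measure_affine (c d : R) (A : set R) : 0 < c -> measurable A ->
  (mu ((fun x => (c * x + d)%R) @^-1` A) = (c^-1)%:E * mu A)%E.
Proof.
move=> c0 mA.
pose phi : measurableTypeR R -> measurableTypeR R := fun x => c * x + d.
have mphi : measurable_fun setT phi by exact: measurable_affine.
have cc : 0 <= c by exact: ltW.
have K := @lebesgue_measure_unique R (mscale (NngNum cc) (pushforward mu phi)).
have H (X : set R) : ocitv X -> mu X = mscale (NngNum cc) (pushforward mu phi) X.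
  move=> [[a b] _ <-] /=.
  rewrite /mscale/= /pushforward.
  have -> : phi @^-1` `]a, b]%classic = `]((a - d) / c), ((b - d) / c)]%classic.
    apply/seteqP; split => x /=; rewrite /phi !in_itv/= ltr_pdivrMr// ler_pdivlMr//.
      by rewrite ltrBlDr lerBrDr ![x * c]mulrC.
    by rewrite ltrBlDr lerBrDr ![x * c]mulrC.
  rewrite !lebesgue_measure_itv/= !lte_fin ltr_pM2r ?invr_gt0// ltrD2r.
  case: ifPn => ab; last by rewrite mule0.
  by rewrite -!EFinB -EFinM; congr EFin; field; rewrite gt_eqF.
have -> : (mu A = c%:E * mu (phi @^-1` A))%E by exact: (K mphi (H mphi) A mA).
by rewrite muleA -EFinM mulVf ?gt_eqF// mul1e.
Qed.

Lemma ge0_integral_affine (c d : R) (f : R -> \bar R) : 0 < c ->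
  measurable_fun setT f -> (forall x, 0 <= f x)%E ->
  (\int[mu]_x f (c * x + d)%R = (c^-1)%:E * \int[mu]_x f x)%E.
Proof.
move=> c0 mf f0.
pose phi : measurableTypeR R -> measurableTypeR R := fun x => c * x + d.
have mphi : measurable_fun setT phi by exact: measurable_affine.
have cc : 0 <= c^-1 by rewrite invr_ge0 ltW.
have := @ge0_integral_pushforward _ _ _ _ R phi mphi mu setT f measurableT mf (fun y _ => f0 y).
rewrite preimage_setT => <-.
rewrite -(@ge0_integral_mscale _ _ R mu setT measurableT (NngNum cc) f)//.
by apply: eq_measure_integral => A mA _; exact: lebesgue_measure_affine.
Qed.

Lemma ge0_integral_opp (f : R -> \bar R) :
  measurable_fun setT f -> (forall x, 0 <= f x)%E ->
  (\int[mu]_x f (- x)%R = \int[mu]_x f x)%E.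
Proof.
move=> mf f0.
pose phi : measurableTypeR R -> measurableTypeR R := fun x => - x.
have mphi : measurable_fun setT phi by exact: measurable_funN.
have := @ge0_integral_pushforward _ _ _ _ R phi mphi mu setT f measurableT mf (fun y _ => f0 y).
rewrite preimage_setT => <-.
by apply: eq_measure_integral => A mA _; exact: lebesgue_measureN.
Qed.

End affine.

Notation L1 f := ((@lebesgue_measure _).-integrable setT (EFin \o f)).

Section L1_theory.
Context {R : realType}.
Local Notation mu := (@lebesgue_measure R).
Implicit Types f g h : R -> R.

Lemma lebesgue_aeS (P Q : R -> Prop) : (forall x, P x -> Q x) ->
  {ae mu, forall x, P x} -> {ae mu, forall x, Q x}.
Proof. by apply: filterS; exact: (ae_filter_ringOfSetsType mu). Qed.

Lemma lebesgue_aeS2 (P Q S : R -> Prop) : (forall x, P x -> Q x -> S x) ->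
  {ae mu, forall x, P x} -> {ae mu, forall x, Q x} -> {ae mu, forall x, S x}.
Proof. by apply: filterS2; exact: (ae_filter_ringOfSetsType mu). Qed.

Lemma L1_measurable f : L1 f -> measurable_fun setT f.
Proof. by move=> /measurable_int/measurable_EFinP. Qed.

Lemma L1_lty f : L1 f -> (\int[mu]_x `|f x|%:E < +oo)%E.
Proof. by move=> /integrableP[_]. Qed.

Lemma L1P f : measurable_fun setT f -> (\int[mu]_x `|f x|%:E < +oo)%E -> L1 f.
Proof. by move=> mf foo; apply/integrableP; split => //; exact/measurable_EFinP. Qed.

Lemma L1_le f g : measurable_fun setT f -> (forall x, `|f x| <= g x) -> L1 g -> L1 f.
Proof.
move=> mf fg Lg; apply: (le_integrable measurableT _ _ Lg); first exact/measurable_EFinP.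
by move=> x _ /=; rewrite lee_fin (le_trans (fg x))// ler_norm.
Qed.

Lemma L1_abs f : L1 f -> L1 (fun x => `|f x|).
Proof. by move=> /integrable_norm. Qed.

Lemma L1_ae f g : L1 f -> measurable_fun setT g -> {ae mu, forall x, f x = g x} -> L1 g.
Proof.
move=> Lf mg fg; apply: L1P => //.
have -> : (\int[mu]_x `|g x|%:E = \int[mu]_x `|f x|%:E)%E; last exact: L1_lty.
apply: ge0_ae_eq_integral => //.
- by apply/measurable_EFinP/measurableT_comp.
- by apply/measurable_EFinP/measurableT_comp => //; exact: L1_measurable.
- by move: fg; apply: lebesgue_aeS => x /= -> _.
Qed.

Lemma L1D f g : L1 f -> L1 g -> L1 (fun x => f x + g x).
Proof. by move=> Lf Lg; exact: (integrableD measurableT Lf Lg). Qed.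

Lemma L1B f g : L1 f -> L1 g -> L1 (fun x => f x - g x).
Proof. by move=> Lf Lg; exact: (integrableB measurableT Lf Lg). Qed.

Lemma L1Z c f : L1 f -> L1 (fun x => c * f x).
Proof. by move=> Lf; exact: (integrableZl measurableT c Lf). Qed.

Lemma L1M h g C : measurable_fun setT h -> (forall x, `|h x| <= C) -> L1 g ->
  L1 (fun x => h x * g x).
Proof.
move=> mh hC Lg; apply: (@L1_le _ (fun x => C * `|g x|)).
- by apply: measurable_funM => //; exact: L1_measurable.
- by move=> x; rewrite normrM ler_wpM2r.
- exact/L1Z/L1_abs.
Qed.

Lemma L1_affine c d f : 0 < c -> L1 f -> L1 (fun x => f (c * x + d)).
Proof.
move=> c0 Lf; have mf := L1_measurable Lf; apply: L1P.
  by apply: (measurableT_comp mf); exact: measurable_affine.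
rewrite (ge0_integral_affine _ (f := fun x => `|f x|%:E))//.
- by rewrite lte_mul_pinfty ?lee_fin ?invr_ge0 ?ltW// L1_lty.
- by apply/measurable_EFinP/measurableT_comp.
Qed.

Lemma L1_opp f : L1 f -> L1 (fun x => f (- x)).
Proof.
move=> Lf; have mf := L1_measurable Lf; apply: L1P.
  by apply: (measurableT_comp mf); exact: measurable_funN.
rewrite (ge0_integral_opp (f := fun x => `|f x|%:E))//; first exact: L1_lty.
by apply/measurable_EFinP/measurableT_comp.
Qed.

(** Carries changes of variables over from nonnegative to integrable functions. *)
Lemma Rint_pos_neg f : L1 f ->
  \int[mu]_x f x = \int[mu]_x (f^\+ x) - \int[mu]_x (f^\- x).
Proof.
move=> Lf; rewrite -RintegralB//.
- by apply: eq_Rintegral => x _; rewrite -[in LHS](funrposBneg f).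
- exact: integrable_funrpos.
- exact: integrable_funrneg.
Qed.

Lemma Rint_affine c d f : 0 < c -> L1 f ->
  \int[mu]_x f (c * x + d) = c^-1 * \int[mu]_x f x.
Proof.
move=> c0 Lf; rewrite (Rint_pos_neg (L1_affine d c0 Lf)) (Rint_pos_neg Lf).
have H g : (forall x, 0 <= g x) -> L1 g ->
    \int[mu]_x g (c * x + d) = c^-1 * \int[mu]_x g x.
  move=> g0 Lg; rewrite /Rintegral (ge0_integral_affine _ (f := fun x => (g x)%:E))//.
  - by rewrite fineM// integrable_fin_num.
  - by apply/measurable_EFinP; exact: L1_measurable Lg.
rewrite mulrBr -(H f^\+) -?(H f^\-)//; [exact: integrable_funrneg|exact: integrable_funrpos].
Qed.

Lemma Rint_opp f : L1 f -> \int[mu]_x f (- x) = \int[mu]_x f x.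
Proof.
move=> Lf; rewrite (Rint_pos_neg (L1_opp Lf)) (Rint_pos_neg Lf).
have H g : (forall x, 0 <= g x) -> L1 g -> \int[mu]_x g (- x) = \int[mu]_x g x.
  move=> g0 Lg; rewrite /Rintegral (ge0_integral_opp (f := fun x => (g x)%:E))//.
  by apply/measurable_EFinP; exact: L1_measurable Lg.
rewrite -(H f^\+) -?(H f^\-)//; [exact: integrable_funrneg|exact: integrable_funrpos].
Qed.

Lemma Rint_le f g : L1 f -> L1 g -> (forall x, f x <= g x) ->
  \int[mu]_x f x <= \int[mu]_x g x.
Proof. by move=> Lf Lg fg; apply: le_Rintegral. Qed.

Lemma Rint_norm_le f g : L1 f -> L1 g -> (forall x, `|f x| <= g x) ->
  `|\int[mu]_x f x| <= \int[mu]_x g x.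
Proof.
move=> Lf Lg fg; apply: le_trans (le_normr_Rintegral measurableT Lf) _.
by apply: Rint_le => //; exact: L1_abs.
Qed.

(** The device that lets real integrals replace complex ones: two integrands are exchanged by
    arranging that their difference is odd. *)
Lemma Rint_odd f : L1 f -> (forall x, f (- x) = - f x) -> \int[mu]_x f x = 0.
Proof.
move=> Lf odd; have := Rint_opp Lf.
under eq_Rintegral do rewrite odd -mulN1r.
by rewrite RintegralZl// => h; lra.
Qed.

End L1_theory.

Lemma measurable_cos (R : realType) : measurable_fun setT (@cos R).
Proof. by apply: continuous_measurable_fun; exact: continuous_cos. Qed.
Lemma measurable_sin (R : realType) : measurable_fun setT (@sin R).
Proof. by apply: continuous_measurable_fun; exact: continuous_sin. Qed.

Ltac mfun := repeat first
  [ assumption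
  | apply: measurable_cst | apply: measurable_id
  | apply: measurable_fst | apply: measurable_snd
  | apply: measurable_cos | apply: measurable_sin | apply: measurable_expR
  | match goal with
    | |- measurable_fun _ (fun x => _ + _) => apply: measurable_funD
    | |- measurable_fun _ (fun x => - _) => apply: measurable_funN
    | |- measurable_fun _ (fun x => _ * _) => apply: measurable_funM
    | |- measurable_fun _ (fun x => _ ^+ _) => apply: measurable_funX
    | |- measurable_fun _ (fun x => `|_|) => apply: (measurableT_comp (@normr_measurable _ setT))
    | |- measurable_fun _ (fun x => cos (@?h x)) => apply: (measurableT_comp (@measurable_cos _) (g := h))
    | |- measurable_fun _ (fun x => sin (@?h x)) => apply: (measurableT_comp (@measurable_sin _) (g := h))
    | |- measurable_fun _ (fun x => expR (@?h x)) => apply: (measurableT_comp (@measurable_expR _) (g := h))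
    | H : measurable_fun _ ?a |- measurable_fun _ (fun x => ?a (@?h x)) =>
        apply: (measurableT_comp H (g := h))
    end ].

(** * Iterated integrals and the coordinates u = x + s, v = x - s *)

Section Fubini_real.
Context {R : realType}.
Local Notation mu := (@lebesgue_measure R).

Implicit Types F G : R * R -> R.

(** Integrability in the plane, in the form in which it gets verified; by Tonelli it yields
    integrability for the product measure. *)
Definition L1_2 (F : R * R -> R) := measurable_fun setT F /\
  (\int[mu]_x \int[mu]_y `|F (x, y)|%:E < +oo)%E.

Let L1_2_integrable F : L1_2 F -> (mu \x mu)%E.-integrable setT (EFin \o F).
Proof.
move=> [mF Foo]; apply/integrable12ltyP => //.
exact/measurable_EFinP.
Qed.

Lemma L1_2_le F G : measurable_fun setT F -> (forall z, `|F z| <= G z) -> L1_2 G -> L1_2 F.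
Proof.
move=> mF FG [mG Goo]; split => //; apply: le_lt_trans Goo.
have mH (H : R * R -> R) : measurable_fun setT H -> measurable_fun setT (fun z : R * R => `|H z|%:E).
  by move=> mH; apply/measurable_EFinP/measurableT_comp.
apply: ge0_le_integral => //.
- by move=> x _; exact: integral_ge0.
- exact: (measurable_fun_fubini_tonelli_F (m2 := mu) _ (mH _ mF)).
- exact: (measurable_fun_fubini_tonelli_F (m2 := mu) _ (mH _ mG)).
- move=> x _; apply: ge0_le_integral => //.
  + exact: measurableT_comp (mH _ mF) (pair1_measurable x).
  + exact: measurableT_comp (mH _ mG) (pair1_measurable x).
  + by move=> y _; rewrite lee_fin (le_trans (FG _))// ler_norm.
Qed.

Lemma L1_2_prod (a b : R -> R) : L1 a -> L1 b -> L1_2 (fun z => a z.1 * b z.2).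
Proof.
move=> La Lb; have ma := L1_measurable La; have mb := L1_measurable Lb; split.
  by mfun.
have -> : (\int[mu]_x \int[mu]_y `|a x * b y|%:E =
   \int[mu]_x (`|a x|%:E * \int[mu]_y `|b y|%:E))%E.
  apply: eq_integral => x _; rewrite -ge0_integralZl//.
  - by apply: eq_integral => y _; rewrite normrM.
  - by apply/measurable_EFinP/measurableT_comp.
rewrite ge0_integralZr//.
- by rewrite lte_mul_pinfty ?integral_ge0// ?ge0_fin_numE ?integral_ge0//; exact: L1_lty.
- by apply/measurable_EFinP/measurableT_comp.
- exact: integral_ge0.
Qed.

(** The inner integral is finite for almost every [x], so [fine] alters it on a null set only. *)
Let Rint_fineK (F : R * R -> R) : L1_2 F ->
  (\int[mu]_x (\int[mu]_y F (x, y))%R%:E = \int[mu]_x \int[mu]_y (F (x, y))%:E)%E.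
Proof.
move=> LF; have iF := L1_2_integrable LF.
have mFF := measurable_fubini_F iF.
apply: ae_eq_integral => //.
  by apply/measurable_EFinP; exact: (measurableT_comp (fine_measurable measurableT)).
have := ae_integrable1 iF; apply: lebesgue_aeS => x iFx _.
by rewrite /Rintegral fineK//; exact: integrable_fin_num.
Qed.

Let L1_2_swap F : L1_2 F -> L1_2 (fun z => F (z.2, z.1)).
Proof.
move=> [mF Foo]; split.
  by apply: (measurableT_comp mF); apply: measurable_fun_pair; mfun.
rewrite /= -(fubini_tonelli (m1 := mu) (m2 := mu) (fun z => `|F z|%:E))//.
by apply/measurable_EFinP/measurableT_comp.
Qed.

Lemma Rint_Fubini (F : R * R -> R) : L1_2 F ->
  \int[mu]_x \int[mu]_y F (x, y) = \int[mu]_y \int[mu]_x F (x, y).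
Proof.
move=> LF; rewrite {1 3}/Rintegral Rint_fineK//.
rewrite (Rint_fineK (L1_2_swap LF)).
by congr fine; exact: (Fubini (L1_2_integrable LF)).
Qed.

Lemma L1_Fubini (F : R * R -> R) : L1_2 F -> L1 (fun x => \int[mu]_y F (x, y)).
Proof.
move=> LF; have iF := L1_2_integrable LF.
have mFF := measurable_fubini_F iF.
have iFF := integrable_fubini_F iF.
apply/integrableP; split.
  by apply/measurable_EFinP; exact: (measurableT_comp (fine_measurable measurableT)).
move/integrableP : iFF => [_]; apply: le_lt_trans.
apply: ge0_le_integral => //.
- apply: measurableT_comp => //.
  by apply/measurable_EFinP; exact: (measurableT_comp (fine_measurable measurableT)).
- exact: measurableT_comp.
- move=> x _ /=; rewrite /Rintegral /fubini_F /=.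
  by case: (\int[mu]_y _)%E => [r| |] //=; rewrite ?leey.
Qed.

(** With v = x - s, integrating a product at x + s and x - s over s becomes a convolution at the
    point 2x. Integrating in x before v decouples the factors, with Jacobian 1/2. *)
Lemma L1_2_conv (a b : R -> R) : L1 a -> L1 b ->
  L1_2 (fun z => a (2 * z.1 - z.2) * b z.2).
Proof.
move=> La Lb; have ma := L1_measurable La; have mb := L1_measurable Lb.
have m2 : measurable_fun setT (fun z : R * R => a (2 * z.1 - z.2) * b z.2) by mfun.
split => //.
rewrite (fubini_tonelli (m1 := mu) (m2 := mu) (fun z => `|a (2 * z.1 - z.2) * b z.2|%:E))//=; last first.
  by apply/measurable_EFinP/measurableT_comp.
have -> : (\int[mu]_y \int[mu]_x `|a (2 * x - y)%R * b y|%:E =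
   \int[mu]_y (`|b y|%:E * ((2^-1)%:E * \int[mu]_x `|a x|%:E)))%E.
  apply: eq_integral => y _.
  rewrite -(@ge0_integral_affine _ 2 (- y) (fun x => `|a x|%:E))//; last first.
    by apply/measurable_EFinP/measurableT_comp.
  rewrite -ge0_integralZl//.
  - by apply: eq_integral => x _; rewrite normrM mulrC.
  - by apply/measurable_EFinP; mfun.
rewrite ge0_integralZr//.
- have Fa : (\int[mu]_x `|a x|%:E)%E \is a fin_num.
    by rewrite ge0_fin_numE ?integral_ge0//; exact: L1_lty.
  rewrite lte_mul_pinfty ?integral_ge0// ?ge0_fin_numE ?integral_ge0//; first exact: L1_lty.
  by rewrite -(fineK Fa) -EFinM ltry.
- by apply/measurable_EFinP/measurableT_comp.
- by rewrite mule_ge0// integral_ge0.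
Qed.

Lemma Rint_conv (a b : R -> R) : L1 a -> L1 b ->
  \int[mu]_x \int[mu]_v (a (2 * x - v) * b v) = 2^-1 * (\int[mu]_x a x * \int[mu]_x b x).
Proof.
move=> La Lb; rewrite (Rint_Fubini (L1_2_conv La Lb))/=.
transitivity (\int[mu]_y ((2^-1 * \int[mu]_x a x) * b y)).
  apply: eq_Rintegral => y _; rewrite RintegralZr; last 2 first.
  - by [].
  - by apply: (@L1_affine _ 2 (- y)).
  by rewrite (@Rint_affine _ 2 (- y)).
by rewrite RintegralZl// mulrA.
Qed.

(** The coordinates u = x + s, v = x - s have Jacobian 2. They are introduced one at a time: v = 2x
    - u for fixed u, then, after Tonelli, u = x + s for fixed x. *)
Lemma ge0_integral_midpoint (H : R * R -> \bar R) :
  measurable_fun setT H -> (forall z, 0 <= H z)%E ->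
  (\int[mu]_u \int[mu]_v H (u, v) =
    2%:E * \int[mu]_x \int[mu]_s H (x + s, x - s)%R)%E.
Proof.
move=> mH H0.
have mH1 : measurable_fun setT (fun z : R * R => H (z.1, 2 * z.2 - z.1)).
  by apply: (measurableT_comp mH); apply: measurable_fun_pair; mfun.
transitivity (\int[mu]_u (2%:E * \int[mu]_x H (u, 2 * x - u)%R))%E.
  apply: eq_integral => u _.
  rewrite (@ge0_integral_affine _ 2 (- u) (fun v => H (u, v)))//.
    by rewrite muleA -EFinM divff// mul1e.
  exact: (measurableT_comp mH (pair1_measurable u)).
rewrite ge0_integralZl//; last 2 first.
- exact: (measurable_fun_fubini_tonelli_F (m2 := mu) _ mH1).
- by move=> u _; exact: integral_ge0.
congr (_ * _)%E.
rewrite (fubini_tonelli (m1 := mu) (m2 := mu) (fun z => H (z.1, 2 * z.2 - z.1)))//=.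
apply: eq_integral => x _.
have mHx : measurable_fun setT (fun u : R => H (u, 2 * x - u)).
  by apply: (measurableT_comp mH); apply: measurable_fun_pair; mfun.
have := @ge0_integral_affine R 1 x (fun u => H (u, 2 * x - u)) ltr01 mHx.
rewrite invr1 mul1e => <-//.
apply: eq_integral => s _; congr (H (_, _)); ring.
Qed.

Lemma lebesgue_ae_affine c d (P : R -> Prop) : 0 < c ->
  {ae mu, forall x, P x} -> {ae mu, forall x, P (c * x + d)}.
Proof.
move=> c0 [N [mN N0 PN]].
exists ((fun x => c * x + d) @^-1` N); split.
- by rewrite -[X in measurable X]setTI; exact: measurable_affine.
- by rewrite lebesgue_measure_affine// N0 mule0.
- by move=> x /= Px; apply: PN.
Qed.

Lemma lebesgue_ae_opp (P : R -> Prop) :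
  {ae mu, forall x, P x} -> {ae mu, forall x, P (- x)}.
Proof.
move=> [N [mN N0 PN]].
exists ((fun x => - x) @^-1` N); split.
- by rewrite -[X in measurable X]setTI; exact: measurable_funN.
- by rewrite -N0; exact: lebesgue_measureN.
- by move=> x /= Px; apply: PN.
Qed.

End Fubini_real.

(** * The Hartley transform *)

Section calculus.
Context {R : realType}.
Local Notation mu := (@lebesgue_measure R).

Lemma is_derive_mul (c x : R) : is_derive x 1 (fun y => c * y) c.
Proof.
have := @is_deriveZ _ _ _ idfun c x 1 1 (is_derive_id x 1).
by rewrite [c *: 1]mulr1.
Qed.

Lemma is_derive_expM (c x : R) : is_derive x 1 (fun y => expR (c * y)) (c * expR (c * x)).
Proof.
have := is_derive1_comp (is_derive_expR (c * x)) (is_derive_mul c x).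
by rewrite mulrC.
Qed.

Lemma is_derive_sinM (c x : R) : is_derive x 1 (fun y => sin (c * y)) (c * cos (c * x)).
Proof.
have := is_derive1_comp (is_derive_sin (c * x)) (is_derive_mul c x).
by rewrite mulrC.
Qed.

Lemma is_derive_cosM (c x : R) : is_derive x 1 (fun y => cos (c * y)) (- (c * sin (c * x))).
Proof.
have := is_derive1_comp (is_derive_cos (c * x)) (is_derive_mul c x).
by rewrite mulNr mulrC.
Qed.

Lemma Rint_dominated (f_ : nat -> R -> R) (f g : R -> R) :
  (forall n, measurable_fun setT (f_ n)) -> L1 g ->
  (forall n x, `|f_ n x| <= g x) -> (forall x, f_ n x @[n --> \oo] --> f x) ->
  \int[mu]_x f_ n x @[n --> \oo] --> \int[mu]_x f x.
Proof.
move=> mf Lg fg ff.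
have mff : measurable_fun setT f by apply: (measurable_fun_cvg mf) => x _; exact: ff.
have Lf : L1 f.
  apply: (L1_le mff _ Lg) => x.
  apply: (@closed_cvg _ _ \oo _ (fun n => `|f_ n x|) [set y | y <= g x]).
  - exact: closed_le.
  - by apply: nearW => n; exact: fg.
  - by apply: cvg_norm; exact: ff.
apply: fine_cvg; rewrite fineK; last exact: integrable_fin_num.
apply: (dominated_cvg measurableT _ _ _ Lg) => //=.
- by move=> n; apply/measurable_EFinP; exact: mf.
- by move=> x _; apply: cvg_EFin; [exact: nearW|exact: ff].
- by move=> n x _; rewrite lee_fin.
Qed.

Lemma Rint_continuous (F : R -> R -> R) (G : R -> R) (x0 r : R) : 0 < r -> L1 G ->
  (forall x, measurable_fun setT (F x)) -> (forall y, continuous (F ^~ y)) ->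
  (forall x y, `|x - x0| < r -> `|F x y| <= G y) ->
  {for x0, continuous (fun x => \int[mu]_y F x y)}.
Proof.
move=> r0 LG mF cF FG.
have H x : `](x0 - r), (x0 + r)[%classic x -> `|x - x0| < r.
  by rewrite /= in_itv/= ltr_norml => /andP[? ?]; apply/andP; split; lra.
apply: (@continuity_under_integral _ _ _ mu F setT measurableT (x0 - r) (x0 + r) _ _ G LG).
- by move=> x /H xr; apply: (L1_le (mF x) _ LG) => y; exact: FG.
- by apply: aeW => y _ x _; exact: cF.
- by move=> x /H xr; apply: aeW => y _; exact: FG.
- by rewrite inE/= in_itv/=; apply/andP; split; lra.
Qed.

Implicit Types g K : R -> R.

Definition cas (x : R) := cos x + sin x.

Lemma cas_le2 x : `|cas x| <= 2.
Proof. by rewrite (le_trans (ler_normD _ _))// (_ : 2 = 1 + 1) ?lerD ?cos_max ?sin_max//; ring. Qed.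

Lemma measurable_cas : measurable_fun setT cas.
Proof. by rewrite /cas; mfun. Qed.

Lemma continuous_cas : continuous cas.
Proof. by move=> x; apply: cvgD; [exact: continuous_cos|exact: continuous_sin]. Qed.

Lemma casM a b : cas a * cas b = cos (a - b) + sin (a + b).
Proof. by rewrite /cas cosB sinD; ring. Qed.

Lemma cas0 : cas 0 = 1.
Proof. by rewrite /cas cos0 sin0 addr0. Qed.

Definition hartley (g : R -> R) (p : R) := \int[mu]_s (g s * cas (p * s)).

Lemma L1_cas g p : L1 g -> L1 (fun s => g s * cas (p * s)).
Proof.
move=> Lg; rewrite (_ : (fun s => _) = (fun s => cas (p * s) * g s)); last first.
  by apply/funext => s; rewrite mulrC.
apply: (L1M (C := 2)) => // [|s]; last exact: cas_le2.
by have mc := measurable_cas; mfun.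
Qed.

Lemma continuous_hartley g : L1 g -> continuous (hartley g).
Proof.
move=> Lg x; have mg := L1_measurable Lg; have mc := measurable_cas.
apply: (@Rint_continuous (fun p s => g s * cas (p * s)) (fun s => 2 * `|g s|) x 1) => //.
- exact/L1Z/L1_abs.
- by move=> y; mfun.
- move=> y z; apply: cvgM; first exact: cvg_cst.
  have : {for z, continuous (cas \o ( *%R^~ y))}.
    by apply: continuous_comp; [exact: mulrr_continuous|exact: continuous_cas].
  exact.
- by move=> p s _; rewrite normrM mulrC ler_wpM2r// cas_le2.
Qed.

Lemma measurable_hartley g : L1 g -> measurable_fun setT (hartley g).
Proof. by move=> /continuous_hartley; exact: continuous_measurable_fun. Qed.

Lemma hartley_le g p : L1 g -> `|hartley g p| <= 2 * \int[mu]_s `|g s|.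
Proof.
move=> Lg; rewrite -RintegralZl//; last exact: L1_abs.
apply: Rint_norm_le => [||s].
- exact: L1_cas.
- exact/L1Z/L1_abs.
- by rewrite normrM mulrC ler_wpM2r// cas_le2.
Qed.

(* Evenness of K makes the sin (p (s + t)) part of casM integrate to 0 against K. *)
Lemma hartley_mult g K t : L1 g -> L1 K -> (forall p, K (- p) = K p) ->
  \int[mu]_p (hartley g p * K p * cas (p * t)) = \int[mu]_s (g s * hartley K (s - t)).
Proof.
move=> Lg LK evenK.
have mg := L1_measurable Lg; have mK := L1_measurable LK; have mc := measurable_cas.
pose F (z : R * R) := K z.1 * g z.2 * (cas (z.1 * z.2) * cas (z.1 * t)).
have LF : L1_2 F.
  apply: (@L1_2_le _ _ (fun z => (4 * `|K z.1|) * `|g z.2|)).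
  - by rewrite /F; mfun.
  - move=> z; rewrite /F !normrM.
    rewrite (_ : 4 * `|K z.1| * `|g z.2| = `|K z.1| * `|g z.2| * (2 * 2)); last by ring.
    by rewrite ler_wpM2l ?mulr_ge0// ler_pM// cas_le2.
  - exact: (L1_2_prod (L1Z 4 (L1_abs LK)) (L1_abs Lg)).
transitivity (\int[mu]_p \int[mu]_s F (p, s)).
  apply: eq_Rintegral => p _; rewrite /hartley -RintegralZr//; last exact: L1_cas.
  rewrite -RintegralZr//; last first.
    have := L1Z (K p) (L1_cas p Lg); congr (integrable _ _ _).
    by apply/funext => s /=; rewrite mulrC.
  by apply: eq_Rintegral => s _; rewrite /F/=; ring.
rewrite (Rint_Fubini LF); apply: eq_Rintegral => s _.
rewrite /hartley -RintegralZl//; last exact: L1_cas.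
have L0 : L1 (fun p => K p * g s * (cas (p * s) * cas (p * t))).
  have := L1_cas t (L1_cas s (L1Z (g s) LK)); congr (integrable _ _ _).
  by apply/funext => p /=; congr EFin; rewrite [s * p]mulrC [t * p]mulrC; ring.
have L2 : L1 (fun p => g s * (K p * cas ((s - t) * p))) by apply: L1Z; exact: L1_cas.
apply/eqP; rewrite -subr_eq0 -RintegralB//; apply/eqP; apply: Rint_odd; first exact: L1B.
move=> p; rewrite /F/= !casM /cas evenK !mulNr !mulrN.
rewrite (_ : - (p * s) - - (p * t) = - ((s - t) * p)); last by ring.
rewrite (_ : p * s - p * t = (s - t) * p); last by ring.
by rewrite -opprD !cosN !sinN; ring.
Qed.

End calculus.

(** * The Poisson kernel and Hartley inversion *)

Section poisson.
Context {R : realType}.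
Local Notation mu := (@lebesgue_measure R).
Implicit Types (k : R -> R) (e u t x : R).

(** An antiderivative of [expR (- e * x) * (1 + cos (u * x))]. The added 1 makes that integrand
    nonnegative, so its integral over the half-line follows from the limit of the antiderivative,
    without prior knowledge of integrability. *)
Let exp1cos_prim e u x := - e^-1 * expR (- e * x) +
  (e ^+ 2 + u ^+ 2)^-1 * (expR (- e * x) * (u * sin (u * x) - e * cos (u * x))).

Lemma is_derive_exp1cos_prim e u x : 0 < e ->
  is_derive x 1 (exp1cos_prim e u) (expR (- e * x) * (1 + cos (u * x))).
Proof.
move=> e0.
have d1 := is_deriveZ (- e^-1) (is_derive_expM (- e) x).
have d2 := is_deriveB (is_deriveZ u (is_derive_sinM u x)) (is_deriveZ e (is_derive_cosM u x)).
have d3 := is_deriveZ ((e ^+ 2 + u ^+ 2)^-1) (is_deriveM (is_derive_expM (- e) x) d2).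
have d4 := is_deriveD d1 d3.
apply: (is_derive_eq d4); rewrite /= /GRing.scale/=.
rewrite (_ : (u \*: _ - e \*: _) x = u * sin (u * x) - e * cos (u * x))//.
have e1 : e != 0 by rewrite gt_eqF.
have e2 : e ^+ 2 + u ^+ 2 != 0 by rewrite gt_eqF// ltr_wpDr ?sqr_ge0// exprn_gt0.
by field; rewrite e1 e2.
Qed.

Lemma cvg_exp1cos_prim e u : 0 < e -> exp1cos_prim e u x @[x --> +oo] --> (0 : R).
Proof.
move=> e0; have e20 : 0 < e ^+ 2 + u ^+ 2 by rewrite ltr_wpDr ?sqr_ge0// exprn_gt0.
pose C := e^-1 + (e ^+ 2 + u ^+ 2)^-1 * (`|u| + e).
have cE : expR (- e * x) @[x --> +oo] --> (0 : R).
  have -> : (fun x => expR (- e * x)) = (fun y => expR (- y)) \o (fun x => e * x).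
    by apply/funext => x /=; rewrite mulNr.
  apply: (@cvg_comp _ _ _ _ _ _ (+oo)); last exact: cvgr_expR.
  exact: (gt0_cvgMry e0 (@cvg_id _ _)).
have bF x : `|exp1cos_prim e u x| <= C * expR (- e * x).
  rewrite /exp1cos_prim /C mulrDl (le_trans (ler_normD _ _))// lerD//.
    by rewrite normrM normrN (ger0_norm (expR_ge0 _)) ger0_norm ?invr_ge0 ?(ltW e0).
  rewrite normrM ger0_norm ?invr_ge0 ?(ltW e20)// normrM (ger0_norm (expR_ge0 _)).
  rewrite -mulrA ler_wpM2l ?invr_ge0 ?(ltW e20)// [X in _ <= X]mulrC ler_wpM2l ?expR_ge0//.
  rewrite (le_trans (ler_normB _ _))// !normrM lerD//.
    by rewrite ler_piMr// sin_max.
  by rewrite (gtr0_norm e0) ler_piMr ?(ltW e0)// cos_max.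
apply/norm_cvg0P.
apply: (@squeeze_cvgr _ _ _ _ (cst 0) (fun x => C * expR (- e * x))).
- by apply: nearW => x; rewrite normr_ge0 bF.
- exact: cvg_cst.
- by rewrite -(mulr0 C); apply: cvgM; [exact: cvg_cst|exact: cE].
Qed.

Let exp1cos e u x := expR (- (e * `|x|)) * (1 + cos (u * x)).

Lemma exp1cos_ge0 e u x : 0 <= exp1cos e u x.
Proof.
have := cos_max (u * x); rewrite ler_norml => /andP[? _].
by rewrite mulr_ge0 ?expR_ge0//; lra.
Qed.

Lemma continuous_exp1cos e u : continuous (exp1cos e u).
Proof.
move=> x; apply: cvgM.
  apply: (@continuous_comp _ _ _ (fun x => - (e * `|x|)) expR); last exact: continuous_expR.
  apply: cvgN; apply: cvgM; first exact: cvg_cst.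
  exact: norm_continuous.
apply: cvgD; first exact: cvg_cst.
apply: (@continuous_comp _ _ _ (fun x => u * x) cos); last exact: continuous_cos.
exact: mulrl_continuous.
Qed.

Lemma integral_exp1cos e u : 0 < e ->
  (\int[mu]_x (exp1cos e u x)%:E = (2 * (e^-1 + e / (e ^+ 2 + u ^+ 2)))%:E)%E.
Proof.
move=> e0; rewrite ge0_symfun_integralT; last 3 first.
- by move=> x; exact: exp1cos_ge0.
- exact: continuous_exp1cos.
- by move=> x /=; rewrite /exp1cos normrN mulrN cosN.
rewrite EFinM; congr (_ * _)%E.
rewrite -set_itvcy.
transitivity (\int[mu]_(x in `[0%R, +oo[) (expR (- e * x) * (1 + cos (u * x)))%:E)%E.
  apply: eq_integral => x; rewrite inE/= in_itv/= andbT => x0.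
  by rewrite /exp1cos ger0_norm// mulNr.
have cF x : {for x, continuous (exp1cos_prim e u)}.
  by apply: differentiable_continuous; apply/derivable1_diffP; have [] := is_derive_exp1cos_prim u x e0.
rewrite (@ge0_continuous_FTC2y _ _ (exp1cos_prim e u) _ 0).
- rewrite /exp1cos_prim !mulr0 expR0 sin0 cos0 sub0e -EFinN; congr EFin; ring.
- move=> x x0; have := cos_max (u * x); rewrite ler_norml => /andP[? _].
  by rewrite mulr_ge0 ?expR_ge0//; lra.
- apply: continuous_subspaceT => x; apply: cvgM.
    apply: (@continuous_comp _ _ _ (fun x => - e * x) expR); last exact: continuous_expR.
    exact: mulrl_continuous.
  apply: cvgD; first exact: cvg_cst.
  apply: (@continuous_comp _ _ _ (fun x => u * x) cos); last exact: continuous_cos.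
  exact: mulrl_continuous.
- exact: cvg_exp1cos_prim.
- by move=> x _; have [] := is_derive_exp1cos_prim u x e0.
- exact/cvg_at_right_filter/cF.
- by move=> x _; rewrite derive1E; have d := is_derive_exp1cos_prim u x e0; rewrite derive_val.
Qed.

Lemma L1_exp e : 0 < e -> L1 (fun x => expR (- (e * `|x|))).
Proof.
move=> e0; apply: (@L1_le _ _ (exp1cos e 0)).
- by mfun.
- by move=> x; rewrite /exp1cos mul0r cos0 ger0_norm ?expR_ge0// ler_peMr ?expR_ge0//; lra.
apply: L1P; first by apply: continuous_measurable_fun; exact: continuous_exp1cos.
under eq_integral do rewrite ger0_norm ?exp1cos_ge0//.
by rewrite integral_exp1cos// ltry.
Qed.

Lemma Rint_exp1cos e u : 0 < e -> L1 (exp1cos e u) /\ \int[mu]_x exp1cos e u x = 2 * (e^-1 + e / (e ^+ 2 + u ^+ 2)).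
Proof.
move=> e0; split; last by rewrite /Rintegral integral_exp1cos.
apply: L1P; first by apply: continuous_measurable_fun; exact: continuous_exp1cos.
under eq_integral do rewrite ger0_norm ?exp1cos_ge0//.
by rewrite integral_exp1cos// ltry.
Qed.

(** The Poisson kernel. The summand 1 in [exp1cos] is subtracted again, and the sine half of [cas]
    contributes an odd integrand. *)
Lemma hartley_exp e u : 0 < e ->
  hartley (fun x => expR (- (e * `|x|))) u = 2 * e / (e ^+ 2 + u ^+ 2).
Proof.
move=> e0; have LE := L1_exp e0.
have [Lf If] := Rint_exp1cos u e0; have [Lf0 If0] := Rint_exp1cos 0 e0.
pose E x := expR (- (e * `|x|)).
have IE : \int[mu]_x E x = 2 / e.
  have -> : \int[mu]_x E x = \int[mu]_x (2^-1 * exp1cos e 0 x).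
    by apply: eq_Rintegral => x _; rewrite /exp1cos mul0r cos0 /E; field.
  rewrite RintegralZl// If0; field; by rewrite gt_eqF.
have mb : measurable_fun setT (fun x : R => sin (u * x)) by mfun.
have Lc : L1 (fun x => sin (u * x) * E x).
  by apply: (L1M mb _ LE) => x; exact: sin_max.
have -> : hartley E u = \int[mu]_x (exp1cos e u x - E x + sin (u * x) * E x).
  by apply: eq_Rintegral => x _; rewrite /exp1cos /E /cas; ring.
rewrite RintegralD//; last exact: L1B.
rewrite RintegralB// If IE (_ : \int[mu]_x (sin _ * _) = 0); last first.
  by apply: Rint_odd => // x; rewrite /E normrN mulrN sinN mulNr.
have e1 : e != 0 by rewrite gt_eqF.
have e2 : e ^+ 2 + u ^+ 2 != 0 by rewrite gt_eqF// ltr_wpDr ?sqr_ge0// exprn_gt0.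
by field; rewrite e1 e2.
Qed.

Lemma L1_cauchy : L1 (fun x : R => (1 + x ^+ 2)^-1) /\
  \int[mu]_x (1 + x ^+ 2)^-1 = pi :> R.
Proof.
have H : (\int[mu]_x ((1 + x ^+ 2)^-1)%:E = (pi : R)%:E)%E.
  rewrite ge0_symfun_integralT.
  - by rewrite -set_itvcy integral0y_oneDsqr -EFinM; congr EFin; field.
  - by move=> x; rewrite invr_ge0 addr_ge0 ?sqr_ge0.
  - exact: continuous_oneDsqrV.
  - by move=> x /=; rewrite sqrrN.
split; last by rewrite /Rintegral H.
apply: L1P; first by apply: continuous_measurable_fun; exact: continuous_oneDsqrV.
under eq_integral do rewrite ger0_norm ?invr_ge0 ?addr_ge0 ?sqr_ge0//.
by rewrite H ltry.
Qed.

(** Abel summation: the factor exp(- e_n |p|) is inserted into the double transform. Dominated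
    convergence removes it in the limit, while [hartley_mult] rewrites the same integral as a
    Poisson average of [k] around [t]. *)
Lemma hartley_inversion k C : L1 k -> continuous k -> (forall x, `|k x| <= C) ->
  L1 (hartley k) -> forall t, hartley (hartley k) t = 2 * pi * k t.
Proof.
move=> Lk ck kC Lhk t.
pose e n : R := n.+1%:R^-1.
have e0 n : 0 < e n by rewrite invr_gt0.
have ce : e n @[n --> \oo] --> (0 : R) by exact: cvg_harmonic.
pose A n := \int[mu]_p (hartley k p * expR (- (e n * `|p|)) * cas (p * t)).
have mk := L1_measurable Lk; have mhk := L1_measurable Lhk.
have mc := @measurable_cas R.
have [Lc Ic] := L1_cauchy; have mcauchy := L1_measurable Lc.
have A1 : A n @[n --> \oo] --> hartley (hartley k) t.
  apply: (@Rint_dominated _ _ _ (fun p => 2 * `|hartley k p|)).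
  - by move=> n; mfun.
  - exact/L1Z/L1_abs.
  - move=> n p; rewrite !normrM mulrC ler_pM ?mulr_ge0 ?cas_le2// ler_piMr//.
    by rewrite ger0_norm ?expR_ge0// -expR0 ler_expR oppr_le0 mulr_ge0// ltW.
  - move=> p; rewrite [t * p]mulrC; apply: cvgM; last exact: cvg_cst.
    rewrite -[X in _ --> X]mulr1; apply: cvgM; first exact: cvg_cst.
    rewrite -expR0; apply: continuous_cvg; first exact: continuous_expR.
    rewrite -oppr0 -(mul0r `|p|); apply: cvgN; apply: cvgM => //; exact: cvg_cst.
(* The substitution s = e_n r + t turns the Poisson kernel into a fixed Cauchy density, so that [n]
   survives only in the argument of [k]. *)
have A2 n : A n = \int[mu]_r (2 * k (e n * r + t) * (1 + r ^+ 2)^-1).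
  rewrite /A (hartley_mult t Lk (L1_exp (e0 n))); last by move=> p; rewrite normrN.
  pose h s := k s * hartley (fun x : R => expR (- (e n * `|x|))) (s - t).
  have Lh : L1 h.
    have b p := @hartley_le R _ p (L1_exp (e0 n)).
    rewrite (_ : h = (fun s => hartley (fun x : R => expR (- (e n * `|x|))) (s - t) * k s)); last first.
      by apply/funext => s; rewrite mulrC.
    apply: (L1M _ _ Lk) => [|s]; last exact: b.
    have mE := measurable_hartley (L1_exp (e0 n)); by mfun.
  have -> : \int[mu]_s h s = e n * \int[mu]_r h (e n * r + t).
    by rewrite Rint_affine// mulrA divff ?mul1r// gt_eqF.
  rewrite -RintegralZl//; last exact: L1_affine.
  apply: eq_Rintegral => r _; rewrite /h hartley_exp// addrK.
  have r1 : 1 + r ^+ 2 != 0 by rewrite gt_eqF// ltr_wpDr ?sqr_ge0.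
  have e1 : e n != 0 by rewrite gt_eqF.
  have e2 : e n ^+ 2 + (e n * r) ^+ 2 != 0.
    by rewrite gt_eqF// ltr_wpDr ?sqr_ge0// exprn_gt0.
  by field; rewrite ?r1 ?e1 ?e2.
have A3 : A n @[n --> \oo] --> 2 * pi * k t.
  rewrite (_ : A = (fun n => \int[mu]_r (2 * k (e n * r + t) * (1 + r ^+ 2)^-1))); last exact/funext.
  have -> : 2 * pi * k t = \int[mu]_r (2 * k t * (1 + r ^+ 2)^-1).
    by rewrite RintegralZl// Ic; ring.
  apply: (@Rint_dominated _ _ _ (fun r => 2 * C * (1 + r ^+ 2)^-1)).
  - by move=> n; mfun.
  - exact: L1Z.
  - move=> n r; rewrite !normrM (ger0_norm (_ : 0 <= 2))// [X in _ * X]ger0_norm ?invr_ge0 ?addr_ge0 ?sqr_ge0//.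
    by rewrite ler_wpM2r ?invr_ge0 ?addr_ge0 ?sqr_ge0// ler_wpM2l.
  - move=> r; apply: cvgM; last exact: cvg_cst.
    apply: cvgM; first exact: cvg_cst.
    apply: continuous_cvg; first exact: ck.
    rewrite -[X in _ --> X]add0r -(mul0r r); apply: cvgD; last exact: cvg_cst.
    by apply: cvgM => //; exact: cvg_cst.
exact: (cvg_unique _ A1 A3).
Qed.

End poisson.

(** * Tent functions and their transforms *)

Section tent.
Context {R : realType}.
Local Notation mu := (@lebesgue_measure R).
Implicit Types (g : R -> R) (s t p : R).

Definition tent s : R := Num.max 0 (1 - `|s|).

Lemma tent_ge0 s : 0 <= tent s.
Proof. by rewrite /tent le_max lexx. Qed.

Lemma tent_le1 s : tent s <= 1.
Proof. by rewrite /tent ge_max ler01/= lerBlDr lerDl. Qed.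

Lemma tent_eq0 s : 1 <= `|s| -> tent s = 0.
Proof. by move=> s1; rewrite /tent max_l// subr_le0. Qed.

Lemma tentN s : tent (- s) = tent s.
Proof. by rewrite /tent normrN. Qed.

Lemma tentE s : 0 <= s <= 1 -> tent s = 1 - s.
Proof. by move=> /andP[s0 s1]; rewrite /tent ger0_norm// max_r// subr_ge0. Qed.

Lemma continuous_tent : continuous tent.
Proof.
have -> : tent = (fun s => 2^-1 * (1 - `|s| + `|1 - `|s| |)).
  apply/funext => s; rewrite /tent; case: (lerP 0 (1 - `|s|)) => h.
    by rewrite (ger0_norm h); lra.
  by rewrite (ltr0_norm h); lra.
have c1 : continuous (fun s : R => 1 - `|s|).
  by move=> x; apply: cvgB; [exact: cvg_cst|exact: norm_continuous].
move=> x; apply: cvgM; first exact: cvg_cst.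
by apply: cvgD; [exact: c1|apply: cvg_norm; exact: c1].
Qed.

Lemma measurable_tent : measurable_fun setT tent.
Proof. by apply: continuous_measurable_fun; exact: continuous_tent. Qed.

Lemma integral_tent g (G : R -> R) : (forall s, 0 <= g s) -> continuous g ->
  (forall s, g (- s) = g s) -> (forall s, is_derive s 1 G ((1 - s) * g s)) ->
  (\int[mu]_s (tent s * g s)%:E = (2 * (G 1 - G 0))%:E)%E.
Proof.
move=> g0 cg gN dG.
have ctg : continuous (fun s => tent s * g s).
  by move=> s; apply: cvgM; [exact: continuous_tent|exact: cg].
have cG x : {for x, continuous G}.
  by apply: differentiable_continuous; apply/derivable1_diffP; have [] := dG x.
rewrite (@ge0_symfun_integralT _ (fun s => tent s * g s)) //; last 2 first.
- by move=> s; rewrite mulr_ge0// tent_ge0.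
- by move=> s /=; rewrite tentN gN.
rewrite EFinM; congr (_ * _)%E; rewrite -set_itvcy.
rewrite (@itv_bndbnd_setU _ _ _ (BRight 1)) ?bnd_simp//.
rewrite ge0_integral_setU//=; last 3 first.
- apply/measurable_EFinP; apply: measurable_funTS.
  exact: continuous_measurable_fun.
- by move=> x _; rewrite lee_fin mulr_ge0// tent_ge0.
- apply/disj_setPS => y [/=]; rewrite !in_itv/= => /andP[_ y1] /andP[+ _].
  by rewrite ltNge y1.
rewrite [X in (_ + X)%E]integral0_eq ?adde0; last first.
  move=> x /=; rewrite in_itv/= andbT => x1; rewrite tent_eq0 ?mul0r//.
  by rewrite ger0_norm; lra.
transitivity (\int[mu]_(x in `[0%R, 1%R]) ((1 - x) * g x)%:E)%E.
  by apply: eq_integral => x; rewrite inE/= in_itv/= => x01; rewrite tentE.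
rewrite (@continuous_FTC2 _ _ G)//.
- apply: continuous_subspaceT => x; apply: cvgM; last exact: cg.
  by apply: cvgB; [exact: cvg_cst|exact: cvg_id].
- split.
  + by move=> x _; have [] := dG x.
  + exact/cvg_at_right_filter/cG.
  + exact/cvg_at_left_filter/cG.
- by move=> x _; rewrite derive1E; have d := dG x; rewrite derive_val.
Qed.

Let L1_ge0 g c : measurable_fun setT g -> (forall x, 0 <= g x) ->
  (\int[mu]_x (g x)%:E = c%:E)%E -> L1 g /\ \int[mu]_x g x = c.
Proof.
move=> mg g0 Ig; split; last by rewrite /Rintegral Ig.
by apply: L1P => //; under eq_integral do rewrite ger0_norm//; rewrite Ig ltry.
Qed.

Lemma L1_tent : L1 tent /\ \int[mu]_x tent x = 1.
Proof.
apply: L1_ge0; [exact: measurable_tent|exact: tent_ge0|].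
have dG s : is_derive s 1 (fun s : R => s - 2^-1 * (s * s)) ((1 - s) * 1).
  have d := is_deriveB (is_derive_id s 1) (is_deriveZ 2^-1 (is_deriveM (is_derive_id s 1) (is_derive_id s 1))).
  by apply: (is_derive_eq d); rewrite /GRing.scale/=; field.
have := @integral_tent (fun=> 1) _ (fun=> ler01) (fun x => cvg_cst _) (fun=> erefl) dG.
under eq_integral do rewrite mulr1.
by move=> ->; congr EFin; field.
Qed.

(** The Fejer kernel. As for the exponential, the computation runs on 1 + cos to keep the integrand
    nonnegative. *)
Lemma hartley_tent p : p != 0 -> hartley tent p = 2 * (1 - cos p) / p ^+ 2.
Proof.
move=> p0; have [Lt It] := L1_tent.
have [Lf If] : L1 (fun s => tent s * (1 + cos (p * s))) /\
    \int[mu]_s (tent s * (1 + cos (p * s))) = 1 + 2 * (1 - cos p) / p ^+ 2.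
  have mt := measurable_tent.
  have c0 s : 0 <= 1 + cos (p * s).
    by have := cos_max (p * s); rewrite ler_norml => /andP[? _]; lra.
  apply: L1_ge0; first by mfun.
    by move=> s; rewrite mulr_ge0// tent_ge0.
  have dG s : is_derive s 1 (fun s => s - 2^-1 * (s * s) +
      (p^-1 * ((1 - s) * sin (p * s)) - (p ^+ 2)^-1 * cos (p * s)))
      ((1 - s) * (1 + cos (p * s))).
    have d1 := is_deriveB (is_derive_id s 1) (is_deriveZ 2^-1 (is_deriveM (is_derive_id s 1) (is_derive_id s 1))).
    have d2 := is_deriveM (is_deriveB (is_derive_cst (1 : R) s 1) (is_derive_id s 1)) (is_derive_sinM p s).
    have d3 := is_deriveB (is_deriveZ p^-1 d2) (is_deriveZ (p ^+ 2)^-1 (is_derive_cosM p s)).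
    apply: (is_derive_eq (is_deriveD d1 d3)); rewrite /GRing.scale/=.
    rewrite (_ : (cst 1 - id) s = 1 - s)//.
    by field; exact: p0.
  have cc : continuous (fun s => 1 + cos (p * s)).
    move=> x; apply: cvgD; first exact: cvg_cst.
    apply: (@continuous_comp _ _ _ (fun x => p * x) cos); last exact: continuous_cos.
    exact: mulrl_continuous.
  rewrite (integral_tent c0 cc _ dG); last by move=> s; rewrite mulrN cosN.
  by rewrite !mulr0 !mulr1 sin0 cos0; congr EFin; field; exact: p0.
have mb : measurable_fun setT (fun x : R => sin (p * x)) by mfun.
have Lc : L1 (fun x => sin (p * x) * tent x).
  by apply: (L1M mb _ Lt) => x; exact: sin_max.
have -> : hartley tent p = \int[mu]_x (tent x * (1 + cos (p * x)) - tent x + sin (p * x) * tent x).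
  by apply: eq_Rintegral => x _; rewrite /cas; ring.
rewrite RintegralD//; last exact: L1B.
rewrite RintegralB// If It (_ : \int[mu]_x (sin _ * _) = 0); last first.
  by apply: Rint_odd => // x; rewrite tentN mulrN sinN mulNr.
by rewrite addr0 [1 + _]addrC addrK.
Qed.

Lemma hartley_tent_ge0 p : 0 <= hartley tent p.
Proof.
have [Lt It] := L1_tent; have [->|p0] := eqVneq p 0.
  by apply: Rintegral_ge0 => x _; rewrite mul0r cas0 mulr1 tent_ge0.
have := cos_max p; rewrite ler_norml => /andP[_ ?].
by rewrite hartley_tent// divr_ge0 ?sqr_ge0// mulr_ge0// subr_ge0.
Qed.

Lemma hartley_tentN p : hartley tent (- p) = hartley tent p.
Proof.
have [->|p0] := eqVneq p 0; first by rewrite oppr0.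
by rewrite !hartley_tent ?oppr_eq0// cosN sqrrN.
Qed.

Lemma L1_hartley_tent : L1 (hartley tent).
Proof.
have [Lt It] := L1_tent; have [Lc _] := @L1_cauchy R.
(* For p^2 >= 1 the closed form is at most 4 / p^2, hence at most 8 / (1 + p^2). For p^2 < 1 the
   bound 2 from [hartley_le] is already enough. *)
apply: (@L1_le _ _ (fun p => 8 * (1 + p ^+ 2)^-1)); last exact: L1Z.
- exact: measurable_hartley.
move=> p; have p20 := sqr_ge0 p.
rewrite ler_pdivlMr; last by lra.
have [p1|p1] := leP 1 (p ^+ 2).
  have p0 : p != 0 by apply/eqP => p0; move: p1; rewrite p0 expr0n/=; lra.
  rewrite ger0_norm ?hartley_tent_ge0// hartley_tent// mulrAC ler_pdivrMr; last by lra.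
  have := cos_max p; rewrite ler_norml => /andP[c1 c2].
  by nra.
have := hartley_le p Lt.
under [X in _ <= _ * X -> _]eq_Rintegral do rewrite ger0_norm ?tent_ge0//.
by rewrite It => h; have := normr_ge0 (hartley tent p); nra.
Qed.

Lemma hartley2_tent u : hartley (hartley tent) u = 2 * pi * tent u.
Proof.
have [Lt It] := L1_tent.
apply: (@hartley_inversion _ tent 1) => //.
- exact: continuous_tent.
- by move=> x; rewrite ger0_norm ?tent_ge0// tent_le1.
- exact: L1_hartley_tent.
Qed.

(** By inversion, the tent integral around [t] is, up to the factor 2 pi, the integral of [hartley g
    p * hartley tent p * cas (p * t)]. The product of the first two factors has constant sign, so
    its L1 norm is the absolute value of its integral, which is the case t = 0. The 2 is the bound
    on |cas|. *)
Lemma hartley_sign_tent g t : L1 g ->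
  (forall p, 0 <= hartley g p) \/ (forall p, hartley g p <= 0) ->
  `|\int[mu]_s (g s * tent (s - t))| <= 2 * `|\int[mu]_s (g s * tent s)|.
Proof.
move=> Lg sg.
have mT := L1_hartley_tent.
have LK : L1 (fun p => hartley g p * hartley tent p).
  by apply: (L1M (measurable_hartley Lg) _ mT) => p; exact: hartley_le.
have Lgt : L1 (fun s => g s * tent s).
  rewrite (_ : (fun s => _) = (fun s => tent s * g s)); last by apply/funext => s; rewrite mulrC.
  apply: (L1M measurable_tent (C := 1) _ Lg) => s.
  by rewrite ger0_norm ?tent_ge0// tent_le1.
have H u : \int[mu]_p (hartley g p * hartley tent p * cas (p * u)) =
    2 * pi * \int[mu]_s (g s * tent (s - u)).
  rewrite (hartley_mult u Lg mT hartley_tentN) -RintegralZl//.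
    by apply: eq_Rintegral => s _; rewrite hartley2_tent; ring.
  have mt := measurable_tent.
  rewrite (_ : (fun s => _) = (fun s => tent (s - u) * g s)); last by apply/funext => s; rewrite mulrC.
  apply: (L1M (C := 1) _ _ Lg) => [|s]; first by mfun.
  by rewrite ger0_norm ?tent_ge0// tent_le1.
have pi2 : 0 < 2 * pi :> R by rewrite mulr_gt0// pi_gt0.
have H0 : \int[mu]_p (hartley g p * hartley tent p) = 2 * pi * \int[mu]_s (g s * tent s).
  have := H 0; under eq_Rintegral do rewrite mulr0 cas0 mulr1.
  by under [X in _ = _ * X]eq_Rintegral do rewrite subr0.
rewrite -(ler_pM2l pi2) mulrCA -{1}(gtr0_norm pi2) -normrM -H.
rewrite -{1}(gtr0_norm pi2) -[X in _ <= 2 * X]normrM -H0.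
have LA : L1 (fun p => hartley g p * hartley tent p * cas (p * t)).
  have := L1_cas t LK; congr (integrable _ _ _).
  by apply/funext => p /=; rewrite [t * p]mulrC.
apply: (@le_trans _ _ (\int[mu]_p (2 * `|hartley g p * hartley tent p|))).
  apply: Rint_norm_le => //.
  - exact/L1Z/L1_abs.
  - by move=> p; rewrite normrM mulrC ler_wpM2r// cas_le2.
rewrite RintegralZl//; last exact: L1_abs.
rewrite ler_pM2l//; case: sg => sg.
  rewrite ger0_norm; last by apply: Rintegral_ge0 => p _; rewrite mulr_ge0// hartley_tent_ge0.
  by apply: Rint_le => //; [exact: L1_abs|move=> p; rewrite ger0_norm// mulr_ge0// hartley_tent_ge0].
rewrite -normrN -mulN1r -RintegralZl//.
rewrite ger0_norm; last first.
  by apply: Rintegral_ge0 => p _; rewrite mulN1r -mulNr mulr_ge0 ?hartley_tent_ge0// oppr_ge0.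
apply: Rint_le => //; [exact: L1_abs|exact: L1Z|move=> p].
by rewrite ler0_norm ?mulN1r// mulr_le0_ge0// hartley_tent_ge0.
Qed.

End tent.

(** * Functions with a transform of constant sign *)

Section lebesgue_points.
Context {R : realType}.
Local Notation mu := (@lebesgue_measure R).
Implicit Types (g b : R -> R) (s t p : R).

Let e (n : nat) : R := n.+1%:R^-1.

Let e_gt0 n : 0 < e n.
Proof. by rewrite invr_gt0. Qed.

Let cvg_e : e n @[n --> \oo] --> (0 : R).
Proof. exact: cvg_harmonic. Qed.

Lemma L1_tentM g : L1 g -> L1 (fun r => g r * tent r).
Proof.
move=> Lg; rewrite (_ : (fun s => _) = (fun s => tent s * g s)); last by apply/funext => s; rewrite mulrC.
apply: (L1M measurable_tent (C := 1) _ Lg) => s.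
by rewrite ger0_norm ?tent_ge0// tent_le1.
Qed.

(** The tent is at most the indicator of an interval of length 2, so weighting by it costs at most
    twice the mean deviation over the ball. *)
Lemma tent_avg g t n : L1 g ->
  (`|\int[mu]_r (g (e n * r + t) * tent r) - g t|%:E <= 2%:E * davg g t (e n))%E.
Proof.
move=> Lg; have mg := L1_measurable Lg.
have [Lt It] := @L1_tent R; have mt := @measurable_tent R.
have Lge : L1 (fun r => g (e n * r + t)) by exact: L1_affine.
have -> : \int[mu]_r (g (e n * r + t) * tent r) - g t =
    \int[mu]_r ((g (e n * r + t) - g t) * tent r).
  have -> : g t = \int[mu]_r (g t * tent r) by rewrite RintegralZl// It mulr1.
  rewrite -RintegralB//; [|exact: L1_tentM|exact: L1Z].
  rewrite RintegralZl// It mulr1.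
  by apply: eq_Rintegral => r _; rewrite mulrBl.
have Ld : L1 (fun r => (g (e n * r + t) - g t) * tent r).
  have := L1B (L1_tentM Lge) (L1Z (g t) Lt); congr (integrable _ _ _).
  by apply/funext => r /=; rewrite mulrBl.
rewrite EFin_normr_Rintegral//.
apply: (le_trans (le_abse_integral _ measurableT (measurable_int mu Ld))) => //.
pose h y : \bar R := ((`|g y - g t| * \1_(ball t (e n)) y)%:E)%E.
have mh : measurable_fun setT h.
  apply/measurable_EFinP; apply: measurable_funM; first by mfun.
  by apply: measurable_indic; exact: measurable_ball.
have h0 y : (0 <= h y)%E by rewrite lee_fin mulr_ge0.
apply: (@le_trans _ _ (\int[mu]_r h (e n * r + t)%R)%E).
  apply: ge0_le_integral => //.
  - by apply: measurableT_comp => //; exact: (measurable_int mu Ld).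
  - by apply: (measurableT_comp mh); exact: measurable_affine.
  - move=> r _ /=; rewrite lee_fin /h normrM ler_wpM2l// ger0_norm ?tent_ge0// indicE.
    case: (leP 1 `|r|) => r1; first by rewrite tent_eq0.
    rewrite mem_set ?tent_le1//= /ball/= opprD addrCA subrr addr0 normrN normrM.
    by rewrite gtr0_norm// gtr_pMr.
rewrite ge0_integral_affine//.
rewrite /davg /iavg (lebesgue_measure_ball _ (ltW (e_gt0 n))).
rewrite inver gt_eqF ?mulrn_wgt0// muleA -EFinM.
rewrite le_eqVlt; apply/orP; left; apply/eqP; congr (_ * _)%E.
  by congr EFin; field; rewrite gt_eqF.
rewrite [RHS]integral_mkcond; apply: eq_integral => y _.
rewrite /h patchE indicE; case: ifPn => yb; rewrite ?mulr1 ?mulr0//.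
Qed.

Lemma cvg_tent_lebesgue_pt g t : L1 g -> lebesgue_pt g t ->
  \int[mu]_r (g (e n * r + t) * tent r) @[n --> \oo] --> g t.
Proof.
move=> Lg gt.
have ce : e n @[n --> \oo] --> (0 : R)^'+.
  by move=> P /cvg_e [N _ H]; exists N => // n Nn; apply: (H n Nn); exact: e_gt0.
have H : davg g t (e n) @[n --> \oo] --> 0%E by exact: (cvg_comp _ _ ce gt).
have H2 : (2%:E * davg g t (e n))%E @[n --> \oo] --> 0%E.
  by rewrite -(mule0 2%:E); apply: cvgeZl.
apply/cvgrPdist_lt => d d0.
move/fine_cvgP : H2 => [H2f /cvgrPdist_lt /(_ _ d0) H2d].
near=> n; rewrite distrC.
have Hf : (2%:E * davg g t (e n))%E \is a fin_num by near: n.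
have Hd : `|0 - fine (2%:E * davg g t (e n))| < d by near: n.
rewrite -lte_fin (le_lt_trans (tent_avg t n Lg))//.
rewrite -(fineK Hf) lte_fin (le_lt_trans _ Hd)// sub0r normrN ler_norm//.
Unshelve. all: by end_near. Qed.

(** Almost every [t] is a Lebesgue point of [g], but 0 need not be one; the majorant [b], with a
    Lebesgue point at [x], controls the averages of [g] near 0 instead. *)
Lemma hartley_sign_bound g b x : L1 g -> L1 b ->
  (forall p, 0 <= hartley g p) \/ (forall p, hartley g p <= 0) ->
  (forall s, `|g s| <= b (x + s) + b (x - s)) -> lebesgue_pt b x ->
  {ae mu, forall t, `|g t| <= 4 * b x}.
Proof.
move=> Lg Lb sg gb bx.
have : {ae mu, forall t, lebesgue_pt g t}.
  by apply: lebesgue_differentiation; apply: open_integrable_locally => //; exact: openT.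
apply: lebesgue_aeS => t gt.
have mg := L1_measurable Lg; have mb := L1_measurable Lb.
have c1 : `|\int[mu]_r (g (e n * r + t) * tent r)| @[n --> \oo] --> `|g t|.
  by apply: cvg_norm; exact: cvg_tent_lebesgue_pt.
have c2 : 4 * \int[mu]_r (b (e n * r + x) * tent r) @[n --> \oo] --> 4 * b x.
  by apply: cvgM; [exact: cvg_cst|exact: cvg_tent_lebesgue_pt].
apply: (ler_cvg_to c1 c2); apply: nearW => n.
(* Dilation preserves the sign of the transform, so tents of width [e n] come from the unit tent
   applied to [ge]. *)
pose ge s := g (e n * s + 0).
have Lge : L1 ge by exact: L1_affine.
have hge p : hartley ge p = (e n)^-1 * hartley g (p / e n).
  have := Rint_affine 0 (e_gt0 n) (L1_cas (p / e n) Lg).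
  rewrite -/(hartley _ _) => <-; apply: eq_Rintegral => s _; rewrite /ge.
  by congr (_ * cas _); field; rewrite gt_eqF.
have sge : (forall p, 0 <= hartley ge p) \/ (forall p, hartley ge p <= 0).
  case: sg => sg; [left|right] => p; rewrite hge.
    by rewrite mulr_ge0// invr_ge0 ltW.
  by rewrite mulr_ge0_le0// invr_ge0 ltW.
have := hartley_sign_tent (t / e n) Lge sge.
have -> : \int[mu]_s (ge s * tent (s - t / e n)) = \int[mu]_r (g (e n * r + t) * tent r).
  pose k s := ge s * tent (s - t / e n).
  have Lk : L1 k.
    rewrite (_ : k = (fun s => tent (s - t / e n) * ge s)); last by apply/funext => s; rewrite mulrC.
    have mt := @measurable_tent R.
    apply: (L1M (C := 1) _ _ Lge) => [|s]; first by mfun.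
    by rewrite ger0_norm ?tent_ge0// tent_le1.
  have := Rint_affine (t / e n) ltr01 Lk; rewrite invr1 mul1r => <-.
  apply: eq_Rintegral => r _; rewrite /k /ge; congr (g _ * tent _).
    by field; rewrite gt_eqF.
  by rewrite mul1r addrK.
move=> /le_trans; apply.
have -> : 4 * \int[mu]_r (b (e n * r + x) * tent r) = 2 * (2 * \int[mu]_r (b (e n * r + x) * tent r)) by ring.
rewrite ler_pM2l//.
have Lbe : L1 (fun r => b (e n * r + x) * tent r) by apply: L1_tentM; exact: L1_affine.
have Lbe' : L1 (fun r => b (e n * (- r) + x) * tent (- r)) by exact: (L1_opp Lbe).
(* The tent is even, so [b (x + s)] and [b (x - s)] have the same average: the second factor 2. *)
rewrite mulr_natl mulr2n -{2}(Rint_opp Lbe) -RintegralD//.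
apply: Rint_norm_le; [exact: L1_tentM|exact: L1D|].
move=> s; rewrite normrM (ger0_norm (tent_ge0 _)) tentN -mulrDl ler_wpM2r ?tent_ge0//.
rewrite (le_trans (gb _))// addr0 mulrN [_ + x]addrC [- _ + x]addrC//.
Qed.

End lebesgue_points.

(** * Comparison of integrals almost everywhere *)

Section ae_comparison.
Context {R : realType}.
Local Notation mu := (@lebesgue_measure R).
Implicit Types f g : R -> R.

Lemma Rint_ae_eq f g : L1 f -> measurable_fun setT g -> {ae mu, forall x, f x = g x} ->
  \int[mu]_x f x = \int[mu]_x g x.
Proof.
move=> Lf mg fg; congr fine; apply: ae_eq_integral => //.
- by apply/measurable_EFinP; exact: L1_measurable.
- exact/measurable_EFinP.
- by move: fg; apply: lebesgue_aeS => x -> _.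
Qed.

Lemma L1_le_ae f g : measurable_fun setT f -> L1 g -> {ae mu, forall x, `|f x| <= g x} -> L1 f.
Proof.
move=> mf Lg fg; have mg := L1_measurable Lg.
have mF : measurable_fun setT (fun x => `|f x|) by mfun.
have mG : measurable_fun setT (fun x => `|g x|) by mfun.
have Lm : L1 (fun x => Num.min `|f x| `|g x|).
  apply: (L1_le _ _ (L1_abs Lg)) => [|x]; first exact: measurable_minr.
  by rewrite ger0_norm ?le_min ?normr_ge0// ge_min lexx orbT.
have La : L1 (fun x => `|f x|).
  apply: (L1_ae Lm mF); move: fg; apply: lebesgue_aeS => x fgx.
  by rewrite min_l// (le_trans fgx)// ler_norm.
exact: (L1_le mf _ La).
Qed.

Lemma Rint_le_ae f g : L1 f -> L1 g -> {ae mu, forall x, f x <= g x} ->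
  \int[mu]_x f x <= \int[mu]_x g x.
Proof.
move=> Lf Lg fg; have mf := L1_measurable Lf; have mg := L1_measurable Lg.
have mm : measurable_fun setT (fun x => Num.min (f x) (g x)) by exact: measurable_minr.
have ae : {ae mu, forall x, f x = Num.min (f x) (g x)}.
  by move: fg; apply: lebesgue_aeS => x fgx; rewrite min_l.
rewrite (Rint_ae_eq Lf mm ae); apply: Rint_le => //; first exact: (L1_ae Lf mm ae).
by move=> x; rewrite ge_min lexx orbT.
Qed.

End ae_comparison.

(** * Exponential decay from the midpoint inequality *)

Section decay.
Context {R : realType}.
Local Notation mu := (@lebesgue_measure R).

Let chi (n : nat) : R -> R := \1_(`[- n%:R, n%:R]%classic).

Let measurable_chi n : measurable_fun setT (chi n).
Proof. by apply: measurable_indic; exact: measurable_itv. Qed.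

Let L1_chi n : L1 (chi n).
Proof. exact: (@integrable_indic_itv R (- n%:R) n%:R true false). Qed.

Let chi_ge0 n x : 0 <= chi n x.
Proof. by rewrite /chi indicE. Qed.

Let chi_le1 n x : `|chi n x| <= 1.
Proof. by rewrite /chi indicE; case: (_ \in _); rewrite ?normr1 ?normr0. Qed.

Let chiP n x : chi n x = 0 \/ (`|x| <= n%:R /\ chi n x = 1).
Proof.
rewrite /chi indicE; case: (boolP (_ \in _)) => [|_]; last by left.
by rewrite inE/= in_itv/= -ler_norml => ?; right.
Qed.

Lemma exists_dyadic (x : R) : 1 <= x -> exists k, (2 ^ k)%:R <= x < (2 ^ k.+1)%:R.
Proof.
move=> x1; have x0 : 0 <= x by lra.
have /andP[t1 t2] := truncn_itv x0.
have t0 : (0 < Num.truncn x)%N by rewrite truncn_gt0.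
exists (trunc_log 2 (Num.truncn x)).
have /andP[k1 k2] := trunc_log_bounds (isT : (1 < 2)%N) t0.
apply/andP; split; first by rewrite (le_trans _ t1)// ler_nat.
by rewrite (lt_le_trans t2)// ler_nat.
Qed.

(** [A] will be the modulus of f, possibly reflected, and later that of its Fourier transform. *)
Variables (A B : R -> R) (c M : R).
Hypotheses (mA : measurable_fun setT A) (A0 : forall x, 0 <= A x).
Hypotheses (BA : forall x, B x = A x ^+ 2) (LB : L1 B) (c0 : 0 < c).
Hypothesis mid : {ae mu, forall u, {ae mu, forall v, M < u + v ->
  A u * A v <= c * B ((u + v) / 2)}}.
Hypothesis A_neq0 : ~ {ae mu, forall x, A x = 0}.

Let B0 x : 0 <= B x. Proof. by rewrite BA sqr_ge0. Qed.

Let L1_Achi n : L1 (fun x => A x * chi n x).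
Proof.
have mc := measurable_chi n.
apply: (@L1_le _ _ (fun x => chi n x + B x)); first by mfun.
- move=> x; have := sqr_ge0 (A x - 1); rewrite BA.
  by case: (chiP n x) => [->|[_ ->]]; rewrite ?mulr0 ?mulr1 ?normr0 ?ger0_norm//; have := A0 x; nra.
- exact: L1D.
Qed.

Let mass_gt0 : exists n, 0 < \int[mu]_x (A x * chi n x).
Proof.
apply: contrapT => /forallNP H; apply: A_neq0.
have H0 n : {ae mu, forall x, A x * chi n x = 0}.
  have : \int[mu]_x (A x * chi n x) = 0.
    apply/eqP; rewrite eq_le; apply/andP; split; first by rewrite leNgt; apply/negP/H.
    by apply: Rintegral_ge0 => x _; rewrite mulr_ge0.
  have LA := L1_Achi n; have mc := measurable_chi n.
  have : (\int[mu]_x `|(A x * chi n x)%:E|)%E = 0%E <-> ae_eq mu setT (fun x => (A x * chi n x)%:E) (cst 0%E).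
    by apply: ae_eq_integral_abs => //; apply/measurable_EFinP; mfun.
  move=> [H1 _] H2; have : ae_eq mu setT (fun x => (A x * chi n x)%:E) (cst 0%E).
    apply: H1; under eq_integral do rewrite gee0_abs ?lee_fin ?mulr_ge0//.
    by rewrite -[LHS](fineK (integrable_fin_num measurableT LA)); exact: (congr1 EFin H2).
  by apply: lebesgue_aeS => x /= /(_ I) [].
have := ae_foralln H0; apply: lebesgue_aeS => x Hx.
have xn : `|x| <= (Num.truncn `|x|).+1%:R by rewrite ltW// truncnS_gt.
have := Hx (Num.truncn `|x|).+1; rewrite /chi indicE mem_set ?mulr1//=.
by rewrite in_itv/= -ler_norml.
Qed.

Let n := sval (cid mass_gt0).
Let w := \int[mu]_x (A x * chi n x).
Let w0 : 0 < w. Proof. exact: (svalP (cid mass_gt0)). Qed.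

Let L1_Bmid z : L1 (fun v => B ((z + v) / 2)).
Proof.
have := L1_affine (z / 2) (_ : 0 < 2^-1) LB.
rewrite invr_gt0 ltr0n => /(_ isT); congr (integrable _ _ _).
by apply/funext => v /=; congr (B _)%:E; field.
Qed.

Let L1_Bmidchi z : L1 (fun v => B ((z + v) / 2) * chi n v).
Proof.
rewrite (_ : (fun v => _) = (fun v => chi n v * B ((z + v) / 2))); last by apply/funext => v; rewrite mulrC.
exact: (L1M (measurable_chi n) (chi_le1 n) (L1_Bmid z)).
Qed.

Let Phi z := \int[mu]_v (B ((z + v) / 2) * chi n v).

(** The midpoint inequality with u = z is integrated in v over the window |v| <= n, on which [A] has
    mass [w]; there z + v > M. *)
Let A_le_Phi : {ae mu, forall z, M + n%:R < z -> A z <= c / w * Phi z}.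
Proof.
move: mid; apply: lebesgue_aeS => z Hz zM.
rewrite mulrAC ler_pdivlMr// -RintegralZl// -RintegralZl//.
apply: Rint_le_ae => //; [exact: L1Z|exact: L1Z|].
move: Hz; apply: lebesgue_aeS => v Hv.
case: (chiP n v) => [->|[vn ->]]; first by rewrite !mulr0.
rewrite !mulr1; apply: Hv.
by move: vn; rewrite ler_norml => /andP[v1 v2]; lra.
Qed.

Let D (m : nat) := \int[mu]_y (B y * \1_(`[m%:R, +oo[%classic) y).

Let cvg_D : D m @[m --> \oo] --> (0 : R).
Proof.
have -> : (0 : R) = \int[mu]_y (cst 0 y : R) by rewrite Rintegral_cst// mul0r.
have mB := L1_measurable LB.
apply: (@Rint_dominated _ _ _ B) => //.
- by move=> m; apply: measurable_funM => //; apply: measurable_indic; exact: measurable_itv.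
- move=> m y; rewrite indicE normrM ger0_norm// ler_piMr//.
  by case: (_ \in _); rewrite ?normr1 ?normr0.
- move=> y; apply: cvg_near_cst.
  exists (Num.truncn `|y|).+1 => // m /= ym.
  rewrite indicE memNset ?mulr0//= in_itv/= andbT; apply/negP; rewrite -ltNge.
  rewrite (le_lt_trans (ler_norm _))// (lt_le_trans (truncnS_gt _))// ler_nat//.
Qed.

(** Starts the recursion, which only contracts from a small value. For z >= 2m + n all midpoints (z
    + v) / 2 of the window lie beyond [m], so [Phi z] is at most twice the tail [D m]. *)
Let A_small k : 0 < k -> exists th, {ae mu, forall z, th <= z -> A z <= k}.
Proof.
move=> k0.
have e0 : 0 < k / (c / w * 2) by rewrite divr_gt0// mulr_gt0// divr_gt0.
have /cvgrPdist_lt /(_ _ e0) [m _ Hm] := cvg_D.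
have {Hm} Dm : D m < k / (c / w * 2).
  by have := Hm m (leqnn m); rewrite /= sub0r normrN; apply: le_lt_trans; exact: ler_norm.
exists (Num.max (M + n%:R + 1) (2 * m%:R + n%:R)).
move: A_le_Phi; apply: lebesgue_aeS => z Hz; rewrite ge_max => /andP[z1 z2].
rewrite (le_trans (Hz _))//; first by lra.
have -> : k = c / w * (2 * (k / (c / w * 2))).
  by field; rewrite !gt_eqF.
rewrite ler_pM2l ?divr_gt0//.
apply: (@le_trans _ _ (2 * D m)); last by rewrite ler_pM2l// ltW.
pose h y := B y * \1_(`[m%:R, +oo[%classic) y.
have Lh : L1 h.
  rewrite (_ : h = (fun y => \1_(`[m%:R, +oo[%classic) y * B y)); last by apply/funext => y; rewrite mulrC.
  apply: (L1M (C := 1) _ _ LB) => [|y].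
    by apply: measurable_indic; exact: measurable_itv.
  by rewrite indicE; case: (_ \in _); rewrite ?normr1 ?normr0.
have i2 : 0 < 2^-1 :> R by rewrite invr_gt0.
have := Rint_affine (z / 2) i2 Lh; rewrite invrK /D -/h => <-.
apply: Rint_le; [exact: L1_Bmidchi|exact: L1_affine|move=> v].
have -> : 2^-1 * v + z / 2 = (z + v) / 2 by field.
rewrite /h ler_wpM2l//; case: (chiP n v) => [->|[vn ->]]; first by rewrite indicE.
rewrite indicE mem_set//= in_itv/= andbT.
by move: vn; rewrite ler_norml => /andP[v1 v2]; lra.
Qed.

(** The window has length 2n; n + 1 in place of n makes positivity immediate. *)
Let K := c / w * (2 * (n%:R + 1)).
Let K0 : 0 < K.
Proof. by rewrite /K mulr_gt0 ?divr_gt0// mulr_gt0// ltr_wpDl. Qed.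

(** For z >= 2 th + n the midpoints of the window are at least [th], where B = A^2 is at most
    k^2. *)
Let A_step k th : 0 <= k -> {ae mu, forall z, th <= z -> A z <= k} ->
  {ae mu, forall z, M + n%:R < z -> 2 * th + n%:R <= z -> A z <= K * k ^+ 2}.
Proof.
move=> k0 Hk; move: A_le_Phi; apply: lebesgue_aeS => z Hz z1 z2.
apply: (le_trans (Hz z1)).
have -> : K * k ^+ 2 = c / w * (2 * (n%:R + 1) * k ^+ 2) by rewrite /K -!mulrA.
rewrite ler_pM2l ?divr_gt0//.
have -> : 2 * (n%:R + 1) * k ^+ 2 = \int[mu]_v (k ^+ 2 * chi n v) + 2 * k ^+ 2.
  rewrite RintegralZl// /chi (_ : \int[mu]_v _ = n%:R *+ 2); last first.
    rewrite /Rintegral integral_indic//= setIT lebesgue_measure_itv/= lte_fin.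
    case: ifPn => [_|]; first by rewrite -EFinB/= opprK mulr2n.
    rewrite -leNgt => h; have : n%:R = 0 :> R by have := ler0n R n; lra.
    by move=> ->; rewrite mul0rn.
  by rewrite -mulr_natl; ring.
rewrite -[Phi z]addr0 lerD//; last by rewrite mulr_ge0// sqr_ge0.
apply: Rint_le_ae; [exact: L1_Bmidchi|exact: L1Z|].
have := lebesgue_ae_affine (z / 2) (_ : 0 < 2^-1) Hk.
rewrite invr_gt0 ltr0n => /(_ isT); apply: lebesgue_aeS => v Hv.
case: (chiP n v) => [->|[vn ->]]; first by rewrite !mulr0.
rewrite !mulr1 BA.
have -> : (z + v) / 2 = 2^-1 * v + z / 2 by field.
rewrite ler_sqr ?nnegrE//; apply: Hv.
by move: vn; rewrite ler_norml => /andP[v1 v2]; lra.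
Qed.

Lemma midpoint_decay_right : exists k C N, 0 < k /\
  {ae mu, forall z, N <= z -> A z <= C * expR (- (k * z))}.
Proof.
have K1 : 0 < K^-1 by rewrite invr_gt0.
have [th Hth] := A_small (mulr_gt0 K1 (expR_gt0 (- 1))).
(* The 1 makes [L] positive; the other bound keeps all later [z] beyond [M + n%:R]. *)
pose th0 := Num.max (Num.max th 1) (M + n%:R + 1).
pose L := th0 + n%:R.
have th1 : 1 <= th0 by rewrite /th0 !le_max lexx orbT.
have thM : M + n%:R + 1 <= th0 by rewrite /th0 le_max lexx orbT.
have n0 : 0 <= n%:R :> R by [].
have L0 : 0 < L by rewrite /L; lra.
(* Normalised by [K], the recursion is exact squaring. The offset -n is preserved by it: 2 (2^k L -
   n) + n = 2^(k+1) L - n. *)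
have Hk k : {ae mu, forall z, (2 ^ k)%:R * L - n%:R <= z -> A z <= K^-1 * expR (- (2 ^ k)%:R)}.
  elim: k => [|k IH].
    move: Hth; apply: lebesgue_aeS => z Hz; rewrite mul1r /L addrK => zt.
    by apply: Hz; rewrite (le_trans _ zt)// /th0 !le_max lexx.
  have := A_step _ IH; rewrite mulr_ge0 ?expR_ge0 ?(ltW K1)// => /(_ isT).
  apply: lebesgue_aeS => z Hz zk.
  have p1 : 1 <= (2 ^ k)%:R :> R by rewrite ler1n expn_gt0.
  have p2 : (2 ^ k.+1)%:R = 2 * (2 ^ k)%:R :> R by rewrite expnS natrM.
  rewrite p2 in zk *.
  have := Hz _ _; rewrite exprMn -expRM_natl => H.
  have -> : K^-1 * expR (- (2 * (2 ^ k)%:R)) = K * (K^-1 ^+ 2 * expR (2 * - (2 ^ k)%:R)).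
    by rewrite mulrN expr2 -mulrA mulVKf// gt_eqF.
  have PL : L <= (2 ^ k)%:R * L by rewrite ler_peMl// ltW.
  by apply: H; move: zk PL; rewrite /L; lra.
(* The dyadic bracket gives 2^k > (z + n) / (2 L), whence the 1/2 in the rate. *)
exists (L^-1 / 2), K^-1, th0; split; first by rewrite divr_gt0// invr_gt0.
have := ae_foralln Hk; apply: lebesgue_aeS => z Hz zt.
have [k /andP[k1 k2]] : exists k, (2 ^ k)%:R <= (z + n%:R) / L < (2 ^ k.+1)%:R.
  by apply: exists_dyadic; rewrite ler_pdivlMr// mul1r /L lerD2r.
rewrite ler_pdivlMr// in k1; rewrite ltr_pdivrMr// in k2.
rewrite (le_trans (Hz k _))//; first by rewrite lerBlDr.
rewrite ler_pM2l// ler_expR lerN2 mulrAC ler_pdivrMr// mulrC ler_pdivrMr//.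
by rewrite expnS natrM in k2; lra.
Qed.

End decay.

Section decay_two_sided.
Context {R : realType}.
Local Notation mu := (@lebesgue_measure R).

Lemma midpoint_decay (A B : R -> R) (c M : R) :
  measurable_fun setT A -> (forall x, 0 <= A x) -> (forall x, B x = A x ^+ 2) ->
  L1 B -> 0 < c ->
  {ae mu, forall u, {ae mu, forall v, M < `|u + v| -> A u * A v <= c * B ((u + v) / 2)}} ->
  ~ {ae mu, forall x, A x = 0} ->
  exists2 k, 0 < k & L1 (fun x => B x * expR (k * `|x|)).
Proof.
move=> mA A0 BA LB c0 mid nz.
have [k1 [C1 [N1 [k10 H1]]]] : exists k C N, 0 < k /\
    {ae mu, forall z, N <= z -> A z <= C * expR (- (k * z))}.
  apply: (@midpoint_decay_right _ A B c M) => //.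
  move: mid; apply: lebesgue_aeS => u; apply: lebesgue_aeS => v Huv uv.
  by apply: Huv; rewrite (lt_le_trans uv)// ler_norm.
have [k2 [C2 [N2 [k20 H2]]]] : exists k C N, 0 < k /\
    {ae mu, forall z, N <= z -> A (- z) <= C * expR (- (k * z))}.
  apply: (@midpoint_decay_right _ (fun x => A (- x)) (fun x => B (- x)) c M) => //.
  - by mfun.
  - exact: L1_opp.
  - have := lebesgue_ae_opp mid; apply: lebesgue_aeS => u /lebesgue_ae_opp.
    apply: lebesgue_aeS => v Huv uv.
    rewrite -mulNr opprD; apply: Huv; rewrite -opprD normrN.
    by rewrite (lt_le_trans uv)// ler_norm.
  - move=> H; apply: nz; have := lebesgue_ae_opp H.
    by apply: lebesgue_aeS => x; rewrite opprK.
pose k := Num.min k1 k2; pose C := Num.max (Num.max C1 C2) 0.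
pose N := Num.max (Num.max N1 N2) 0.
have k0 : 0 < k by rewrite /k lt_min k10.
have kk1 : k <= k1 by rewrite /k ge_min lexx.
have kk2 : k <= k2 by rewrite /k ge_min lexx orbT.
have C0 : 0 <= C by rewrite /C le_max lexx orbT.
have CC1 : C1 <= C by rewrite /C !le_max lexx.
have CC2 : C2 <= C by rewrite /C !le_max lexx orbT.
have N0 : 0 <= N by rewrite /N le_max lexx orbT.
have NN1 : N1 <= N by rewrite /N !le_max lexx.
have NN2 : N2 <= N by rewrite /N !le_max lexx orbT.
have H : {ae mu, forall x, N <= `|x| -> A x <= C * expR (- (k * `|x|))}.
  have := lebesgue_ae_opp H2; move: H1; apply: lebesgue_aeS2 => x Hx1 Hx2 xN.
  have [x0|x0] := leP 0 x.
    rewrite ger0_norm// in xN *; rewrite (le_trans (Hx1 (le_trans NN1 xN)))//.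
    apply: (@le_trans _ _ (C * expR (- (k1 * x)))); first by rewrite ler_wpM2r// expR_ge0.
    by rewrite ler_wpM2l// ler_expR lerN2 ler_wpM2r.
  rewrite ltr0_norm// in xN *.
  have := Hx2 (le_trans NN2 xN); rewrite opprK => h; rewrite (le_trans h)//.
  apply: (@le_trans _ _ (C * expR (- (k2 * - x)))); first by rewrite ler_wpM2r// expR_ge0.
  by rewrite ler_wpM2l// ler_expR lerN2 ler_wpM2r// oppr_ge0 ltW.
exists k => //.
(* Beyond [N], B decays at rate 2k and the weight uses up only k of it; within [N] the weight is at
   most exp(k N). *)
apply: (@L1_le_ae _ _ (fun x => expR (k * N) * B x + C ^+ 2 * expR (- (k * `|x|)))).
- by have mB := L1_measurable LB; mfun.
- by apply: L1D; [exact: L1Z|apply: L1Z; exact: L1_exp].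
move: H; apply: lebesgue_aeS => x Hx.
have B0 : 0 <= B x by rewrite BA sqr_ge0.
rewrite ger0_norm ?mulr_ge0 ?expR_ge0//.
have [xN|xN] := leP N `|x|; last first.
  rewrite -[leLHS]addr0 lerD ?mulr_ge0 ?sqr_ge0 ?expR_ge0//.
  by rewrite mulrC ler_wpM2r// ler_expR ler_wpM2l// ltW.
rewrite -[leLHS]add0r lerD ?mulr_ge0 ?expR_ge0//.
have -> : C ^+ 2 * expR (- (k * `|x|)) = (C * expR (- (k * `|x|))) ^+ 2 * expR (k * `|x|).
  by rewrite expRN; field; rewrite gt_eqF// expR_gt0.
by rewrite ler_wpM2r ?expR_ge0// BA ler_sqr ?nnegrE// ?Hx// (le_trans (A0 x))// Hx.
Qed.

End decay_two_sided.

(** * Analyticity of the transform of an exponentially decaying function *)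

Section cas_taylor.
Context {R : realType}.
Implicit Types (x y s r : R).

Lemma is_derive_exprn n x : is_derive x 1 (fun y : R => y ^+ n.+1) (n.+1%:R * x ^+ n).
Proof.
elim: n => [|n IH].
  by rewrite expr0 mulr1; exact: is_derive_id.
have := is_deriveM (is_derive_id x 1) IH; rewrite /GRing.scale/= => d.
rewrite (_ : (fun y => y ^+ n.+2) = (fun y => y * y ^+ n.+1)); last first.
  by apply/funext => y; rewrite exprS.
by apply: (is_derive_eq d); rewrite -[n.+2]addn1 natrD exprS; ring.
Qed.

Lemma casDpihalf y : cas (y + pi / 2) = cos y - sin y.
Proof. by rewrite /cas cosDpihalf sinDpihalf addrC. Qed.

Lemma is_derive_cas y : is_derive y 1 cas (cas (y + pi / 2)).
Proof.
have d := is_deriveD (is_derive_cos y) (is_derive_sin y).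
by apply: (is_derive_eq d); rewrite casDpihalf addrC.
Qed.

(* Sum of the first n terms, since the m-th derivative of cas is y |-> cas (y + m pi / 2). *)
Fixpoint cas_taylor n y s : R := if n is m.+1 then
  cas_taylor m y s + cas (y + m%:R * (pi / 2)) * (s ^+ m / m`!%:R) else 0.

Lemma is_derive_cas_taylor n y s :
  is_derive s 1 (cas_taylor n.+1 y) (cas_taylor n (y + pi / 2) s).
Proof.
elim: n => [|n IH].
  rewrite (_ : cas_taylor 1 y = cst (cas y)); first exact: is_derive_cst.
  by apply/funext => r /=; rewrite mul0r addr0 expr0 fact0 divr1 mulr1 add0r.
have d := is_deriveD IH (is_deriveZ (cas (y + n.+1%:R * (pi / 2)) / (n.+1)`!%:R) (is_derive_exprn n s)).
rewrite (_ : cas_taylor n.+2 y = cas_taylor n.+1 y \+ (fun r => cas (y + n.+1%:R * (pi / 2)) / (n.+1)`!%:R * r ^+ n.+1)); last first.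
  by apply/funext => r; rewrite [LHS]/= -/(cas_taylor n.+1 y r); congr (_ + _); ring.
apply: (is_derive_eq d); rewrite /GRing.scale/= -/(cas_taylor n (y + pi / 2) s).
congr (_ + _).
have -> : y + n.+1%:R * (pi / 2) = y + pi / 2 + n%:R * (pi / 2).
  by rewrite -[n.+1]addn1 natrD mulrDl mul1r; ring.
have f0 : n`!%:R != 0 :> R by rewrite pnatr_eq0 -lt0n fact_gt0.
have f1 : 1 + n%:R != 0 :> R by rewrite addrC natr1 pnatr_eq0.
by rewrite factS natrM; field; rewrite f0 f1.
Qed.

(** Monotonicity of m r^(n+1) / (n+1) + e psi(r), for e = 1 and e = -1, replaces integrating the
    bound on the derivative. *)
Lemma norm_le_of_derive (psi dpsi : R -> R) n m : psi 0 = 0 ->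
  (forall r, is_derive r 1 psi (dpsi r)) ->
  (forall r, 0 <= r <= 1 -> `|dpsi r| <= m * r ^+ n) ->
  `|psi 1| <= m / n.+1%:R.
Proof.
move=> psi0 dp bp.
have n0 : n.+1%:R != 0 :> R by rewrite pnatr_eq0.
have H (e : R) : `|e| <= 1 -> - (e * psi 1) <= m / n.+1%:R.
  move=> e1.
  pose phi r := m / n.+1%:R * r ^+ n.+1 + e * psi r.
  have dphi r : is_derive r 1 phi (m * r ^+ n + e * dpsi r).
    have d := is_deriveD (is_deriveZ (m / n.+1%:R) (is_derive_exprn n r)) (is_deriveZ e (dp r)).
    by apply: (is_derive_eq d); rewrite /GRing.scale/=; field.
  have cphi x : {for x, continuous phi}.
    by apply: differentiable_continuous; apply/derivable1_diffP; have [] := dphi x.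
  have : phi 0 <= phi 1.
    apply: (@ger0_derive1_le_cc _ phi 0 1) => //.
    - move=> x; rewrite in_itv/= => /andP[x0 x1].
      rewrite derive1E; have d := dphi x; rewrite derive_val.
      have b : `|dpsi x| <= m * x ^+ n by apply: bp; rewrite (ltW x0) (ltW x1).
      have : `|e * dpsi x| <= m * x ^+ n by rewrite normrM (le_trans _ b)// ler_piMl.
      by rewrite ler_norml => /andP[? _]; lra.
    - by apply: continuous_subspaceT => x; exact: cphi.
    - by rewrite in_itv/= lexx ler01.
    - by rewrite in_itv/= lexx ler01.
  by rewrite /phi psi0 expr0n/= !mulr0 addr0 expr1n mulr1 => h; rewrite -subr_ge0 opprK.
have := H 1; have := H (-1); rewrite normrN normr1 => /(_ (lexx _)) h1 /(_ (lexx _)) h2.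
by rewrite mulN1r opprK in h1; rewrite mul1r in h2; rewrite ler_norml h1 andbT lerNl.
Qed.

(** Along r s with r in [0, 1], the derivative of the remainder is s times the remainder of one
    order less at y + pi / 2. The 2 is the bound on |cas|, at order 0. *)
Lemma cas_taylor_le n y s : `|cas (y + s) - cas_taylor n y s| <= 2 * (`|s| ^+ n / n`!%:R).
Proof.
elim: n y s => [|n IH] y s; first by rewrite /= subr0 fact0 expr0 divr1 mulr1 cas_le2.
pose psi r := cas (y + r * s) - cas_taylor n.+1 y (r * s).
pose dpsi r := s * (cas (y + pi / 2 + r * s) - cas_taylor n (y + pi / 2) (r * s)).
have := @norm_le_of_derive psi dpsi n (2 * (`|s| ^+ n.+1 / n`!%:R)).
rewrite /psi mul1r => H.
have -> : 2 * (`|s| ^+ n.+1 / (n.+1)`!%:R) = 2 * (`|s| ^+ n.+1 / n`!%:R) / n.+1%:R.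
  have f0 : n`!%:R != 0 :> R by rewrite pnatr_eq0 -lt0n fact_gt0.
  have f1 : 1 + n%:R != 0 :> R by rewrite addrC natr1 pnatr_eq0.
  by rewrite factS natrM; field; rewrite f0 f1.
apply: H.
- rewrite mul0r addr0; have -> : cas_taylor n.+1 y 0 = cas y; last by rewrite subrr.
  elim: n {IH psi dpsi} => [|n IH]; first by rewrite /= mul0r addr0 expr0 fact0 divr1 mulr1 add0r.
  by rewrite [LHS]/= -/(cas_taylor n.+1 y 0) IH expr0n/= mul0r mulr0 addr0.
- move=> r.
  have dl : is_derive r 1 (fun r => r * s) s.
    rewrite (_ : (fun r => r * s) = (fun r => s * r)); last by apply/funext => ?; rewrite mulrC.
    exact: is_derive_mul.
  have d0 := is_derive1_comp (g := fun r => r * s) (x := r) (is_derive_cas_taylor n y (r * s)) dl.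
  have d2 : is_derive r 1 (fun r => y + r * s) s.
    have d := is_deriveD (is_derive_cst y r 1) dl.
    by apply: (is_derive_eq d); rewrite add0r.
  have d1 := is_derive1_comp (g := fun r => y + r * s) (x := r) (is_derive_cas (y + r * s)) d2.
  have d := is_deriveB d1 d0.
  apply: (is_derive_eq d); rewrite /dpsi mulrBr; congr (_ - _); last by rewrite mulrC.
  by rewrite mulrC [y + r * s + _]addrAC.
- move=> r /andP[r0 r1]; rewrite /dpsi normrM.
  rewrite (le_trans (ler_wpM2l (normr_ge0 s) (IH _ _)))// normrM (ger0_norm r0) exprMn exprS.
  rewrite le_eqVlt; apply/orP; left; apply/eqP; ring.
Qed.

Lemma pow_fact_le_exp n x : 0 <= x -> x ^+ n / n`!%:R <= expR x.
Proof.
move=> x0; case: n => [|n]; first by rewrite expr0 fact0 divr1 -expR0 ler_expR.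
by have := expR_ge1Dxn n x0; lra.
Qed.

End cas_taylor.

(** * Propagation of zeros of the transform *)

Section analytic.
Context {R : realType}.
Local Notation mu := (@lebesgue_measure R).
Variables (h : R -> R) (c : R).
Hypotheses (mh : measurable_fun setT h) (c0 : 0 < c).
Hypothesis Lh : L1 (fun y => h y * expR (c * `|y|)).

Let M := \int[mu]_y (`|h y| * expR (c * `|y|)).

Let LM : L1 (fun y => `|h y| * expR (c * `|y|)).
Proof.
have := L1_abs Lh; congr (integrable _ _ _).
by apply/funext => y /=; rewrite normrM [X in _ * X]ger0_norm ?expR_ge0.
Qed.

Let L1h : L1 h.
Proof.
apply: (L1_le mh _ LM) => y; rewrite ler_peMr// -expR0 ler_expR mulr_ge0//; exact: ltW.
Qed.

(** The Taylor coefficients of [hartley h] at [x], from expanding [cas] under the integral. The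
    weight exp(c |y|) absorbs |y|^n / n! at the price of c^-n, so the series converges to
    [hartley h] within distance c, whatever [x]. *)
Let a n x := \int[mu]_y (h y * (cas (x * y + n%:R * (pi / 2)) * (y ^+ n / n`!%:R))).

Let pow_le n (y : R) : `|y| ^+ n / n`!%:R <= c ^- n * expR (c * `|y|).
Proof.
have := @pow_fact_le_exp R n (c * `|y|); rewrite mulr_ge0 ?(ltW c0)// => /(_ isT).
have cn : 0 < c ^+ n by rewrite exprn_gt0.
by rewrite exprMn -mulrA -ler_pdivlMl// mulrC.
Qed.

Let La n x : L1 (fun y => h y * (cas (x * y + n%:R * (pi / 2)) * (y ^+ n / n`!%:R))).
Proof.
have mc := @measurable_cas R.
apply: (@L1_le _ _ (fun y => 2 * c ^- n * (`|h y| * expR (c * `|y|)))); first by mfun.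
- move=> y; rewrite normrM [X in _ <= X]mulrCA ler_wpM2l// normrM -mulrA ler_pM ?cas_le2//.
  rewrite normrM normrX (@ger0_norm _ (_^-1)) ?invr_ge0//; exact: pow_le.
- exact: L1Z.
Qed.

Fixpoint analytic_sum n x s : R := if n is m.+1 then analytic_sum m x s + a m x * s ^+ m else 0.

Let Rint_taylor n x s : L1 (fun y => h y * cas_taylor n (x * y) (s * y)) /\
  \int[mu]_y (h y * cas_taylor n (x * y) (s * y)) = analytic_sum n x s.
Proof.
elim: n => [|n [IL IH]] /=.
  split; last by under eq_Rintegral do rewrite mulr0; rewrite Rintegral_cst// mul0r.
  have := L1Z 0 L1h; congr (integrable _ _ _); apply/funext => y /=.
  by rewrite mul0r mulr0.
have E y : h y * (cas_taylor n (x * y) (s * y) + cas (x * y + n%:R * (pi / 2)) * ((s * y) ^+ n / n`!%:R))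
  = h y * cas_taylor n (x * y) (s * y) + s ^+ n * (h y * (cas (x * y + n%:R * (pi / 2)) * (y ^+ n / n`!%:R))).
  by rewrite exprMn; ring.
have L2 := L1Z (s ^+ n) (La n x).
split.
  have := L1D IL L2; congr (integrable _ _ _); apply/funext => y /=.
  by rewrite E.
under eq_Rintegral do rewrite E.
by rewrite RintegralD// IH RintegralZl ?[in RHS](mulrC (a n x))//; exact: La.
Qed.

Let taylor_bound n x s :
  `|hartley h (x + s) - analytic_sum n x s| <= 2 * M * (`|s| / c) ^+ n.
Proof.
have [IL <-] := Rint_taylor n x s.
have LH := L1_cas (x + s) L1h.
rewrite /hartley -RintegralB//.
rewrite (_ : 2 * M * _ = \int[mu]_y (2 * (`|s| / c) ^+ n * (`|h y| * expR (c * `|y|)))); last first.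
  by rewrite RintegralZl// /M; ring.
apply: Rint_norm_le => [||y]; [exact: L1B|exact: L1Z|].
rewrite -mulrBr normrM [leRHS]mulrCA ler_wpM2l// mulrDl.
rewrite (le_trans (cas_taylor_le _ _ _))// -mulrA ler_pM2l// normrM exprMn -mulrA.
rewrite (_ : (`|s| / c) ^+ n * expR (c * `|y|) = `|s| ^+ n * (c ^- n * expR (c * `|y|))); last first.
  by rewrite exprMn exprVn mulrA.
by rewrite ler_wpM2l ?exprn_ge0// pow_le.
Qed.

Let M0 : 0 <= M.
Proof. by apply: Rintegral_ge0 => y _; rewrite mulr_ge0 ?expR_ge0. Qed.

(** All Taylor coefficients at [x] vanish: if those below n do, dividing by s^n and letting s tend
    to 0 gives the n-th. For s <= c / 2 the remainders are then at most 2 M 2^-n. The reach c / 2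
    does not depend on [d], which allows iteration. *)
Let analytic_step x d : 0 < d -> (forall s, 0 <= s <= d -> hartley h (x + s) = 0) ->
  forall s, 0 <= s <= c / 2 -> hartley h (x + s) = 0.
Proof.
move=> d0 H.
have an0 n : forall i, (i < n)%N -> a i x = 0.
  elim: n => // n IH i; rewrite ltnS leq_eqVlt => /predU1P[->{i}|]; last exact: IH.
  have S0 s : analytic_sum n x s = 0.
    elim: n IH => //= n IHn IH; rewrite IHn ?IH ?mul0r ?addr0// => i ni.
    by apply: IH; rewrite ltnS ltnW.
  apply/eqP; rewrite -normr_le0; apply/ler_addgt0Pr => e e0; rewrite add0r.
  (* After division by s^n the remainder of order n + 1 is at most (C - 1) s; the 1 keeps [C]
     positive even for M = 0. *)
  pose C := 2 * M / c ^+ n.+1 + 1.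
  have cn : 0 < c ^+ n.+1 by rewrite exprn_gt0.
  have C0 : 0 < C by rewrite /C ltr_wpDl// divr_ge0 ?(ltW cn)// mulr_ge0.
  pose s := Num.min d (e / C).
  have s0 : 0 < s by rewrite /s lt_min d0 divr_gt0.
  have sd : s <= d by rewrite /s ge_min lexx.
  have se : s * C <= e by rewrite -ler_pdivlMr// /s ge_min lexx orbT.
  have := taylor_bound n.+1 x s; rewrite H ?(ltW s0)//= S0 !add0r normrN normrM.
  rewrite (gtr0_norm s0) normrX (gtr0_norm s0) => b.
  have sn : 0 < s ^+ n by rewrite exprn_gt0.
  rewrite -(ler_pM2r sn) (le_trans b)//.
  have -> : 2 * M * (s / c) ^+ n.+1 = 2 * M / c ^+ n.+1 * s * s ^+ n.
    by rewrite exprMn exprVn exprS; ring.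
  rewrite ler_wpM2r ?(ltW sn)// (le_trans _ se)// mulrC ler_wpM2l ?(ltW s0)//.
  by rewrite /C lerDl.
move=> s /andP[s0 sc].
have S0 n : analytic_sum n x s = 0.
  by elim: n => //= n ->; rewrite (an0 n.+1) ?mul0r ?addr0.
have b n : `|hartley h (x + s)| <= 2 * M * 2^-1 ^+ n.
  have := taylor_bound n x s; rewrite S0 subr0 => /le_trans; apply.
  rewrite ler_wpM2l ?mulr_ge0// ger0_norm// lerXn2r ?nnegrE ?divr_ge0 ?(ltW c0)//.
  by rewrite ler_pdivrMr// mulrC.
have cv : 2 * M * 2^-1 ^+ n @[n --> \oo] --> (0 : R).
  rewrite -(mulr0 (2 * M)); apply: cvgM; first exact: cvg_cst.
  apply: cvg_expr; rewrite ger0_norm; lra.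
apply/eqP; rewrite -normr_le0.
apply: (@ler_cvg_to _ _ _ _ (fun _ : nat => `|hartley h (x + s)|) _ _ _ (cvg_cst _) cv).
by apply: nearW => n; exact: b.
Qed.

Lemma hartley_zero_right x1 x2 : x1 < x2 ->
  (forall x, x1 <= x <= x2 -> hartley h x = 0) -> forall x, x1 <= x -> hartley h x = 0.
Proof.
move=> x12 H.
have c4 : 0 < c / 4 by rewrite divr_gt0.
(* Steps of c / 4, half the reach: each new base point already has zeros on the c / 4 to its right,
   as [analytic_step] requires. *)
have Hm m : forall s, 0 <= s <= m.+2%:R * (c / 4) -> hartley h (x1 + s) = 0.
  elim: m => [|m IH] s.
    rewrite (_ : 2%:R * (c / 4) = c / 2); last by field.
    apply: (@analytic_step x1 (x2 - x1)); first by rewrite subr_gt0.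
    by move=> r /andP[r0 r1]; apply: H; apply/andP; split; lra.
  have [sm|sm] := leP s (m.+2%:R * (c / 4)).
    move=> /andP[s0 _]; apply: IH; by rewrite s0.
  move=> /andP[s0 s1].
  have -> : x1 + s = (x1 + m.+1%:R * (c / 4)) + (s - m.+1%:R * (c / 4)) by ring.
  have E3 : m.+3%:R = m.+1%:R + 2 :> R by rewrite -natrD addn2.
  have E2 : m.+2%:R = m.+1%:R + 1 :> R by rewrite natr1.
  rewrite E3 mulrDl in s1; rewrite E2 mulrDl in sm IH.
  apply: (@analytic_step _ (c / 4)) => //; last by apply/andP; split; lra.
  move=> r /andP[r0 r1]; rewrite -addrA; apply: IH.
  have : 0 <= m.+1%:R * (c / 4) by rewrite mulr_ge0// ltW.
  by move=> ?; apply/andP; split; lra.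
move=> x x1x.
have -> : x = x1 + (x - x1) by ring.
apply: (Hm (Num.truncn ((x - x1) / (c / 4)))).
rewrite subr_ge0 x1x/= -ler_pdivrMr//.
rewrite (le_trans (ltW (truncnS_gt _)))// ler_nat//.
Qed.

End analytic.

(** * Square-integrable functions *)

Section continuity.
Context {R : realType}.
Local Notation mu := (@lebesgue_measure R).
Implicit Types (al be ga phi : R -> R).

Lemma continuous_maxr (f g : R -> R) : continuous f -> continuous g ->
  continuous (fun x => Num.max (f x) (g x)).
Proof.
move=> cf cg; have -> : (fun x => Num.max (f x) (g x)) = (fun x => 2^-1 * (f x + g x + `|f x - g x|)).
  apply/funext => x; case: (lerP (f x) (g x)) => h.
    by lra.
  by lra.
move=> x; apply: cvgM; first exact: cvg_cst.
apply: cvgD; first by apply: cvgD; [exact: cf|exact: cg].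
by apply: cvg_norm; apply: cvgB; [exact: cf|exact: cg].
Qed.

(** Truncation to [-m, m], written with maxima alone so that [continuous_maxr] covers it. *)
Let clip (m y : R) : R := - Num.max (- m) (- Num.max (- m) y).

Let clip_bound m y : 0 <= m -> `|clip m y| <= m.
Proof.
move=> m0; rewrite /clip normrN ler_norml le_max lexx/= ge_max; apply/andP; split; first by lra.
by rewrite lerNl le_max lexx.
Qed.

Let clip_id m y : `|y| <= m -> clip m y = y.
Proof.
rewrite ler_norml => /andP[y1 y2]; rewrite /clip (max_r y1) max_r ?opprK// lerN2//.
Qed.

Let clip_lip m y z : `|clip m y - clip m z| <= `|y - z|.
Proof.
have H (u v w : R) : `|Num.max u v - Num.max u w| <= `|v - w|.
  have h1 := ler_norm (v - w); have h2 := ler_norm (w - v); rewrite distrC in h2.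
  by rewrite ler_norml; case: (lerP u v) => uv; case: (lerP u w) => uw; apply/andP; split; lra.
rewrite /clip -opprD normrN (le_trans (H _ _ _))// -opprD normrN; exact: H.
Qed.

(** A trapezoid: 1 for |x| <= m, 0 for |x| >= m + 1. *)
Let cut (m x : R) : R := clip 1 (Num.max 0 (m + 1 - `|x|)).

(** After truncating both domain and range, an L1 approximation by continuous functions suffices:
    two functions bounded by m have squared difference at most 2m times their difference, and
    clipping does not increase the distance. *)
Lemma L2_dense al eps : measurable_fun setT al -> L1 (fun x => al x ^+ 2) -> 0 < eps ->
  exists be, exists m : R, [/\ continuous be, forall x, `|be x| <= m,
    forall x, m + 1 <= `|x| -> be x = 0, L1 (fun x => (al x - be x) ^+ 2) &
    \int[mu]_x ((al x - be x) ^+ 2) <= eps].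
Proof.
move=> mal Lal eps0.
have arith (x y z : R) : x < z / 4 -> y <= z / 4 -> 2 * x + 2 * y <= z by move=> ? ?; lra.
pose I (n : nat) : set R := `[- n%:R, n%:R]%classic.
have IE n x : (x \in I n) = (`|x| <= n%:R) by rewrite ler_norml /I; apply/idP/idP; rewrite inE/= in_itv.
have mI n : measurable_fun setT (\1_(I n) : R -> R) by apply: measurable_indic; exact: measurable_itv.
pose aln n x := al x * (\1_(I n) x * \1_(I n) (al x)).
have maln n : measurable_fun setT (aln n) by have mIn := mI n; rewrite /aln; mfun.
have alnE n x : aln n x = al x /\ `|x| <= n%:R /\ `|al x| <= n%:R \/ aln n x = 0.
  rewrite /aln !indicE !IE.
  have [h1|h1] := boolP (`|x| <= n%:R); last by right; rewrite mul0r mulr0.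
  have [h2|h2] := boolP (`|al x| <= n%:R); last by right; rewrite !mulr0.
  by left; rewrite !mulr1.
have aln_sq n x : (al x - aln n x) ^+ 2 <= al x ^+ 2.
  by case: (alnE n x) => [[-> _]|->]; rewrite ?subrr ?expr0n ?sqr_ge0//= subr0.
have Ln n : L1 (fun x => (al x - aln n x) ^+ 2).
  apply: (L1_le _ _ Lal) => [|x]; first by have h := maln n; mfun.
  by rewrite ger0_norm ?sqr_ge0.
have cn : \int[mu]_x ((al x - aln n x) ^+ 2) @[n --> \oo] --> (0 : R).
  have -> : (0 : R) = \int[mu]_x (cst 0 x : R) by rewrite Rintegral_cst// mul0r.
  apply: (@Rint_dominated _ _ _ (fun x => al x ^+ 2)) => //.
  - by move=> n; exact: L1_measurable.
  - by move=> n x; rewrite ger0_norm ?sqr_ge0.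
  - move=> x; apply: cvg_near_cst.
    exists (Num.truncn (Num.max `|x| `|al x|)).+1 => // n /= xn.
    have : Num.max `|x| `|al x| <= n%:R.
      by rewrite (le_trans (ltW (truncnS_gt _)))// ler_nat.
    rewrite ge_max => /andP[h1 h2].
    by rewrite /aln !indicE !IE h1 h2 !mulr1 subrr expr0n.
have e4 : 0 < eps / 4 by rewrite divr_gt0.
have /cvgrPdist_lt /(_ _ e4) [n0 _ /(_ n0.+1 (leqnSn _))/=] := cn.
set n := n0.+1; rewrite sub0r normrN ger0_norm; last by apply: Rintegral_ge0 => x _; rewrite sqr_ge0.
move=> Hn.
pose m : R := n%:R.
have m0 : 0 < m by rewrite ltr0n.
(* One unit wider than the support of [aln n], so as to contain that of [be]. *)
pose E : set R := `[- n.+1%:R, n.+1%:R]%classic.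
have mE : measurable E by exact: measurable_itv.
have muE : (mu E < +oo)%E by rewrite /E lebesgue_measure_itv/=; case: ifP; rewrite ?ltry// -EFinB ltry.
have aln_le x : `|aln n x| <= m * \1_E x.
  case: (alnE n x) => [[-> [h1 h2]]|->]; last by rewrite normr0 mulr_ge0// ltW.
  by rewrite indicE (_ : x \in E) ?mulr1// (IE n.+1) (le_trans h1)// ler_nat.
have LE : L1 (\1_E : R -> R) by exact: (@integrable_indic_itv R (- n.+1%:R) n.+1%:R true false).
have Laln : L1 (aln n) by apply: (L1_le (maln n) _ (L1Z m LE)).
have iE : mu.-integrable E (EFin \o aln n) by apply: (@integrableS _ _ _ mu setT E) Laln.
have [g [cg ig Hg]] := approximation_continuous_integrable mE muE iE.
(* Multiplied by the 2m of [key] this is eps / 4; [sq_split] then doubles this error and that of the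
   truncation. *)
have e8 : 0 < eps / (8 * m) by rewrite divr_gt0// mulr_gt0.
move/fine_cvgP : Hg => [Hgf /cvgrPdist_lt /(_ _ e8) Hgd].
have [k [Hk1 Hk2]] : exists k, (\int[mu]_(z in E) `|(aln n z - g k z)%:E|)%E \is a fin_num /\
   `|0 - fine (\int[mu]_(z in E) `|(aln n z - g k z)%:E|)%E| < eps / (8 * m).
  by have [k0 _ Hk] := filterI Hgf Hgd; exists k0; have [] := Hk k0 (leqnn k0).
pose be x := cut m x * clip m (g k x).
have cut01 x : 0 <= cut m x <= 1.
  rewrite /cut /clip; set u := Num.max 0 _.
  have u0 : 0 <= u by rewrite /u le_max lexx.
  rewrite (max_r (_ : -1 <= u)); last by lra.
  rewrite lerNr oppr0 ge_max lerN10 oppr_le0 u0/= lerNl le_max lexx//.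
have cut_eq1 x : `|x| <= m -> cut m x = 1.
  move=> xm; rewrite /cut /clip; set u := Num.max 0 _.
  have u1 : 1 <= u by rewrite /u le_max; apply/orP; right; lra.
  by rewrite (max_r (_ : -1 <= u)) ?max_l ?opprK//; lra.
have cut_eq0 x : m + 1 <= `|x| -> cut m x = 0.
  move=> xm; rewrite /cut (max_l (_ : m + 1 - `|x| <= 0)); last by lra.
  by rewrite clip_id// normr0.
have cclip (f : R -> R) r : continuous f -> continuous (fun x => clip r (f x)).
  move=> cf x; rewrite /clip; apply: cvgN.
  apply: (@continuous_maxr (cst (- r)) (fun x => - Num.max (- r) (f x))).
    by move=> y; exact: cvg_cst.
  move=> y; apply: cvgN; apply: (@continuous_maxr (cst (- r)) f) => //.
  by move=> z; exact: cvg_cst.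
have cbe : continuous be.
  move=> x; apply: cvgM; last by apply: cclip; exact: cg.
  apply: (@cclip (fun x => Num.max 0 (m + 1 - `|x|)) 1).
  apply: (@continuous_maxr (cst 0) (fun x => m + 1 - `|x|)).
    by move=> y; exact: cvg_cst.
  by move=> y; apply: cvgB; [exact: cvg_cst|exact: norm_continuous].
have mbe := continuous_measurable_fun cbe.
have be_le x : `|be x| <= m.
  by rewrite /be normrM -[leRHS]mul1r ler_pM ?clip_bound ?(ltW m0).
have be0 x : m + 1 <= `|x| -> be x = 0 by move=> xm; rewrite /be cut_eq0 ?mul0r.
pose q x : R := `|aln n x - g k x| * \1_E x.
have mgk := continuous_measurable_fun (cg k).
have mq : measurable_fun setT q.
  have h := maln n; have h2 := L1_measurable LE; rewrite /q; mfun.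
have iq : (\int[mu]_x `|q x|%:E = \int[mu]_(z in E) `|(aln n z - g k z)%:E|)%E.
  rewrite [RHS]integral_mkcond; apply: eq_integral => y _.
  by rewrite /q patchE indicE; case: ifPn => yE; rewrite ?mulr1 ?mulr0 ?normr0// normr_id.
have Lq : L1 q by apply: L1P => //; rewrite iq -(fineK Hk1) ltry.
have Iq : \int[mu]_x q x <= eps / (8 * m).
  rewrite /Rintegral; under eq_integral do rewrite -[q _]ger0_norm ?mulr_ge0//.
  by rewrite iq (le_trans _ (ltW Hk2))// sub0r normrN ler_norm.
have key x : (aln n x - be x) ^+ 2 <= 2 * m * q x.
  have [xE|xE] := boolP (x \in E); last first.
    have xn : m + 1 <= `|x|.
      by move: xE; rewrite (IE n.+1) -ltNge => /ltW; rewrite -natr1.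
    rewrite be0// subr0; have := aln_le x; rewrite /q indicE (negbTE xE) !mulr0.
    by rewrite normr_le0 => /eqP ->; rewrite expr0n.
  rewrite /q indicE xE mulr1.
  have E1 : `|aln n x - be x| <= `|aln n x - g k x|.
    have -> : aln n x - be x = cut m x * (clip m (aln n x) - clip m (g k x)).
      rewrite /be mulrBr; congr (_ - _).
      have am : `|aln n x| <= m by rewrite (le_trans (aln_le x))// indicE xE mulr1.
      rewrite clip_id//; case: (alnE n x) => [[_ [h1 _]]|->]; last by rewrite mulr0.
      by rewrite cut_eq1// mul1r.
    have /andP[h1 h2] := cut01 x.
    by rewrite normrM (ger0_norm h1) (le_trans _ (clip_lip m _ _))// ler_piMl.
  have E2 : `|aln n x - be x| <= 2 * m.
    rewrite (le_trans (ler_normB _ _))// mulr_natl mulr2n lerD//.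
    by rewrite (le_trans (aln_le x))// indicE xE mulr1.
  by rewrite -real_normK ?num_real// expr2 ler_pM.
have Lkey : L1 (fun x => (aln n x - be x) ^+ 2).
  apply: (L1_le _ _ (L1Z (2 * m) Lq)) => [|x]; first by have h := maln n; mfun.
  by rewrite ger0_norm ?sqr_ge0.
have sq_split x : (al x - be x) ^+ 2 <= 2 * (al x - aln n x) ^+ 2 + 2 * (aln n x - be x) ^+ 2.
  by have := sqr_ge0 ((al x - aln n x) - (aln n x - be x)); nra.
have Lbe : L1 (fun x => (al x - be x) ^+ 2).
  apply: (L1_le _ _ (L1D (L1Z 2 (Ln n)) (L1Z 2 Lkey))) => [|x]; first by mfun.
  by rewrite ger0_norm ?sqr_ge0.
exists be, m; split => //.
apply: (le_trans (Rint_le Lbe (L1D (L1Z 2 (Ln n)) (L1Z 2 Lkey)) sq_split)).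
rewrite RintegralD//; [|exact: L1Z|exact: L1Z].
rewrite !RintegralZl//.
have := Rint_le Lkey (L1Z (2 * m) Lq) key; rewrite RintegralZl// => H1.
have H2 : 2 * m * \int[mu]_x q x <= 2 * m * (eps / (8 * m)) by rewrite ler_pM2l// mulr_gt0.
have E3 : 2 * m * (eps / (8 * m)) = eps / 4 by field; rewrite gt_eqF.
by apply: arith => //; rewrite -E3 (le_trans H1).
Qed.

Lemma L1_shear al be phi x : measurable_fun setT al -> measurable_fun setT be ->
  measurable_fun setT phi -> (forall s, `|phi s| <= 1) ->
  L1 (fun x => al x ^+ 2) -> L1 (fun x => be x ^+ 2) ->
  L1 (fun s => al (x + s) * be (x - s) * phi s).
Proof.
move=> ma mb mp p1 La Lb.
have La' : L1 (fun s => al (x + s) ^+ 2).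
  have := L1_affine x ltr01 La; congr (integrable _ _ _).
  by apply/funext => s /=; rewrite mul1r addrC.
have Lb' : L1 (fun s => be (x - s) ^+ 2).
  have := L1_opp (L1_affine x ltr01 Lb); congr (integrable _ _ _).
  by apply/funext => s /=; rewrite mul1r addrC.
apply: (L1_le _ _ (L1D La' Lb')) => [|s]; first by mfun.
rewrite normrM (le_trans (_ : _ <= `|al (x + s) * be (x - s)| * 1))//; first by rewrite ler_wpM2l.
rewrite mulr1 ler_norml; have := sqr_ge0 (al (x + s) - be (x - s)).
by have := sqr_ge0 (al (x + s) + be (x - s)); move=> *; apply/andP; split; nra.
Qed.

(** A weighted Young inequality in place of Cauchy-Schwarz; a large [lam] makes the second term
    small, and the first is small when [al] is an approximation error. *)
Lemma Rint_shear_le al be phi x lam : measurable_fun setT al -> measurable_fun setT be ->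
  measurable_fun setT phi -> (forall s, `|phi s| <= 1) ->
  L1 (fun x => al x ^+ 2) -> L1 (fun x => be x ^+ 2) -> 0 < lam ->
  `|\int[mu]_s (al (x + s) * be (x - s) * phi s)| <=
    lam * \int[mu]_x (al x ^+ 2) + lam^-1 * \int[mu]_x (be x ^+ 2).
Proof.
move=> ma mb mp p1 La Lb l0.
have Ia := Rint_affine x ltr01 La; have Ib := Rint_opp (L1_affine x ltr01 Lb).
rewrite (Rint_affine x ltr01 Lb) invr1 !mul1r in Ia Ib.
have La' := L1_affine x ltr01 La.
have Lb' := L1_opp (L1_affine x ltr01 Lb).
rewrite -Ia -Ib -!RintegralZl// -RintegralD//; [|exact: L1Z|exact: L1Z].
apply: Rint_norm_le; [exact: L1_shear|by apply: L1D; exact: L1Z|move=> s].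
rewrite !mul1r [s + x]addrC [- s + x]addrC.
rewrite normrM (le_trans (_ : _ <= `|al (x + s) * be (x - s)| * 1))//; first by rewrite ler_wpM2l.
set u := al _; set v := be _.
have li : lam * lam^-1 = 1 by rewrite divff// gt_eqF.
have i0 : 0 < lam^-1 by rewrite invr_gt0.
have h1 : 0 <= lam * (u - lam^-1 * v) ^+ 2 by rewrite mulr_ge0 ?sqr_ge0// ltW.
have h2 : 0 <= lam * (u + lam^-1 * v) ^+ 2 by rewrite mulr_ge0 ?sqr_ge0// ltW.
have e1 : lam * (u - lam^-1 * v) ^+ 2 = lam * u ^+ 2 - 2 * (u * v) + lam^-1 * v ^+ 2.
  by field; rewrite gt_eqF.
have e2 : lam * (u + lam^-1 * v) ^+ 2 = lam * u ^+ 2 + 2 * (u * v) + lam^-1 * v ^+ 2.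
  by field; rewrite gt_eqF.
have h3 : 0 <= lam * u ^+ 2 by rewrite mulr_ge0 ?sqr_ge0// ltW.
have h4 : 0 <= lam^-1 * v ^+ 2 by rewrite mulr_ge0 ?sqr_ge0// ltW.
rewrite mulr1 ler_norml; rewrite e1 in h1; rewrite e2 in h2.
by apply/andP; split; lra.
Qed.

(** Approximating [al] by a bounded continuous [ga] of compact support costs an error uniform in x,
    so continuity is needed for [ga] only. *)
Lemma continuous_shear al be phi : measurable_fun setT al -> measurable_fun setT be ->
  continuous phi -> (forall s, `|phi s| <= 1) ->
  L1 (fun x => al x ^+ 2) -> L1 (fun x => be x ^+ 2) ->
  continuous (fun x => \int[mu]_s (al (x + s) * be (x - s) * phi s)).
Proof.
move=> ma mb cp p1 La Lb x0; have mp := continuous_measurable_fun cp.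
apply/cvgrPdist_lt => eps eps0.
pose Ib := \int[mu]_x (be x ^+ 2).
have Ib0 : 0 <= Ib by apply: Rintegral_ge0 => x _; rewrite sqr_ge0.
(* Five shares: 2 eta for replacing [al] by [ga] at each of two points, and eta for the continuity
   of [G]. The choice of [lam] makes each term of [Rint_shear_le] at most eta. *)
pose eta := eps / 5.
have eta0 : 0 < eta by rewrite divr_gt0.
pose lam := (Ib + 1) / eta.
have lam0 : 0 < lam by rewrite divr_gt0// ltr_wpDl.
have el0 : 0 < eta / lam by rewrite divr_gt0.
have [ga [m [cga gam ga0 Lga Iga]]] := L2_dense ma La el0.
have mga := continuous_measurable_fun cga.
have m0 : 0 <= m by rewrite (le_trans _ (gam 0)).
have Lga2 : L1 (fun x => ga x ^+ 2).
  apply: (L1_le _ _ (L1D (L1Z 2 La) (L1Z 2 Lga))) => [|x]; first by mfun.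
  rewrite ger0_norm ?sqr_ge0//; have := sqr_ge0 (2 * al x - ga x); nra.
pose J x := \int[mu]_s (al (x + s) * be (x - s) * phi s).
pose G x := \int[mu]_s (ga (x + s) * be (x - s) * phi s).
have JG x : `|J x - G x| <= 2 * eta.
  rewrite /J /G -RintegralB//; [|exact: L1_shear|exact: L1_shear].
  have -> : \int[mu]_s (al (x + s) * be (x - s) * phi s - ga (x + s) * be (x - s) * phi s) =
     \int[mu]_s ((fun y => al y - ga y) (x + s) * be (x - s) * phi s).
    by apply: eq_Rintegral => s _; ring.
  have md : measurable_fun setT (fun y => al y - ga y) by mfun.
  rewrite (le_trans (Rint_shear_le x md mb mp p1 Lga Lb lam0))//.
  rewrite mulr_natl mulr2n lerD//.
    by rewrite -ler_pdivlMl// mulrC.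
  rewrite /lam invf_div mulrAC -/Ib ler_pdivrMr ?ltr_wpDl// ler_pM2l//; lra.
(* With v = x - s the factor [be], which is merely measurable, no longer depends on x. *)
have GE x : G x = \int[mu]_v (ga (2 * x - v) * be v * phi (x - v)).
  have L := L1_shear x mga mb mp p1 Lga2 Lb.
  rewrite /G -(Rint_opp L); have := Rint_affine (- x) ltr01 (L1_opp L).
  rewrite invr1 mul1r => <-; apply: eq_Rintegral => v _.
  by congr (ga _ * be _ * phi _); ring.
have cG : {for x0, continuous G}.
  have -> : G = (fun x => \int[mu]_v (ga (2 * x - v) * be v * phi (x - v))) by exact/funext.
  (* If |x - x0| < 1 and |2x - v| < m + 1, then |v| < m + 3 + 2|x0|. *)
  pose K := (Num.truncn (m + 3 + 2 * `|x0|)).+1.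
  pose chi : R -> R := \1_(`[- K%:R, K%:R]%classic).
  have Lchi : L1 chi by exact: (@integrable_indic_itv R (- K%:R) K%:R true false).
  apply: (@Rint_continuous _ (fun x v => ga (2 * x - v) * be v * phi (x - v))
     (fun v => m * (chi v + be v ^+ 2)) x0 1) => //.
  - by apply: L1Z; exact: L1D.
  - by move=> x; mfun.
  - move=> v x; apply: cvgM.
      apply: cvgM; last exact: cvg_cst.
      have : {for x, continuous (ga \o (fun x => 2 * x - v))}.
        apply: continuous_comp; last exact: cga.
        by apply: cvgB; [exact: mulrl_continuous|exact: cvg_cst].
      exact.
    have : {for x, continuous (phi \o (fun x => x - v))}.
      apply: continuous_comp; last exact: cp.
      by apply: cvgB; [exact: cvg_id|exact: cvg_cst].
    exact.
  - move=> x v xx0.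
    rewrite normrM (le_trans (_ : _ <= `|ga (2 * x - v) * be v| * 1))//; first by rewrite ler_wpM2l.
    rewrite mulr1 normrM.
    have [h|h] := leP (m + 1) `|2 * x - v|.
      by rewrite ga0// normr0 mul0r mulr_ge0// addr_ge0 ?sqr_ge0// /chi indicE.
    rewrite ler_pM ?gam//.
    have -> : chi v = 1.
      rewrite /chi indicE mem_set//= in_itv/= -ler_norml.
      have hK : m + 3 + 2 * `|x0| < K%:R by exact: truncnS_gt.
      rewrite (le_trans _ (ltW hK))//.
      move: h xx0; rewrite !ltr_norml ler_norml => /andP[? ?] /andP[? ?].
      have := ler_norm x0; have := ler_norm (- x0); rewrite normrN => *.
      by apply/andP; split; lra.
    rewrite ler_norml; have := sqr_ge0 (be v - 1); have := sqr_ge0 (be v + 1).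
    by move=> *; apply/andP; split; nra.
move/cvgrPdist_lt : cG => /(_ _ eta0).
apply: filterS => x Gx.
have -> : J x0 - J x = (J x0 - G x0) + (G x0 - G x) - (J x - G x) by ring.
rewrite (le_lt_trans (ler_normB _ _))//.
have h1 := JG x0; have h2 := JG x; have h3 := ler_normD (J x0 - G x0) (G x0 - G x).
have : eps = 5 * eta by rewrite /eta; field.
by move=> ->; lra.
Qed.

End continuity.

(** * Midpoint products and the power spectrum *)

Section shear.
Context {R : realType}.
Local Notation mu := (@lebesgue_measure R).
Implicit Types (al be a : R -> R).

Definition L12 (f : R -> R) := L1 f /\ L1 (fun x => f x ^+ 2).

Lemma L12_measurable al : L12 al -> measurable_fun setT al.
Proof. by case=> /L1_measurable. Qed.

Lemma L12M al (h : R -> R) : L12 al -> measurable_fun setT h -> (forall x, `|h x| <= 1) ->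
  L12 (fun x => al x * h x).
Proof.
move=> La mh h1; have ma := L12_measurable La; case: La => La La2.
split.
  apply: (L1_le _ _ (L1_abs La)) => [|x]; first by mfun.
  by rewrite normrM ler_piMr.
apply: (L1_le _ _ La2) => [|x]; first by mfun.
rewrite ger0_norm ?sqr_ge0// exprMn ler_piMr ?sqr_ge0//.
by rewrite -real_normK ?num_real// expr_le1.
Qed.

Lemma L12D al be : L12 al -> L12 be -> L12 (fun x => al x + be x).
Proof.
move=> La Lb; have ma := L12_measurable La; have mb := L12_measurable Lb.
case: La Lb => La La2 [Lb Lb2]; split; first exact: L1D.
apply: (L1_le _ _ (L1D (L1Z 2 La2) (L1Z 2 Lb2))) => [|x]; first by mfun.
by rewrite ger0_norm ?sqr_ge0//; have := sqr_ge0 (al x - be x); nra.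
Qed.

Lemma L12B al be : L12 al -> L12 be -> L12 (fun x => al x - be x).
Proof.
move=> La Lb; have ma := L12_measurable La; have mb := L12_measurable Lb.
case: La Lb => La La2 [Lb Lb2]; split; first exact: L1B.
apply: (L1_le _ _ (L1D (L1Z 2 La2) (L1Z 2 Lb2))) => [|x]; first by mfun.
by rewrite ger0_norm ?sqr_ge0//; have := sqr_ge0 (al x + be x); nra.
Qed.

Lemma L1_shear1 al be x : L12 al -> L12 be -> L1 (fun s => al (x + s) * be (x - s)).
Proof.
move=> La Lb; have ma := L12_measurable La; have mb := L12_measurable Lb.
have m1 : measurable_fun setT (cst 1 : R -> R) by mfun.
have := @L1_shear R al be (cst 1) x ma mb m1 _ La.2 Lb.2.
rewrite /= normr1 => /(_ (fun=> lexx _)); congr (integrable _ _ _).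
by apply/funext => s /=; rewrite mulr1.
Qed.

Lemma Rint_shear al be : L12 al -> L12 be ->
  L1 (fun x => \int[mu]_s (al (x + s) * be (x - s))) /\
  \int[mu]_x \int[mu]_s (al (x + s) * be (x - s)) =
    2^-1 * (\int[mu]_x al x * \int[mu]_x be x).
Proof.
move=> La Lb.
have E x : \int[mu]_s (al (x + s) * be (x - s)) = \int[mu]_v (al (2 * x - v) * be v).
  have L := L1_shear1 x La Lb.
  rewrite -(Rint_opp L); have := Rint_affine (- x) ltr01 (L1_opp L).
  rewrite invr1 mul1r => <-; apply: eq_Rintegral => v _.
  by congr (al _ * be _); ring.
split.
  have := L1_Fubini (L1_2_conv La.1 Lb.1); congr (integrable _ _ _).
  by apply/funext => x /=; rewrite E.
rewrite -(Rint_conv La.1 Lb.1); apply: eq_Rintegral => x _; exact: E.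
Qed.

(** Four products are what the real plus the imaginary part of a product of two complex functions
    expands into. *)
Lemma Rint_shear4 a1 a2 a3 a4 b1 b2 b3 b4 : L12 a1 -> L12 a2 -> L12 a3 -> L12 a4 ->
  L12 b1 -> L12 b2 -> L12 b3 -> L12 b4 ->
  let F x s := a1 (x + s) * b1 (x - s) + a2 (x + s) * b2 (x - s) +
    (a3 (x + s) * b3 (x - s) + a4 (x + s) * b4 (x - s)) in
  [/\ forall x, L1 (F x), L1 (fun x => \int[mu]_s F x s) &
  \int[mu]_x \int[mu]_s F x s =
    2^-1 * (\int[mu]_x a1 x * \int[mu]_x b1 x + \int[mu]_x a2 x * \int[mu]_x b2 x +
      (\int[mu]_x a3 x * \int[mu]_x b3 x + \int[mu]_x a4 x * \int[mu]_x b4 x))].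
Proof.
move=> A1 A2 A3 A4 B1 B2 B3 B4 F.
have [l1 e1] := Rint_shear A1 B1; have [l2 e2] := Rint_shear A2 B2.
have [l3 e3] := Rint_shear A3 B3; have [l4 e4] := Rint_shear A4 B4.
have LF x : L1 (F x) by apply: L1D; apply: L1D; exact: L1_shear1.
have E x : \int[mu]_s F x s = \int[mu]_s (a1 (x + s) * b1 (x - s)) + \int[mu]_s (a2 (x + s) * b2 (x - s)) +
    (\int[mu]_s (a3 (x + s) * b3 (x - s)) + \int[mu]_s (a4 (x + s) * b4 (x - s))).
  rewrite RintegralD//; [|by apply: L1D; exact: L1_shear1|by apply: L1D; exact: L1_shear1].
  by rewrite !RintegralD//; exact: L1_shear1.
split => //.
  have := L1D (L1D l1 l2) (L1D l3 l4); congr (integrable _ _ _).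
  by apply/funext => x /=; rewrite E.
under eq_Rintegral do rewrite E.
rewrite RintegralD//; [|exact: L1D|exact: L1D].
by rewrite !RintegralD// e1 e2 e3 e4; ring.
Qed.

Lemma L12_cos al q : L12 al -> L12 (fun u => al u * cos (q * u)).
Proof. by move=> La; apply: L12M => // [|x]; [mfun|exact: cos_max]. Qed.

Lemma L12_sin al q : L12 al -> L12 (fun u => al u * sin (q * u)).
Proof. by move=> La; apply: L12M => // [|x]; [mfun|exact: sin_max]. Qed.

Lemma L12_opp al : L12 al -> L12 (fun u => al (- u)).
Proof. by case=> L L2; split; [exact: L1_opp|exact: (L1_opp L2)]. Qed.

Definition fcos al q := \int[mu]_u (al u * cos (q * u)).
Definition fsin al q := \int[mu]_u (al u * sin (q * u)).

Lemma fcosE al q : L1 al -> fcos al q = 2^-1 * (hartley al q + hartley al (- q)).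
Proof.
move=> La; have L1' := L1_cas q La; have L2' := L1_cas (- q) La.
rewrite -RintegralD// -RintegralZl//; last exact: L1D.
by apply: eq_Rintegral => u _; rewrite /cas mulNr cosN sinN; field.
Qed.

Lemma fsinE al q : L1 al -> fsin al q = 2^-1 * (hartley al q - hartley al (- q)).
Proof.
move=> La; have L1' := L1_cas q La; have L2' := L1_cas (- q) La.
rewrite -RintegralB// -RintegralZl//; last exact: L1B.
by apply: eq_Rintegral => u _; rewrite /cas mulNr cosN sinN; field.
Qed.

Let measurable_hartleyN al : L1 al -> measurable_fun setT (fun q : R => hartley al (- q)).
Proof. by move=> La; have mh := measurable_hartley La; mfun. Qed.

Lemma measurable_fcos al : L1 al -> measurable_fun setT (fcos al).
Proof.
move=> La; rewrite (_ : fcos al = (fun q => 2^-1 * (hartley al q + hartley al (- q)))); last first.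
  by apply/funext => q; rewrite fcosE.
by have mh := measurable_hartley La; have mh' := measurable_hartleyN La; mfun.
Qed.

Lemma measurable_fsin al : L1 al -> measurable_fun setT (fsin al).
Proof.
move=> La; rewrite (_ : fsin al = (fun q => 2^-1 * (hartley al q - hartley al (- q)))); last first.
  by apply/funext => q; rewrite fsinE.
by have mh := measurable_hartley La; have mh' := measurable_hartleyN La; mfun.
Qed.

(* The autocorrelation of a at lag 2x; its Hartley transform is the
   power spectrum, so that boundedness of the former gives integrability of the latter. *)
Let autocor a x := \int[mu]_s (a (x + s) * a (- (x - s))).

Let hartley_autocor a xi : L12 a -> L1 (autocor a) /\
  hartley (autocor a) xi = 2^-1 * (fcos a (xi / 2) ^+ 2 + fsin a (xi / 2) ^+ 2).
Proof.
move=> La; have Lb := L12_opp La; pose q := xi / 2.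
split; first by have [] := Rint_shear La Lb.
have Lbs : L12 (fun u => a (- u) * - sin (q * u)).
  apply: L12M => // [|x]; first by mfun.
  by rewrite normrN sin_max.
have [LF LI IF] := Rint_shear4 (L12_cos q La) (L12_sin q La) (L12_sin q La) (L12_cos q La)
  (L12_cos q Lb) Lbs (L12_cos q Lb) (L12_sin q Lb).
have Ec : \int[mu]_x (a (- x) * cos (q * x)) = fcos a q.
  rewrite /fcos -(Rint_opp (L12_cos q La).1); apply: eq_Rintegral => x _.
  by rewrite mulrN cosN.
have Es : \int[mu]_x (a (- x) * sin (q * x)) = - fsin a q.
  rewrite /fsin -(Rint_opp (L12_sin q La).1) -mulN1r -RintegralZl//; last exact: (L1_opp (L12_sin q La).1).
  by apply: eq_Rintegral => x _; rewrite mulrN sinN; ring.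
have Es' : \int[mu]_x (a (- x) * - sin (q * x)) = fsin a q.
  rewrite /fsin -(Rint_opp (L12_sin q La).1).
  by apply: eq_Rintegral => x _; rewrite [q * - x]mulrN sinN.
transitivity (\int[mu]_x \int[mu]_s ((a (x + s) * cos (q * (x + s))) * (a (- (x - s)) * cos (q * (x - s))) +
   (a (x + s) * sin (q * (x + s))) * (a (- (x - s)) * - sin (q * (x - s))) +
   ((a (x + s) * sin (q * (x + s))) * (a (- (x - s)) * cos (q * (x - s))) +
   (a (x + s) * cos (q * (x + s))) * (a (- (x - s)) * sin (q * (x - s)))))).
  apply: eq_Rintegral => x _; rewrite /autocor -RintegralZr//; last exact: (L1_shear1 x La Lb).
  apply: eq_Rintegral => s _.
  have -> : xi * x = q * (x + s) + q * (x - s) by rewrite /q; field.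
  by rewrite /cas cosD sinD; ring.
by rewrite IF Ec Es Es' -/(fcos a q) -/(fsin a q); congr (_ * _); ring.
Qed.

(** Against exp(- e |xi|) the power spectrum integrates to a Poisson integral of the
    autocorrelation, bounded independently of e because the Poisson kernel has mass 2 pi. Monotone
    convergence lets e tend to 0. *)
Lemma bessel a : L12 a -> L1 (fun q => fcos a q ^+ 2 + fsin a q ^+ 2).
Proof.
move=> La; have ma := L12_measurable La; have Lb := L12_opp La.
have mb : measurable_fun setT (fun u : R => a (- u)) by mfun.
pose S q := fcos a q ^+ 2 + fsin a q ^+ 2.
have S0 q : 0 <= S q by rewrite addr_ge0// sqr_ge0.
have mS : measurable_fun setT S.
  have h1 := measurable_fcos La.1; have h2 := measurable_fsin La.1; rewrite /S; mfun.
have Lr : L1 (autocor a) by have [] := hartley_autocor 0 La.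
have HR xi : hartley (autocor a) xi = 2^-1 * S (xi / 2) by have [] := hartley_autocor xi La.
pose I2 := \int[mu]_x (a x ^+ 2).
have bR x : `|autocor a x| <= 2 * I2.
  have m1 : measurable_fun setT (cst 1 : R -> R) by mfun.
  have := @Rint_shear_le R a (fun u => a (- u)) (cst 1) x 1 ma mb m1 _ La.2 Lb.2 ltr01.
  rewrite /= normr1 => /(_ (fun=> lexx _)); rewrite (Rint_opp La.2) invr1 !mul1r => h.
  have -> : 2 * I2 = I2 + I2 by ring.
  apply: le_trans h; rewrite le_eqVlt; apply/orP; left; apply/eqP; congr (`| _ |).
  by apply: eq_Rintegral => s _; rewrite mulr1.
have [Lc Ic] := @L1_cauchy R.
have IK e : 0 < e -> L1 (fun s : R => 2 * e / (e ^+ 2 + s ^+ 2)) /\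
    \int[mu]_s (2 * e / (e ^+ 2 + s ^+ 2)) = 2 * pi.
  move=> e0; have ei : 0 < e^-1 by rewrite invr_gt0.
  have E s : 2 * e / (e ^+ 2 + s ^+ 2) = 2 / e * (1 + (e^-1 * s + 0) ^+ 2)^-1.
    have e1 : e != 0 by rewrite gt_eqF.
    have e2 : e ^+ 2 + s ^+ 2 != 0 by rewrite gt_eqF// ltr_wpDr ?sqr_ge0// exprn_gt0.
    have e3 : 1 + (e^-1 * s + 0) ^+ 2 != 0 by rewrite gt_eqF// ltr_wpDr ?sqr_ge0.
    apply: (mulIf e3); rewrite mulfVK//; apply: (mulIf e2).
    by rewrite mulrAC mulfVK//; field.
  split.
    have := L1Z (2 / e) (L1_affine 0 ei Lc); congr (integrable _ _ _).
    by apply/funext => s /=; rewrite E.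
  under eq_Rintegral do rewrite E.
  rewrite RintegralZl//; last exact: (L1_affine 0 ei Lc).
  by rewrite (Rint_affine 0 ei Lc) Ic invrK; field; rewrite gt_eqF.
pose T xi := 2^-1 * S (xi / 2).
have T0 xi : 0 <= T xi by rewrite mulr_ge0.
have mT : measurable_fun setT T by rewrite /T; mfun.
have bT e : 0 < e -> L1 (fun xi => T xi * expR (- (e * `|xi|))) /\
    \int[mu]_xi (T xi * expR (- (e * `|xi|))) <= 2 * I2 * (2 * pi).
  move=> e0; have LE := L1_exp e0; have [LK IK'] := IK e e0; split.
    apply: (L1M mT _ LE (C := 2 * \int[mu]_s `|autocor a s|)) => xi.
    by rewrite -[T xi]HR; exact: hartley_le.
  have := @hartley_mult R _ _ 0 Lr LE (fun p => ltac:(by rewrite /= normrN)).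
  under eq_Rintegral do rewrite HR mulr0 cas0 mulr1.
  move=> ->; rewrite -IK' -RintegralZl//.
  rewrite (le_trans (ler_norm _))//; apply: Rint_norm_le.
  - have := L1M (L1_measurable Lr) bR LK; congr (integrable _ _ _).
    by apply/funext => s /=; rewrite hartley_exp// subr0.
  - exact: L1Z.
  - move=> s; rewrite hartley_exp// subr0 normrM ler_pM//.
    by rewrite ger0_norm// divr_ge0 ?addr_ge0 ?sqr_ge0// mulr_ge0// ltW.
have LT : L1 T.
  apply: L1P => //.
  pose f_ n xi := (T xi * expR (- (n.+1%:R^-1 * `|xi|)))%:E.
  have e0 n : 0 < n.+1%:R^-1 :> R by rewrite invr_gt0.
  have mf n : measurable_fun setT (f_ n) by apply/measurable_EFinP; mfun.
  have f0 n xi : setT xi -> (0 <= f_ n xi)%E by move=> _; rewrite lee_fin mulr_ge0 ?expR_ge0.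
  have nd xi : setT xi -> nondecreasing_seq (f_ ^~ xi).
    move=> _ n m nm; rewrite lee_fin ler_wpM2l// ler_expR lerN2 ler_wpM2r//.
    by rewrite lef_pV2 ?posrE// ler_nat.
  have := @cvg_monotone_convergence _ _ _ mu setT measurableT f_ mf f0 nd.
  have lf xi : limn (f_ ^~ xi) = `|T xi|%:E.
    rewrite ger0_norm//; apply/cvg_lim => //; apply: cvg_EFin; first exact: nearW.
    have c : expR (- (n.+1%:R^-1 * `|xi|)) @[n --> \oo] --> expR (- (0 * `|xi|)).
      apply: continuous_cvg; first exact: continuous_expR.
      by apply: cvgN; apply: cvgM; [exact: cvg_harmonic|exact: cvg_cst].
    rewrite mul0r oppr0 expR0 in c.
    by rewrite /f_ /= -[X in _ --> X]mulr1; apply: cvgM; [exact: cvg_cst|exact: c].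
  under [X in _ --> X]eq_integral do rewrite lf.
  move=> cv; apply: (@le_lt_trans _ _ (2 * I2 * (2 * pi))%:E); last exact: ltry.
  rewrite -(cvg_lim _ cv)//; apply: lime_le; first by apply/cvg_ex; eexists; exact: cv.
  apply: nearW => n; have [Ln In] := bT _ (e0 n).
  by rewrite -(fineK (integrable_fin_num measurableT Ln)) lee_fin.
have := L1Z 2 (L1_affine 0 (ltr0n _ 2) LT); congr (integrable _ _ _).
by apply/funext => q /=; rewrite /T /S addr0 mulrAC divff ?mul1r//; congr EFin; field.
Qed.

End shear.

(** * Constant sign and null sets *)

Section sign.
Context {R : realType}.
Local Notation mu := (@lebesgue_measure R).

Lemma continuous_neq0_sign (f : R -> R) : continuous f -> (forall x, f x != 0) ->
  (forall x, 0 <= f x) \/ (forall x, f x <= 0).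
Proof.
move=> cf f0.
have [H|/existsNP[y /negP fy]] := pselect (forall x, 0 <= f x); [by left|right => x].
rewrite -ltNge in fy; rewrite leNgt; apply/negP => fx.
have cw u v : {within `[u, v], continuous f} by exact: continuous_subspaceT.
have [xy|yx] := leP x y.
  have [|c _ fc] := @IVT _ f x y 0 xy (cw _ _).
    by rewrite ge_min le_max (ltW fx) (ltW fy) orbT.
  by have := f0 c; rewrite fc eqxx.
have [|c _ fc] := @IVT _ f y x 0 (ltW yx) (cw _ _).
  by rewrite ge_min le_max (ltW fx) (ltW fy) orbT.
by have := f0 c; rewrite fc eqxx.
Qed.

Lemma lebesgue_ae_exists (P : R -> Prop) (M : R) : {ae mu, forall x, P x} ->
  exists2 x, M < x & P x.
Proof.
move=> [N [mN N0 PN]].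
have [//|H] := pselect (exists2 x, M < x & P x).
have sub : `]M, (M + 1)[%classic `<=` N.
  move=> x /=; rewrite in_itv/= => /andP[Mx _]; apply: PN => /= Px.
  by apply: H; exists x.
have h : (lebesgue_measure (`]M, (M + 1)%R[%classic : set R) <= lebesgue_measure N)%E.
  by apply: le_measure => //; rewrite inE.
by move: h; rewrite N0 lebesgue_measure_itv/= lte_fin ltrDl ltr01 -EFinB lee_fin; lra.
Qed.

Lemma Rint_eq0_ae (f : R -> R) : L1 f -> (forall x, 0 <= f x) ->
  \int[mu]_x f x = 0 -> {ae mu, forall x, f x = 0}.
Proof.
move=> Lf f0 If.
have mf : measurable_fun setT (fun x => (f x)%:E) by apply/measurable_EFinP; exact: L1_measurable.
have [H _] := @ae_eq_integral_abs _ _ R mu setT measurableT (fun x => (f x)%:E) mf.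
have : ae_eq mu setT (fun x => (f x)%:E) (cst 0%E).
  apply: H; under eq_integral do rewrite gee0_abs ?lee_fin//.
  by rewrite -[LHS](fineK (integrable_fin_num measurableT Lf)); exact: (congr1 EFin If).
by apply: lebesgue_aeS => x /= /(_ I) [].
Qed.

Lemma Rint_sign (f : R -> R) : L1 f -> (forall x, 0 <= f x) \/ (forall x, f x <= 0) ->
  \int[mu]_x `|f x| = `|\int[mu]_x f x|.
Proof.
move=> Lf [f0|f0].
  rewrite ger0_norm; last exact: Rintegral_ge0.
  by apply: eq_Rintegral => x _; rewrite ger0_norm.
have -> : \int[mu]_x f x = - \int[mu]_x (`|f x|).
  rewrite -mulN1r -RintegralZl//; last exact: L1_abs.
  by apply: eq_Rintegral => x _; rewrite ler0_norm// mulN1r opprK.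
by rewrite normrN ger0_norm//; exact: Rintegral_ge0.
Qed.

(** In either pair of coordinates, vanishing almost everywhere amounts to a zero iterated integral,
    and the two integrals differ by the Jacobian. *)
Lemma ge0_ae_midpoint (H : R * R -> R) : measurable_fun setT H -> (forall z, 0 <= H z) ->
  {ae mu, forall x, {ae mu, forall s, H (x + s, x - s) = 0}} ->
  {ae mu, forall u, {ae mu, forall v, H (u, v) = 0}}.
Proof.
move=> mH H0 aeH.
have mE : measurable_fun setT (fun z => (H z)%:E) by exact/measurable_EFinP.
have E0 z : (0 <= (H z)%:E)%E by rewrite lee_fin.
have mH2 : measurable_fun setT (fun z : R * R => (H (z.1 + z.2, z.1 - z.2))%:E).
  by apply: (measurableT_comp mE); apply: measurable_fun_pair; mfun.
have aux (h : R -> R) : measurable_fun setT h -> (forall x, 0 <= h x) ->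
    (\int[mu]_x (h x)%:E = 0)%E <-> {ae mu, forall x, h x = 0}.
  move=> mh h0; have mh' : measurable_fun setT (fun x => (h x)%:E) by exact/measurable_EFinP.
  have [K1 K2] := @ae_eq_integral_abs _ _ R mu setT measurableT _ mh'.
  have E : (\int[mu]_x `|(h x)%:E| = \int[mu]_x (h x)%:E)%E.
    by apply: eq_integral => x _; rewrite gee0_abs ?lee_fin.
  rewrite E in K1 K2; split => [/K1|K].
    by apply: lebesgue_aeS => x /= /(_ I) [].
  by apply: K2; move: K; apply: lebesgue_aeS => x -> _.
have := ge0_integral_midpoint mE E0.
have -> : (\int[mu]_x \int[mu]_s (H (x + s, x - s)%R)%:E = 0)%E.
  have mF := measurable_fun_fubini_tonelli_F (m2 := mu) _ mH2 (fun z => E0 _).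
  have [_ K] := @ae_eq_integral_abs _ _ R mu setT measurableT _ mF.
  have <- : (\int[mu]_x `|fubini_F mu (fun z : R * R => (H (z.1 + z.2, z.1 - z.2)%R)%:E) x| =
     \int[mu]_x \int[mu]_s (H (x + s, x - s)%R)%:E)%E.
    by apply: eq_integral => x _; rewrite gee0_abs//; exact: integral_ge0.
  apply: K; move: aeH; apply: lebesgue_aeS => x /= Hx _; rewrite /fubini_F/=.
  have mHx : measurable_fun setT (fun s : R => H (x + s, x - s)).
    apply: (measurableT_comp mH).
    by apply: (measurable_fun_pair (f := fun s : R => x + s) (g := fun s : R => x - s)); mfun.
  exact: ((aux _ mHx (fun s => H0 _)).2 Hx).
rewrite mule0 => I0.
have mF := measurable_fun_fubini_tonelli_F (m2 := mu) _ mE E0.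
have [K _] := @ae_eq_integral_abs _ _ R mu setT measurableT _ mF.
have : ae_eq mu setT (fubini_F mu (fun z => (H z)%:E)) (cst 0%E).
  apply: K; rewrite -[RHS]I0; apply: eq_integral => u _; rewrite gee0_abs//.
  exact: integral_ge0.
apply: lebesgue_aeS => u /= /(_ I); rewrite /fubini_F => Iu.
have mHu : measurable_fun setT (fun v : R => H (u, v)).
  exact: (measurableT_comp mH (pair1_measurable u)).
exact: ((aux _ mHu (fun v => H0 _)).1 Iu).
Qed.

End sign.

(** * The Wigner function of a pair of real functions *)

Section wigner_real.
Context {R : realType}.
Local Notation mu := (@lebesgue_measure R).

(* With f = a + i b: the real part plus the imaginary part of f(u) conj(f(v)). *)
Definition hcross (a b : R -> R) u v := a u * a v + b u * b v + (b u * a v - a u * b v).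
Definition sqn (a b : R -> R) u := a u ^+ 2 + b u ^+ 2.
(* The Wigner function of a + i b, up to a factor and a scaling of p: see Wigner_eq0. *)
Definition rwigner (a b : R -> R) x p := \int[mu]_s
  ((a (x + s) * a (x - s) + b (x + s) * b (x - s)) * cos (p * s) +
   (b (x + s) * a (x - s) - a (x + s) * b (x - s)) * sin (p * s)).

Lemma hcross_le a b u v : `|hcross a b u v| <= sqn a b u + sqn a b v.
Proof.
rewrite /hcross /sqn; move: (a u) (b u) (a v) (b v) => x y z w.
have h1 := sqr_ge0 (x - (z - w) / 2); have h2 := sqr_ge0 (y - (z + w) / 2).
have h3 := sqr_ge0 (x + (z - w) / 2); have h4 := sqr_ge0 (y + (z + w) / 2).
have h5 := sqr_ge0 z; have h6 := sqr_ge0 w.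
by rewrite ler_norml; apply/andP; split; nra.
Qed.

Lemma sqn_ge0 a b u : 0 <= sqn a b u.
Proof. by rewrite addr_ge0// sqr_ge0. Qed.

(** For z = f(u) conj(f(v)) the two cross terms are Re z + Im z and Re z - Im z; half the sum of
    their squares is |z|^2. *)
Lemma sqrt_sqn_le a b u v k : `|hcross a b u v| <= 4 * k -> `|hcross a b v u| <= 4 * k ->
  Num.sqrt (sqn a b u) * Num.sqrt (sqn a b v) <= 4 * k.
Proof.
move=> h1 h2; have k0 : 0 <= 4 * k by rewrite (le_trans _ h1).
rewrite -sqrtrM ?sqn_ge0// -[X in _ <= X](ger0_norm k0) -sqrtr_sqr; apply: ler_wsqrtr.
have e : sqn a b u * sqn a b v = 2^-1 * (hcross a b u v ^+ 2 + hcross a b v u ^+ 2).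
  by rewrite /sqn /hcross; field.
have s1 : hcross a b u v ^+ 2 <= (4 * k) ^+ 2 by rewrite -real_normK ?num_real// ler_sqr ?nnegrE.
have s2 : hcross a b v u ^+ 2 <= (4 * k) ^+ 2 by rewrite -real_normK ?num_real// ler_sqr ?nnegrE.
by rewrite e; lra.
Qed.

Variables a b : R -> R.
Hypotheses (ma : measurable_fun setT a) (mb : measurable_fun setT b).
Hypothesis LB : L1 (sqn a b).

Let La2 : L1 (fun x => a x ^+ 2).
Proof.
by apply: (L1_le _ _ LB) => [|x]; [mfun|rewrite ger0_norm ?sqr_ge0// lerDl sqr_ge0].
Qed.

Let Lb2 : L1 (fun x => b x ^+ 2).
Proof.
by apply: (L1_le _ _ LB) => [|x]; [mfun|rewrite ger0_norm ?sqr_ge0// lerDr sqr_ge0].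
Qed.

Let LBx x : L1 (fun s => sqn a b (x + s)).
Proof.
have := L1_affine x ltr01 LB; congr (integrable _ _ _).
by apply/funext => s /=; rewrite mul1r addrC.
Qed.

Let LBx' x : L1 (fun s => sqn a b (x - s)).
Proof. exact: (L1_opp (LBx x)). Qed.

Let mhcross (x : R) : measurable_fun setT (fun s : R => hcross a b (x + s) (x - s)).
Proof. by rewrite /hcross; mfun. Qed.

Let L1_hcross x : L1 (fun s => hcross a b (x + s) (x - s)).
Proof. by apply: (L1_le (mhcross x) _ (L1D (LBx x) (LBx' x))) => s; exact: hcross_le. Qed.

Lemma L1_rwigner_integrand x p : L1 (fun s =>
  (a (x + s) * a (x - s) + b (x + s) * b (x - s)) * cos (p * s) +
   (b (x + s) * a (x - s) - a (x + s) * b (x - s)) * sin (p * s)).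
Proof.
have mc : measurable_fun setT (fun s : R => cos (p * s)) by mfun.
have ms : measurable_fun setT (fun s : R => sin (p * s)) by mfun.
have c1 s := cos_max (p * s); have s1 s := sin_max (p * s).
have h1 := L1_shear x ma ma mc c1 La2 La2; have h2 := L1_shear x mb mb mc c1 Lb2 Lb2.
have h3 := L1_shear x mb ma ms s1 Lb2 La2; have h4 := L1_shear x ma mb ms s1 La2 Lb2.
have := L1D (L1D h1 h2) (L1B h3 h4); congr (integrable _ _ _).
by apply/funext => s /=; rewrite mulrDl mulrBl.
Qed.

Lemma L1_rwigner_integrand_im x p : L1 (fun s =>
  (b (x + s) * a (x - s) - a (x + s) * b (x - s)) * cos (p * s) -
  (a (x + s) * a (x - s) + b (x + s) * b (x - s)) * sin (p * s)).
Proof.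
have mc : measurable_fun setT (fun s : R => cos (p * s)) by mfun.
have ms : measurable_fun setT (fun s : R => sin (p * s)) by mfun.
have c1 s := cos_max (p * s); have s1 s := sin_max (p * s).
have h1 := L1_shear x ma ma ms s1 La2 La2; have h2 := L1_shear x mb mb ms s1 Lb2 Lb2.
have h3 := L1_shear x mb ma mc c1 Lb2 La2; have h4 := L1_shear x ma mb mc c1 La2 Lb2.
have := L1B (L1B h3 h4) (L1D h1 h2); congr (integrable _ _ _).
by apply/funext => s /=; rewrite [in RHS]mulrBl [in RHS]mulrDl.
Qed.

(** In s, the real part of f(x+s) conj(f(x-s)) is even and the imaginary part odd. The extra terms
    produced by [cas], real part times sine and imaginary part times cosine, are therefore odd. *)
Lemma rwigner_hartley x p :
  rwigner a b x p = hartley (fun s => hcross a b (x + s) (x - s)) p.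
Proof.
have LW := L1_rwigner_integrand x p.
apply/eqP; rewrite -subr_eq0 /rwigner /hartley -RintegralB//; last exact: (L1_cas p (L1_hcross x)).
apply/eqP; apply: Rint_odd; first exact: (L1B LW (L1_cas p (L1_hcross x))).
by move=> s; rewrite /cas !mulrN cosN sinN opprK /hcross; ring.
Qed.

Lemma continuous_rwigner_p x : continuous (rwigner a b x).
Proof.
rewrite (_ : rwigner a b x = hartley (fun s => hcross a b (x + s) (x - s))).
  exact: continuous_hartley.
by apply/funext => p; exact: rwigner_hartley.
Qed.

Lemma continuous_rwigner_x p : continuous (fun x => rwigner a b x p).
Proof.
have cc : continuous (fun s : R => cos (p * s)).
  move=> s; apply: (@continuous_comp _ _ _ (fun x => p * x) cos); last exact: continuous_cos.
  exact: mulrl_continuous.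
have cs : continuous (fun s : R => sin (p * s)).
  move=> s; apply: (@continuous_comp _ _ _ (fun x => p * x) sin); last exact: continuous_sin.
  exact: mulrl_continuous.
have mc : measurable_fun setT (fun s : R => cos (p * s)) by mfun.
have ms : measurable_fun setT (fun s : R => sin (p * s)) by mfun.
have c1 s := cos_max (p * s); have s1 s := sin_max (p * s).
have h1 x := L1_shear x ma ma mc c1 La2 La2; have h2 x := L1_shear x mb mb mc c1 Lb2 Lb2.
have h3 x := L1_shear x mb ma ms s1 Lb2 La2; have h4 x := L1_shear x ma mb ms s1 La2 Lb2.
have -> : (fun x => rwigner a b x p) = (fun x =>
  (\int[mu]_s (a (x + s) * a (x - s) * cos (p * s)) + \int[mu]_s (b (x + s) * b (x - s) * cos (p * s))) +
  (\int[mu]_s (b (x + s) * a (x - s) * sin (p * s)) - \int[mu]_s (a (x + s) * b (x - s) * sin (p * s)))).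
  apply/funext => x; rewrite -RintegralD// -RintegralB// -RintegralD//; [|exact: (L1D (h1 x) (h2 x))|exact: (L1B (h3 x) (h4 x))].
  by apply: eq_Rintegral => s _; rewrite mulrDl mulrBl.
move=> x; apply: cvgD; [apply: cvgD|apply: cvgB].
- exact: (continuous_shear ma ma cc c1 La2 La2).
- exact: (continuous_shear mb mb cc c1 Lb2 Lb2).
- exact: (continuous_shear mb ma cs s1 Lb2 La2).
- exact: (continuous_shear ma mb cs s1 La2 Lb2).
Qed.

Lemma rwigner_le x p : `|rwigner a b x p| <= 4 * \int[mu]_x sqn a b x.
Proof.
rewrite rwigner_hartley (le_trans (hartley_le _ (L1_hcross x)))//.
rewrite (_ : 4 = 2 * 2) -?mulrA ?ler_pM2l//; last by ring.
apply: (@le_trans _ _ (\int[mu]_s (sqn a b (x + s) + sqn a b (x - s)))).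
  by apply: Rint_le; [exact: L1_abs|exact: L1D|move=> s; exact: hcross_le].
rewrite RintegralD// mulr_natl mulr2n.
have I1 : \int[mu]_s sqn a b (x + s) = \int[mu]_s sqn a b s.
  have := Rint_affine x ltr01 LB; rewrite invr1 mul1r => <-.
  by apply: eq_Rintegral => s _; rewrite mul1r addrC.
by rewrite I1 (Rint_opp (LBx x)) I1.
Qed.

Variable M : R.
Hypothesis nodal : forall x p, rwigner a b x p = 0 -> `|x| <= M /\ `|p| <= M.

Let rwigner_neq0 x p : M < `|x| \/ M < `|p| -> rwigner a b x p != 0.
Proof.
by move=> H; apply/eqP => /nodal[h1 h2]; case: H => H; [move: h1|move: h2]; rewrite leNgt H.
Qed.

Lemma rwigner_sign_p x : M < `|x| ->
  (forall p, 0 <= rwigner a b x p) \/ (forall p, rwigner a b x p <= 0).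
Proof.
move=> xM; apply: continuous_neq0_sign; first exact: continuous_rwigner_p.
by move=> p; apply: rwigner_neq0; left.
Qed.

Lemma rwigner_sign_x p : M < `|p| ->
  (forall x, 0 <= rwigner a b x p) \/ (forall x, rwigner a b x p <= 0).
Proof.
move=> pM; apply: continuous_neq0_sign; first exact: continuous_rwigner_x.
by move=> x; apply: rwigner_neq0; right.
Qed.

Let A u := Num.sqrt (sqn a b u).

Let mA : measurable_fun setT A.
Proof.
have mB := L1_measurable LB.
apply: (measurableT_comp (continuous_measurable_fun (@sqrt_continuous R)) mB).
Qed.

Let AB u : sqn a b u = A u ^+ 2.
Proof. by rewrite sqr_sqrtr// sqn_ge0. Qed.

Lemma sqn_midpoint : {ae mu, forall u, {ae mu, forall v, M * 2 < `|u + v| ->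
  A u * A v <= 4 * sqn a b ((u + v) / 2)}}.
Proof.
(* [H] is the excess in the desired inequality, cut off to |u + v| > 2M, that is, to midpoints |x| >
   M; it vanishes exactly where the claim holds. *)
pose H (z : R * R) : R := Num.max 0 (A z.1 * A z.2 - 4 * sqn a b ((z.1 + z.2) / 2)) *
  \1_(`]M * 2, +oo[%classic) `|z.1 + z.2|.
have mB := L1_measurable LB.
have mI : measurable_fun setT (\1_(`]M * 2, +oo[%classic) : R -> R).
  by apply: measurable_indic; exact: measurable_itv.
have mH : measurable_fun setT H.
  apply: measurable_funM; last by mfun.
  by apply: measurable_maxr; mfun.
have H0 z : 0 <= H z by rewrite mulr_ge0// ?le_max ?lexx// indicE.
have : {ae mu, forall x, {ae mu, forall s, H (x + s, x - s) = 0}}.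
  have : {ae mu, forall x, lebesgue_pt (sqn a b) x}.
    by apply: lebesgue_differentiation; apply: open_integrable_locally => //; exact: openT.
  apply: lebesgue_aeS => x xpt.
  have E s : (x + s + (x - s)) / 2 = x by field.
  have E2 s : `|x + s + (x - s)| = `|x| * 2.
    by rewrite (_ : x + s + (x - s) = x * 2) ?normrM ?(ger0_norm (_ : 0 <= 2))//; ring.
  have [xM|xM] := leP `|x| M.
    apply: aeW => s; rewrite /H /= E2 indicE memNset ?mulr0//= in_itv/= andbT.
    by apply/negP; rewrite -leNgt ler_pM2r.
  have sg : (forall p, 0 <= hartley (fun s => hcross a b (x + s) (x - s)) p) \/
      (forall p, hartley (fun s => hcross a b (x + s) (x - s)) p <= 0).
    by case: (rwigner_sign_p xM) => h; [left|right] => p; rewrite -rwigner_hartley.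
  have := hartley_sign_bound (L1_hcross x) LB sg (fun s => hcross_le _ _ _ _) xpt.
  (* Both s and -s are needed, for the cross terms at (u, v) and at (v, u). *)
  move=> h; have h' := lebesgue_ae_opp h; move: h h'; apply: lebesgue_aeS2 => s h1 h2.
  rewrite /H /= E max_l ?mul0r// subr_le0; apply: sqrt_sqn_le => //.
  by move: h2; rewrite opprK.
move/(ge0_ae_midpoint mH H0); apply: lebesgue_aeS => u; apply: lebesgue_aeS => v.
rewrite /H /= => + uv; rewrite indicE mem_set/= ?in_itv/= ?uv// mulr1 => h.
have : A u * A v - 4 * sqn a b ((u + v) / 2) <= 0 by rewrite -h le_max lexx orbT.
by rewrite subr_le0.
Qed.

Lemma sqrt_sqn_neq0 : ~ {ae mu, forall x, A x = 0}.
Proof.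
move=> A0.
pose x0 := `|M| + 1.
have xM : M < `|x0|.
  rewrite /x0 ger0_norm ?addr_ge0//; have := ler_norm M; lra.
have /eqP := rwigner_neq0 (x := x0) (p := 0) (or_introl xM); apply.
rewrite rwigner_hartley.
have B0 u : A u = 0 -> a u = 0 /\ b u = 0.
  move=> Au; have := AB u; rewrite Au expr0n/= /sqn => h.
  have := sqr_ge0 (a u); have := sqr_ge0 (b u) => h1 h2.
  have /eqP : a u ^+ 2 = 0 by lra.
  have /eqP : b u ^+ 2 = 0 by lra.
  by rewrite !sqrf_eq0 => /eqP ? /eqP ?.
rewrite /hartley; transitivity (\int[mu]_s (cst 0 s : R)); last by rewrite Rintegral_cst// mul0r.
apply: Rint_ae_eq; [exact: L1_cas|exact: measurable_cst|].
have := lebesgue_ae_affine x0 ltr01 A0; apply: lebesgue_aeS => s.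
by rewrite mul1r addrC => /B0[a0 b0]; rewrite /hcross a0 b0 !mul0r subrr !addr0 mul0r.
Qed.

Lemma sqn_exp : exists2 k, 0 < k & L1 (fun x => sqn a b x * expR (k * `|x|)).
Proof.
apply: (@midpoint_decay _ A (sqn a b) 4 (M * 2)) => //.
- by move=> x; exact: sqrtr_ge0.
- exact: sqn_midpoint.
- exact: sqrt_sqn_neq0.
Qed.

End wigner_real.

(** * The Wigner function on the Fourier side *)

Section wigner_fourier.
Context {R : realType}.
Local Notation mu := (@lebesgue_measure R).
Variables a b : R -> R.

(* Real and imaginary parts of int (a + i b)(u) e^{-iqu} du. *)
Definition fourier_re q := fcos a q + fsin b q.
Definition fourier_im q := fcos b q - fsin a q.

Section marginal.
Hypotheses (La : L12 a) (Lb : L12 b).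
Let ma := L12_measurable La.
Let mb := L12_measurable Lb.

Let LB : L1 (sqn a b).
Proof. exact: (L1D La.2 Lb.2). Qed.

(** The phase splits as p s + xi x = q1 (x + s) - q2 (x - s), so up to terms odd in s the double
    integral factors into transforms at [q1] and [q2]. *)
Let rwigner_cas p xi : L1 (fun x => rwigner a b x p * cas (xi * x)) /\
  \int[mu]_x (rwigner a b x p * cas (xi * x)) =
    2^-1 * hcross fourier_re fourier_im ((p - xi) / 2) ((p + xi) / 2).
Proof.
pose q1 := (p + xi) / 2; pose q2 := (p - xi) / 2.
(* [f1] and [f2] are the real and imaginary parts of f(u) exp(-iqu); [f3] is the negative of [f2],
   because [Rint_shear4] takes sums only. *)
pose f1 q u := a u * cos (q * u) + b u * sin (q * u).
pose f2 q u := b u * cos (q * u) - a u * sin (q * u).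
pose f3 q u := a u * sin (q * u) - b u * cos (q * u).
have L1' q : L12 (f1 q) by apply: L12D; [exact: L12_cos|exact: L12_sin].
have L2' q : L12 (f2 q) by apply: L12B; [exact: L12_cos|exact: L12_sin].
have L3' q : L12 (f3 q) by apply: L12B; [exact: L12_sin|exact: L12_cos].
have I1 q : \int[mu]_u f1 q u = fourier_re q.
  by rewrite RintegralD//; [exact: (L12_cos q La).1|exact: (L12_sin q Lb).1].
have I2 q : \int[mu]_u f2 q u = fourier_im q.
  by rewrite RintegralB//; [exact: (L12_cos q Lb).1|exact: (L12_sin q La).1].
have I3 q : \int[mu]_u f3 q u = - fourier_im q.
  rewrite RintegralB//; [|exact: (L12_sin q La).1|exact: (L12_cos q Lb).1].
  by rewrite -/(fsin a q) -/(fcos b q) /fourier_im opprB.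
pose F x s := f1 q1 (x + s) * f1 q2 (x - s) + f2 q1 (x + s) * f2 q2 (x - s) +
  (f3 q1 (x + s) * f1 q2 (x - s) + f1 q1 (x + s) * f2 q2 (x - s)).
have [LF LI IF] : [/\ forall x, L1 (F x), L1 (fun x => \int[mu]_s F x s) &
    \int[mu]_x \int[mu]_s F x s = _] :=
  Rint_shear4 (L1' q1) (L2' q1) (L3' q1) (L1' q1) (L1' q2) (L2' q2) (L1' q2) (L2' q2).
have E x : \int[mu]_s F x s = rwigner a b x p * cas (xi * x).
  pose C s := a (x + s) * a (x - s) + b (x + s) * b (x - s).
  pose S s := b (x + s) * a (x - s) - a (x + s) * b (x - s).
  have LW : L1 (fun s => C s * cos (p * s) + S s * sin (p * s)) by exact: (L1_rwigner_integrand ma mb LB x p).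
  have LW' : L1 (fun s => (C s * cos (p * s) + S s * sin (p * s)) * cas (xi * x)).
    have := L1Z (cas (xi * x)) LW; congr (integrable _ _ _).
    by apply/funext => s /=; rewrite mulrC.
  rewrite /rwigner -RintegralZr//.
  apply/eqP; rewrite -subr_eq0 -RintegralB//; apply/eqP.
  have FE s : F x s = C s * (cos (p * s) * cos (xi * x) - sin (p * s) * sin (xi * x)) +
      S s * (sin (p * s) * cos (xi * x) + cos (p * s) * sin (xi * x)) +
      (C s * (sin (p * s) * cos (xi * x) + cos (p * s) * sin (xi * x)) -
       S s * (cos (p * s) * cos (xi * x) - sin (p * s) * sin (xi * x))).
    have th : p * s + xi * x = q1 * (x + s) - q2 * (x - s) by rewrite /q1 /q2; field.
    by rewrite -cosD -sinD th cosB sinB /F /f1 /f2 /f3 /C /S; ring.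
  apply: Rint_odd; first exact: (L1B (LF x) LW').
  move=> s; rewrite !FE !mulrN cosN sinN /C /S /cas opprK; ring.
split.
  by move: LI; congr (integrable _ _ _); apply/funext => x /=; rewrite E.
under eq_Rintegral do rewrite -E.
by rewrite IF !I1 !I2 !I3 /hcross -/q1 -/q2; congr (_ * _); ring.
Qed.

Lemma L1_rwigner p : L1 (fun x => rwigner a b x p).
Proof.
have [L _] := rwigner_cas p 0; move: L; congr (integrable _ _ _).
by apply/funext => x /=; rewrite mul0r cas0 mulr1.
Qed.

(* The Wigner function of the Fourier transform is that of f, rotated by a right angle. *)
Lemma hartley_rwigner p xi : hartley (fun x => rwigner a b x p) xi =
  2^-1 * hcross fourier_re fourier_im ((p - xi) / 2) ((p + xi) / 2).
Proof. by have [_ <-] := rwigner_cas p xi. Qed.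

Lemma measurable_fourier_re : measurable_fun setT fourier_re.
Proof. by have h1 := measurable_fcos La.1; have h2 := measurable_fsin Lb.1; rewrite /fourier_re; mfun. Qed.

Lemma measurable_fourier_im : measurable_fun setT fourier_im.
Proof. by have h1 := measurable_fcos Lb.1; have h2 := measurable_fsin La.1; rewrite /fourier_im; mfun. Qed.

Lemma L1_sqn_fourier : L1 (sqn fourier_re fourier_im).
Proof.
have h1 := measurable_fourier_re; have h2 := measurable_fourier_im.
apply: (L1_le _ _ (L1Z 2 (L1D (bessel La) (bessel Lb)))) => [|q].
  by rewrite /sqn; mfun.
rewrite ger0_norm ?sqn_ge0// /sqn /fourier_re /fourier_im.
move: (fcos a q) (fsin a q) (fcos b q) (fsin b q) => x y z w.
by have := sqr_ge0 (x - w); have := sqr_ge0 (z + y); nra.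
Qed.

End marginal.

(** * Vertical, then horizontal segments *)

Section no_segment.
Hypotheses (ma : measurable_fun setT a) (mb : measurable_fun setT b).
Hypothesis LB : L1 (sqn a b).
Variable M : R.
Hypothesis nodal : forall x p, rwigner a b x p = 0 -> `|x| <= M /\ `|p| <= M.

Let expR_norm_tri (k c u v w : R) : 0 < k -> `|w| <= c * `|u| + `|v| ->
  expR (k * `|w|) <= expR (k * `|v|) * expR (k * c * `|u|).
Proof.
move=> k0 h; rewrite -expRD ler_expR.
have -> : k * `|v| + k * c * `|u| = k * (c * `|u| + `|v|) by ring.
by rewrite ler_pM2l.
Qed.

Lemma rwigner_no_vertical x0 p1 p2 : p1 < p2 ->
  ~ (forall p, p1 <= p <= p2 -> rwigner a b x0 p = 0).
Proof.
move=> p12 H; have [k k0 Lk] := sqn_exp ma mb LB nodal.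
pose h s := hcross a b (x0 + s) (x0 - s).
have mh : measurable_fun setT h by rewrite /h /hcross; mfun.
have Lk1 : L1 (fun s => sqn a b (x0 + s) * expR (k * `|x0 + s|)).
  have := L1_affine x0 ltr01 Lk; congr (integrable _ _ _).
  by apply/funext => s /=; rewrite mul1r addrC.
have Lk2 := L1_opp Lk1.
have Lh : L1 (fun s => h s * expR (k * `|s|)).
  (* Since |s| <= |x0| + |x0 + s| and |s| <= |x0| + |x0 - s|, each summand of [hcross_le] carries
     the weight at its own point. *)
  apply: (L1_le _ _ (L1Z (expR (k * `|x0|)) (L1D Lk1 Lk2))) => [|s]; first by mfun.
  rewrite normrM (ger0_norm (expR_ge0 _)).
  apply: (@le_trans _ _ ((sqn a b (x0 + s) + sqn a b (x0 - s)) * expR (k * `|s|))).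
    by rewrite ler_wpM2r ?expR_ge0// hcross_le.
  rewrite mulrDl mulrDr lerD//.
    rewrite mulrCA ler_wpM2l ?sqn_ge0//.
    have := @expR_norm_tri k 1 (x0 + s) x0 s k0; rewrite mul1r mulr1; apply.
    by have := ler_normB (x0 + s) x0; rewrite (_ : x0 + s - x0 = s)//; ring.
  rewrite mulrCA ler_wpM2l ?sqn_ge0//.
  have := @expR_norm_tri k 1 (x0 - s) x0 s k0; rewrite mul1r mulr1; apply.
  by have := ler_normB (x0 - s) x0; rewrite (_ : x0 - s - x0 = - s) ?normrN//; ring.
have H' p : p1 <= p <= p2 -> hartley h p = 0.
  by move=> pp; rewrite -(rwigner_hartley ma mb LB) H.
pose p := Num.max p1 (`|M| + 1).
have := hartley_zero_right mh k0 Lh p12 H' (_ : p1 <= p).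
rewrite le_max lexx => /(_ isT); rewrite -(rwigner_hartley ma mb LB) => /nodal[_].
apply/negP; rewrite -ltNge (lt_le_trans _ (ler_norm _))// lt_max; apply/orP; right.
by have := ler_norm M; lra.
Qed.

(** The integral of W(.,p) is half of |F(p/2)|^2, with F the Fourier transform of f. Where W(.,p)
    has constant sign this is its L1 norm, which bounds its transform at every point: the midpoint
    inequality for F needs neither tents nor Lebesgue points. Decay of F makes the transform of
    W(.,p0) decay, and inversion hands its zeros to [hartley_zero_right]. *)
Lemma rwigner_no_horizontal p0 x1 x2 : x1 < x2 ->
  ~ (forall x, x1 <= x <= x2 -> rwigner a b x p0 = 0).
Proof.
move=> x12 H; have [k k0 Lk] := sqn_exp ma mb LB nodal.
have L1ab (f : R -> R) : measurable_fun setT f -> (forall x, f x ^+ 2 <= sqn a b x) -> L12 f.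
  move=> mf fB; split; last first.
    apply: (L1_le _ _ LB) => [|x]; first by mfun.
    by rewrite ger0_norm ?sqr_ge0.
  apply: (L1_le mf _ (L1D Lk (L1_exp k0))) => x.
  have t0 := expR_gt0 (k * `|x|); rewrite expRN; set t := expR _ in t0 *.
  have := fB x; rewrite -real_normK ?num_real// => fx.
  have y0 := normr_ge0 (f x); set y := `|f x| in fx y0 *.
  have ti : 0 < t^-1 by rewrite invr_gt0.
  (* Here y = |f(x)| and t = exp(k |x|): either y <= 1/t, or y t > 1 and then y <= y^2 t. *)
  apply: (@le_trans _ _ (y ^+ 2 * t + t^-1)); last by rewrite lerD2r ler_wpM2r// ltW.
  have [yt|yt] := leP (y * t) 1.
    have /le_trans -> // : y <= t^-1 by rewrite -[t^-1]mul1r ler_pdivlMr.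
    by rewrite lerDr mulr_ge0 ?sqr_ge0 ?(ltW t0).
  rewrite -[leLHS]addr0 lerD ?(ltW ti)// expr2 -mulrA ler_peMr// ltW//.
have La : L12 a by apply: L1ab => // x; rewrite lerDl sqr_ge0.
have Lb : L12 b by apply: L1ab => // x; rewrite lerDr sqr_ge0.
pose B := sqn fourier_re fourier_im; pose A u := Num.sqrt (B u).
have LF : L1 B by exact: L1_sqn_fourier.
have AB u : B u = A u ^+ 2 by rewrite sqr_sqrtr// sqn_ge0.
have mA : measurable_fun setT A.
  apply: (measurableT_comp (continuous_measurable_fun (@sqrt_continuous R))).
  exact: L1_measurable.
have hW := hartley_rwigner La Lb; have LW := L1_rwigner La Lb.
have hcross_diag q : hcross fourier_re fourier_im q q = B q by rewrite /hcross /B /sqn; ring.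
have IW p : \int[mu]_x rwigner a b x p = 2^-1 * B (p / 2).
  have := hW p 0; rewrite subr0 addr0 hcross_diag => <-.
  by apply: eq_Rintegral => x _; rewrite mul0r cas0 mulr1.
(* Taken at p = u + v and xi = v - u. The estimate gives 2; 4 is the shape that [sqrt_sqn_le]
   expects. *)
have bd u v : M < `|u + v| -> `|hcross fourier_re fourier_im u v| <= 4 * B ((u + v) / 2).
  move=> uv; have sg := rwigner_sign_x ma mb LB nodal uv.
  have := hartley_le (v - u) (LW (u + v)).
  rewrite (Rint_sign (LW _) sg) IW hW.
  rewrite (_ : (u + v - (v - u)) / 2 = u); last by field.
  rewrite (_ : (u + v + (v - u)) / 2 = v); last by field.
  rewrite normrM (ger0_norm (_ : 0 <= 2^-1)) ?invr_ge0// (ger0_norm (_ : 0 <= 2^-1 * B _)).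
    by have := sqn_ge0 fourier_re fourier_im ((u + v) / 2); rewrite -/B; lra.
  by rewrite mulr_ge0 ?invr_ge0// sqn_ge0.
have [c c0 Lc] : exists2 c, 0 < c & L1 (fun x => B x * expR (c * `|x|)).
  apply: (@midpoint_decay _ A B 4 M) => //.
  - by move=> x; exact: sqrtr_ge0.
  - apply: aeW => u; apply: aeW => v uv; apply: sqrt_sqn_le; first exact: bd.
    by rewrite addrC; apply: bd; rewrite addrC.
  (* If F vanished almost everywhere, some W(.,2q) with 2q outside the nodal range would have
     constant sign and integral 0, hence zeros. *)
  - move=> A0; have [q Mq Aq] := lebesgue_ae_exists `|M| A0.
    have pM : M < `|2 * q|.
      rewrite ger0_norm; last by rewrite mulr_ge0// ltW// (le_lt_trans _ Mq).
      by have := ler_norm M; have := normr_ge0 M; lra.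
    have := IW (2 * q); rewrite (_ : 2 * q / 2 = q); last by field.
    rewrite AB Aq expr0n/= mulr0 => I0.
    have Ia := Rint_sign (LW (2 * q)) (rwigner_sign_x ma mb LB nodal pM).
    rewrite I0 normr0 in Ia.
    have := Rint_eq0_ae (L1_abs (LW (2 * q))) (fun x => normr_ge0 _) Ia.
    move=> /(lebesgue_ae_exists 0)[x _ /eqP]; rewrite normr_eq0 => /eqP /nodal[_].
    by rewrite leNgt pM.
pose kk x := rwigner a b x p0.
have Lkk : L1 kk by exact: LW.
have mh : measurable_fun setT (hartley kk) by exact: measurable_hartley.
(* The transform is evaluated at (p0 - xi) / 2 and (p0 + xi) / 2, which halves the rate in xi. *)
have c2 : 0 < c / 2 by rewrite divr_gt0.
have i2 : 0 < 2^-1 :> R by rewrite invr_gt0.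
have Lc1 := L1_affine (p0 / 2) i2 Lc; have Lc2 := L1_opp Lc1.
have Lh : L1 (fun xi => hartley kk xi * expR (c / 2 * `|xi|)).
  apply: (L1_le _ _ (L1Z (expR (c / 2 * `|p0|)) (L1D Lc1 Lc2))) => [|xi]; first by mfun.
  rewrite normrM (ger0_norm (expR_ge0 _)) hW.
  have -> : 2^-1 * xi + p0 / 2 = (p0 + xi) / 2 by field.
  have -> : 2^-1 * - xi + p0 / 2 = (p0 - xi) / 2 by field.
  set u := (p0 - xi) / 2; set v := (p0 + xi) / 2.
  apply: (@le_trans _ _ ((B v + B u) * expR (c / 2 * `|xi|))).
    rewrite ler_wpM2r ?expR_ge0// normrM (ger0_norm (_ : 0 <= 2^-1)) ?invr_ge0//.
    have := hcross_le fourier_re fourier_im u v; have := normr_ge0 (hcross fourier_re fourier_im u v); rewrite -/B; lra.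
  rewrite mulrDl mulrDr lerD//.
    rewrite mulrCA ler_wpM2l ?sqn_ge0//.
    have := @expR_norm_tri (c / 2) 2 v p0 xi c2; rewrite mulfVK//; apply.
    have := ler_normB (2 * v) p0; rewrite normrM (ger0_norm (_ : 0 <= 2))//.
    by rewrite (_ : 2 * v - p0 = xi)// /v; field.
  rewrite mulrCA ler_wpM2l ?sqn_ge0//.
  have := @expR_norm_tri (c / 2) 2 u p0 xi c2; rewrite mulfVK//; apply.
  have := ler_normB (2 * u) p0; rewrite normrM (ger0_norm (_ : 0 <= 2))//.
  by rewrite (_ : 2 * u - p0 = - xi) ?normrN// /u; field.
have Lhk : L1 (hartley kk).
  apply: (L1_le mh _ (L1_abs Lh)) => xi; rewrite normrM ler_peMr// (ger0_norm (expR_ge0 _)).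
  by rewrite -[leLHS]expR0 ler_expR mulr_ge0// (ltW c2).
have cW : continuous kk by exact: continuous_rwigner_x.
have inv := hartley_inversion Lkk cW
  (fun x => rwigner_le ma mb LB x p0) Lhk.
have H' x : x1 <= x <= x2 -> hartley (hartley kk) x = 0.
  by move=> xx; rewrite inv /kk H// mulr0.
pose x := Num.max x1 (`|M| + 1).
have := hartley_zero_right mh c2 Lh x12 H' (_ : x1 <= x).
rewrite le_max lexx => /(_ isT); rewrite inv => /eqP.
rewrite mulf_eq0 gt_eqF/=; last by rewrite mulr_gt0// pi_gt0.
move=> /eqP /nodal[+ _]; apply/negP; rewrite -ltNge (lt_le_trans _ (ler_norm _))// lt_max.
by apply/orP; right; have := ler_norm M; lra.
Qed.

End no_segment.

End wigner_fourier.

(** * Chirps, and the passage to the complex Wigner function *)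

Section wigner_segment.
Context {R : realType}.
Local Notation mu := (@lebesgue_measure R).
Implicit Types a b : R -> R.

(** Since (x+s)^2 - (x-s)^2 = 4 x s, the quadratic phase contributes a phase linear in s, which
    shifts p by 4 al x. *)
Lemma rwigner_chirp a b al x p :
  rwigner (fun u => a u * cos (al * u ^+ 2) - b u * sin (al * u ^+ 2))
          (fun u => a u * sin (al * u ^+ 2) + b u * cos (al * u ^+ 2)) x p =
  rwigner a b x (p - 4 * al * x).
Proof.
apply: eq_Rintegral => s _.
have -> : (p - 4 * al * x) * s = p * s - (al * (x + s) ^+ 2 - al * (x - s) ^+ 2) by ring.
rewrite (cosB (p * s)) (sinB (p * s)) (cosB (al * _)) (sinB (al * _)).
by ring.
Qed.

Lemma sqn_chirp a b al u :
  sqn (fun u => a u * cos (al * u ^+ 2) - b u * sin (al * u ^+ 2))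
      (fun u => a u * sin (al * u ^+ 2) + b u * cos (al * u ^+ 2)) u = sqn a b u.
Proof.
rewrite /sqn -[RHS]mulr1 -(cos2Dsin2 (al * u ^+ 2)); ring.
Qed.

Lemma rwigner_no_slanted a b M x1 x2 p0 m :
  measurable_fun setT a -> measurable_fun setT b -> L1 (sqn a b) ->
  (forall x p, rwigner a b x p = 0 -> `|x| <= M /\ `|p| <= M) ->
  x1 < x2 -> ~ (forall x, x1 <= x <= x2 -> rwigner a b x (p0 + m * x) = 0).
Proof.
move=> ma mb LB nodal x12 H.
pose al := - m / 4; have mE : m = - (4 * al) by rewrite /al; field.
pose a' u := a u * cos (al * u ^+ 2) - b u * sin (al * u ^+ 2).
pose b' u := a u * sin (al * u ^+ 2) + b u * cos (al * u ^+ 2).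
have ma' : measurable_fun setT a' by rewrite /a'; mfun.
have mb' : measurable_fun setT b' by rewrite /b'; mfun.
have LB' : L1 (sqn a' b').
  by move: LB; congr (integrable _ _ _); apply/funext => u /=; rewrite sqn_chirp.
have W' x p : rwigner a' b' x p = rwigner a b x (p - 4 * al * x) by exact: rwigner_chirp.
(* The shear keeps the nodal set bounded: |p| <= |p - 4 al x| + |4 al| |x|. *)
apply: (rwigner_no_horizontal (M := M * (1 + `|4 * al|)) ma' mb' LB' (p0 := p0) _ x12).
- move=> x p; rewrite W' => /nodal[xM pM].
  have M0 : 0 <= M := le_trans (normr_ge0 _) xM.
  have q0 := normr_ge0 (4 * al); split.
    by rewrite (le_trans xM)// ler_peMr// lerDl.
  have := ler_normD (p - 4 * al * x) (4 * al * x); rewrite subrK normrM => /le_trans; apply.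
  by rewrite mulrDr mulr1 [M * _]mulrC lerD// ler_wpM2l.
- by move=> x xx; rewrite W' -mulNr -mE H.
Qed.

Lemma L2_L1_sqn (f : R -> R[i]) :
  L2 f -> L1 (sqn (fun u => cre (f u)) (fun u => cim (f u))).
Proof.
move=> [ma [mb LB]]; apply: L1P; first by rewrite /sqn; mfun.
by under eq_integral => x _ do rewrite ger0_norm ?sqn_ge0//.
Qed.

(** With tau = 2s the phase p tau / hbar becomes (2p / hbar) s; the imaginary part of the integrand
    is odd, so W is real. *)
Lemma Wigner_eq0 (hbar : R) (f : R -> R[i]) x p : 0 < hbar -> L2 f ->
  Wigner hbar f x p = 0 <->
  rwigner (fun u => cre (f u)) (fun u => cim (f u)) x (2 * p / hbar) = 0.
Proof.
move=> h0 f2; have LB := L2_L1_sqn f2; case: f2 => ma [mb _].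
set a := (fun u => cre (f u)) in ma LB *; set b := (fun u => cim (f u)) in mb LB *.
have hn0 : hbar != 0 by rewrite gt_eqF.
set q := 2 * p / hbar; have i2 : 0 < 2^-1 :> R by rewrite invr_gt0.
pose C s := a (x + s) * a (x - s) + b (x + s) * b (x - s).
pose S s := b (x + s) * a (x - s) - a (x + s) * b (x - s).
pose g tau := f (x + tau / 2) * (f (x - tau / 2))^* * expi (- (p * tau / hbar)).
have phase tau : p * tau / hbar = q * (tau / 2) by rewrite /q; field.
have gRe tau : cre (g tau) = C (tau / 2) * cos (q * (tau / 2)) + S (tau / 2) * sin (q * (tau / 2)).
  rewrite /g phase /expi cosN sinN /C /S /a /b /cre /cim.
  case: (f (x + tau / 2)) => a1 b1; case: (f (x - tau / 2)) => a2 b2 /=.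
  by ring.
have gIm tau : cim (g tau) = S (tau / 2) * cos (q * (tau / 2)) - C (tau / 2) * sin (q * (tau / 2)).
  rewrite /g phase /expi cosN sinN /C /S /a /b /cre /cim.
  case: (f (x + tau / 2)) => a1 b1; case: (f (x - tau / 2)) => a2 b2 /=.
  by ring.
have Re2 : \int[mu]_t cre (g t) = 2 * rwigner a b x q.
  have := Rint_affine 0 i2 (L1_rwigner_integrand ma mb LB x q); rewrite invrK => <-.
  by apply: eq_Rintegral => t _; rewrite gRe addr0 [2^-1 * t]mulrC.
have Im0 : \int[mu]_t cim (g t) = 0.
  apply: Rint_odd.
    have LS := L1_affine 0 i2 (L1_rwigner_integrand_im ma mb LB x q).
    by move: LS; congr (integrable _ _ _); apply/funext => t /=; rewrite gIm addr0 [2^-1 * t]mulrC.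
  by move=> t; rewrite !gIm !mulNr !mulrN cosN sinN /C /S opprK; ring.
have -> : Wigner hbar f x p = ((2 * pi * hbar)^-1)%:C%C * (2 * rwigner a b x q)%:C%C.
  by rewrite /Wigner /cintegral -/g Re2 Im0.
rewrite -rmorphM; split => [/eqP|->]; last by rewrite !mulr0.
rewrite fmorph_eq0 mulf_eq0 invr_eq0 mulf_eq0 (gt_eqF h0) mulf_eq0 (gt_eqF (pi_gt0 R)) pnatr_eq0/=.
by rewrite mulf_eq0 pnatr_eq0/= => /eqP.
Qed.

End wigner_segment.

Theorem theorem5 (R : realType) (hbar : R) (f : R -> R[i]) :
  0 < hbar -> L2 f -> nodal_bounded hbar f ->
  forall a b : R * R, a <> b ->
    ~ (forall z, segment a b z -> Wigner hbar f z.1 z.2 = 0).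
Proof.
move=> h0 f2 [M nodal].
pose re u := cre (f u); pose im u := cim (f u).
have hn0 : hbar != 0 by rewrite gt_eqF.
have q0 : 0 < 2 / hbar by rewrite divr_gt0.
have [mr [mi _]] := f2; have LB := L2_L1_sqn f2.
have W0 x p := Wigner_eq0 x p h0 f2.
(* Rescaling p multiplies its bound by 2 / hbar; the factor 1 + 2 / hbar serves both coordinates. *)
have nodal' x p : rwigner re im x p = 0 -> `|x| <= M * (1 + 2 / hbar) /\ `|p| <= M * (1 + 2 / hbar).
  move=> W; have : Wigner hbar f x (p / (2 / hbar)) = 0.
    by apply/W0; rewrite (_ : 2 * _ / hbar = p)//; field; rewrite hn0.
  move=> /(nodal (x, _))/=[xM pM]; have M0 : 0 <= M := le_trans (normr_ge0 _) xM.
  split; first by rewrite (le_trans xM)// ler_peMr// lerDl ltW.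
  move: pM; rewrite normrM normfV (gtr0_norm q0) ler_pdivrMr// => /le_trans; apply.
  by rewrite mulrDr mulr1 lerDr.
have seg_sym a b z : segment a b z -> segment b a z.
  move=> [t /andP[t0 t1] ->]; exists (1 - t); first by apply/andP; split; lra.
  by congr pair; ring.
(* The segment is oriented from left to right, or upwards when it is vertical. *)
move=> a b; wlog ab : a b / a.1 < b.1 \/ a.1 = b.1 /\ a.2 < b.2.
  move=> hwlog ab H; have [lt|lt|e1] := ltgtP a.1 b.1.
  - by apply: (hwlog a b) => //; left.
  - apply: (hwlog b a) => //; [by left|exact/nesym|by move=> z /seg_sym /H].
  - have [lt|lt|e2] := ltgtP a.2 b.2.
    + by apply: (hwlog a b) => //; right.
    + apply: (hwlog b a) => //; [by right|exact/nesym|by move=> z /seg_sym /H].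
    + by apply: ab; rewrite (surjective_pairing a) e1 e2 -surjective_pairing.
move=> _ H; case: ab => [lt|[e lt]].
- pose m := (b.2 - a.2) / (b.1 - a.1); have d0 : 0 < b.1 - a.1 by rewrite subr_gt0.
  (* The line through a and b has slope [m]; intercept and slope are multiplied by 2 / hbar to match
     the rescaled p. *)
  apply: (@rwigner_no_slanted _ re im _ a.1 b.1 (2 / hbar * (a.2 - m * a.1)) (2 / hbar * m)
    mr mi LB nodal' lt) => x /andP[ax xb].
  have dn0 : b.1 - a.1 != 0 by rewrite gt_eqF.
  rewrite (_ : _ + _ = 2 * (a.2 + m * (x - a.1)) / hbar); last by field.
  apply/W0; apply: (H (x, a.2 + m * (x - a.1))).
  exists ((x - a.1) / (b.1 - a.1)).
    by rewrite divr_ge0 ?subr_ge0 ?(ltW lt)//= ler_pdivrMr// mul1r lerD2r.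
  by rewrite /m; congr pair; field.
- have lt' : 2 * a.2 / hbar < 2 * b.2 / hbar by rewrite ltr_pM2r ?invr_gt0// ltr_pM2l.
  apply: (@rwigner_no_vertical _ re im mr mi LB _ nodal' a.1 _ _ lt') => p /andP[ap pb].
  have d0 : 0 < b.2 - a.2 by rewrite subr_gt0.
  have dn0 : b.2 - a.2 != 0 by rewrite gt_eqF.
  pose y := p * hbar / 2.
  have ay : a.2 <= y by move: ap; rewrite ler_pdivrMr// /y; lra.
  have yb : y <= b.2 by move: pb; rewrite ler_pdivlMr// /y; lra.
  rewrite (_ : p = 2 * y / hbar); last by rewrite /y; field.
  apply/W0; apply: (H (a.1, y)).
  exists ((y - a.2) / (b.2 - a.2)).
    by rewrite divr_ge0 ?subr_ge0 ?(ltW lt)//= ler_pdivrMr// mul1r lerD2r.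
  by rewrite e; congr pair; field.
Qed.
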